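(* Let $V$ be a $C_2$-cofinite vertex operator algebra of CFT-type, and let $U$ be a sub vertex operator algebra of $V$ which is isomorphic to the two-dimensional Ising model $L(\tfrac12,0)$ of central charge $\tfrac12$. Then the commutant $E=\{v\in V\mid u_mv=0\text{ for all }u\in U,\ m\ge 0\}$ of $U$ in $V$ is $C_2$-cofinite.
   Context: A vertex operator algebra (VOA) is a quadruple $(V,Y,\mathbf 1,\omega)$ over $\mathbb C$ in the usual sense, with grading $V=\bigoplus_n V_n$ by $L(0)$-weights, vertex operators $Y(v,z)=\sum_{m\in\mathbb Z}v_mz^{-m-1}$, vacuum $\mathbf 1\in V_0$ and Virasoro element $\omega\in V_2$; $\mathrm{wt}(v)=n$ for $v\in V_n$. $V$ is of CFT-type if $V=\bigoplus_{n\ge 0}V_n$ and $V_0=\mathbb C\mathbf 1$. A subVOA $U$ may have its own Virasoro element, different from that of $V$. $L(\tfrac12,0)$ is the simple Virasoro VOA of central charge $\tfrac12$. The commutant $E$ is a subVOA of $V$. For a VOA $V$ and a $V$-module $W$ put $C_2(W)=\mathrm{Span}_{\mathbb C}\{v_{-2}u\mid v\in V,\ u\in W,\ \mathrm{wt}(v)>0\}$ ($v$ homogeneous); $W$ is called $C_2$-cofinite if $\dim W/C_2(W)<\infty$. A VOA is $C_2$-cofinite if it is $C_2$-cofinite as a module over itself. *)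

(* Defs.v *)
From mathcomp Require Export all_boot all_order all_algebra.
From mathcomp Require Export boolp classical_sets functions reals.
From mathcomp Require Export complex.
Set Implicit Arguments.
Unset Strict Implicit.
Unset Printing Implicit Defensive.
Import Order.TTheory GRing.Theory Num.Theory.
Local Open Scope classical_set_scope.
Local Open Scope ring_scope.

Section LinearAlgebra.
Context (C : numFieldType) (M : lmodType C).

Definition subspace (S : set M) : Prop :=
  S 0 /\ forall (a : C) (u v : M), S u -> S v -> S (a *: u + v).

Definition lin_span (X : set M) : set M := smallest subspace X.

(* dim (S / T) is finite, for subspaces T of S *)
Definition finite_codim (S T : set M) : Prop :=
  exists s : seq M, [set` s] `<=` S /\ S `<=` lin_span (T `|` [set` s]).

End LinearAlgebra.

(* 'C(p, i) for an arbitrary integer p *)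
Definition binz (C : numFieldType) (p : int) (i : nat) : C :=
  (\prod_(j < i) (p - j%:Z)%:~R) / i`!%:R.

(* The data (V, Y, 1, omega), where V is the subset [space] of an ambient vector
   space [M], so that subalgebras are structures of the same kind.  [mode A u m]
   is the coefficient u_m of z^(-m-1) in Y(u, z); its values outside [space A]
   are irrelevant. *)
Record voa_data (C : numFieldType) (M : lmodType C) := VOAData {
  space : set M;
  mode : M -> int -> M -> M;
  vac : M;
  conf : M }.

Section VertexOperatorAlgebra.
Context (C : numFieldType) (M : lmodType C).
Implicit Types (A : voa_data M) (U S : set M).

Definition Lop A (n : int) : M -> M := mode A (conf A) (n + 1).

Definition weight_space A (n : int) : set M :=
  [set v | space A v /\ Lop A 0 v = n%:~R *: v].

Definition has_central_charge A (c : C) : Prop :=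
  forall (m n : int) (v : M), space A v ->
    Lop A m (Lop A n v) - Lop A n (Lop A m v) =
    (m - n)%:~R *: Lop A (m + n) v +
    (if m + n == 0 then ((m ^+ 3 - m)%:~R / 12%:R * c) *: v else 0).

(* The Jacobi identity, in components.  By truncation the terms vanish for large
   i, so the two infinite sums are the eventual values of the partial sums. *)
Definition borcherds_identity A (u v w : M) : Prop :=
  forall p q r : int, exists N0 : nat, forall N : nat, (N0 <= N)%N ->
    \sum_(i < N) binz C p i *: mode A (mode A u (r + i%:Z) v) (p + q - i%:Z) w =
    \sum_(i < N) ((-1) ^+ i * binz C r i) *:
       (mode A u (p + r - i%:Z) (mode A v (q + i%:Z) w)
        - (-1) ^+ `|r|%N *: mode A v (q + r - i%:Z) (mode A u (p + i%:Z) w)).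

(* The grading is by definition the one by L(0)-eigenvalues; its homogeneous
   components are therefore in direct sum, and [voa_graded] says that they span. *)
Record is_voa A : Prop := IsVOA {
  voa_subspace : subspace (space A);
  voa_closed : forall u v m, space A u -> space A v -> space A (mode A u m v);
  voa_linl : forall (a : C) u v m w, space A u -> space A v -> space A w ->
    mode A (a *: u + v) m w = a *: mode A u m w + mode A v m w;
  voa_linr : forall (a : C) u v m w, space A u -> space A v -> space A w ->
    mode A w m (a *: u + v) = a *: mode A w m u + mode A w m v;
  voa_truncation : forall u v, space A u -> space A v ->
    exists N : int, forall m : int, N <= m -> mode A u m v = 0;
  voa_vacuum : forall v m, space A v ->
    mode A (vac A) m v = if m == - 1 then v else 0;
  voa_creation : forall v, space A v -> mode A v (- 1) (vac A) = v /\
    forall m : int, 0 <= m -> mode A v m (vac A) = 0;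
  voa_jacobi : forall u v w, space A u -> space A v -> space A w ->
    borcherds_identity A u v w;
  voa_virasoro : exists c : C, has_central_charge A c;
  voa_derivative : forall v m w, space A v -> space A w ->
    mode A (Lop A (- 1) v) m w = - m%:~R *: mode A v (m - 1) w;
  voa_graded : space A `<=` lin_span (\bigcup_n weight_space A n);
  voa_fin_dim : forall n, finite_codim (weight_space A n) [set 0];
  voa_lower_bound : exists N : int, forall n : int, n < N ->
    weight_space A n `<=` [set 0];
  voa_vac_weight : weight_space A 0 (vac A);
  voa_conf_weight : weight_space A 2 (conf A) }.

Definition CFT_type A : Prop :=
  (forall n : int, n < 0 -> weight_space A n `<=` [set 0]) /\
  weight_space A 0 = [set a *: vac A | a in [set: C]].

Definition sub_data A S (w : M) : voa_data M := VOAData S (mode A) (vac A) w.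

(* The Virasoro element w of the subVOA may differ from that of A, but it has
   weight 2 in A. *)
Definition is_subvoa A S (w : M) : Prop :=
  [/\ S `<=` space A, weight_space A 2 w & is_voa (sub_data A S w)].

Definition commutant A U : set M :=
  [set v | space A v /\ forall u (m : int), U u -> 0 <= m -> mode A u m v = 0].

(* The commutant of a subVOA (U, w), with its Virasoro element omega - w.  Since
   w_1 vanishes on the commutant, weights there are the weights in A. *)
Definition commutant_voa A U (w : M) : voa_data M :=
  sub_data A (commutant A U) (conf A - w).

Definition is_ideal A S : Prop :=
  [/\ subspace S, S `<=` space A &
    forall u v m, space A u -> S v -> S (mode A u m v) /\ S (mode A v m u)].

Definition is_simple A : Prop :=
  (exists2 v, space A v & v != 0) /\
  forall S, is_ideal A S -> S = [set 0] \/ S = space A.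

Definition generated_by_conf A : Prop :=
  forall S, subspace S -> S (vac A) -> S (conf A) ->
    (forall u v m, S u -> S v -> S (mode A u m v)) -> space A `<=` S.

(* A is a model of L(c, 0) *)
Definition is_simple_Virasoro_voa A (c : C) : Prop :=
  [/\ is_voa A, has_central_charge A c, generated_by_conf A & is_simple A].

End VertexOperatorAlgebra.

Definition voa_isomorphic (C : numFieldType) (M N : lmodType C)
    (A : voa_data M) (B : voa_data N) : Prop :=
  exists f : M -> N,
    [/\ set_bij (space A) (space B) f,
        forall (a : C) u v, space A u -> space A v ->
          f (a *: u + v) = a *: f u + f v,
        forall u v m, space A u -> space A v ->
          f (mode A u m v) = mode B (f u) m (f v),
        f (vac A) = vac B &
        f (conf A) = conf B].

(* [act] is the action v |-> v_m of A on a module with underlying space W. *)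
Definition C2_space (C : numFieldType) (M N : lmodType C) (A : voa_data M)
    (W : set N) (act : M -> int -> N -> N) : set N :=
  lin_span [set x | exists (n : int) (v : M) (u : N),
    [/\ 0 < n, weight_space A n v, W u & x = act v (- 2) u]].

Definition C2_cofinite_module (C : numFieldType) (M N : lmodType C)
    (A : voa_data M) (W : set N) (act : M -> int -> N -> N) : Prop :=
  finite_codim W (C2_space A W act).

Definition C2_cofinite (C : numFieldType) (M : lmodType C) (A : voa_data M) :=
  C2_cofinite_module A (space A) (mode A).

(* Main.v *)
(* Let w be the Virasoro element of U and L(n) = w_(n+1).  The level 6 singular
   vector of the vacuum module vanishes in U, so h = L(0) satisfies
   h (16 h - 1) (2 h - 1) = 0 modulo the images of the L(-n), n > 0.  Hence V is
   the sum of three sectors V_0, V_(1/2), V_(1/16), on which L(0) has eigenvalues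
   in h + N, and the vanishing of the singular vectors of level 1 and 2 over
   primary vectors yields the Ising fusion rules.  So V is Z/2-graded with odd
   part V_(1/16), and its even part V_0 + V_(1/2) with odd part V_(1/2).

   The even part of a C2-cofinite Z/2-graded vertex algebra of CFT type is
   C2-cofinite.  Write C for the span of the v_(-2) y, v even and y odd.  Cleared
   of its poles, the correlation function a(z1) b(z2) c(z3) 1 of three odd vectors
   is killed modulo C by powers of the d/dz_i + d/dz_j, hence by a power of the
   total derivation, so that its coefficients have a derivative in C.  Spanning
   sets without repetitions extend this to all odd vectors, and the odd part of
   high weight is C.  The products a_m b of two odd vectors, modulo the v_(-2) u
   with v and u even, are then combinations, uniform in the weight N of a_m b, of
   finitely many of them; integrating by parts in these gives a linear system
   (B - N) X = 0 with B constant, whence X = 0 for large N.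

   Applied twice this gives the C2-cofiniteness of V_0.  The commutant E is the
   kernel of L(0), V_0 is generated from E by the L(-n), and the modes of E
   commute with the L(-n); so a product u_(-2) v in V_0 is in C2(E) modulo the
   images of the L(-n), which meet E trivially. *)

(* By C2-cofiniteness a vector of high weight in the even part is a sum of products u_(-2) v in
   which u and v may both be odd; re-expressing these through even factors is the difficulty. Modulo
   C an odd vector of high weight is an iterated derivative of one of fixed weight, because u_(-2) v
   with u odd and v even turns by skew symmetry into derivatives. The odd part is thus controlled
   once the derivation is locally nilpotent modulo C. On products of three odd vectors this is the
   correlation function argument. For the others the derivation is realised inside the even part:
   the mode K - 1 of omega_(-1)^K 1 acts as its K-th power up to terms v_(-1) y with v of positive
   weight. The spanning set rewrites this vector, of weight 2K, through words whose indices add up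
   to at least K + 1, one more than in the word in omega. The mode K - 1 of such an even word yields
   only terms of the same kind, and words with odd letters lead back to products of three odd
   vectors. After iteration the even factors v merge into a single one of weight above P, to which
   C2-cofiniteness of V applies again. *)
Require Import Defs.
From HB Require Import structures.
From mathcomp Require Import ring zify.
Import Order.TTheory GRing.Theory Num.Theory.
Set Implicit Arguments.
Unset Strict Implicit.
Unset Printing Implicit Defensive.
Local Open Scope classical_set_scope.
Local Open Scope ring_scope.

(** * Linear combinations *)

Section LinearCombination.
Context (C : comNzRingType) (M : lmodType C).

(** Syntax for deciding module equalities by reflection: two combinations of the same atoms agree
    once their coefficients do, and each coefficient gives one equality in [C], left to [ring] or
    [field]. Atoms are compared by [Nat.eqb] so that [cbv] evaluates the test. *)
Inductive lexp :=
  LAtom of nat | LZero | LAdd of lexp & lexp | LOpp of lexp | LScale of C & lexp.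

Fixpoint leval (e : seq M) (t : lexp) : M :=
  match t with
  | LAtom n => nth 0 e n
  | LZero => 0
  | LAdd a b => leval e a + leval e b
  | LOpp a => - leval e a
  | LScale c a => c *: leval e a
  end.

Fixpoint lcoef (n : nat) (t : lexp) : C :=
  match t with
  | LAtom m => if Nat.eqb m n then 1 else 0
  | LZero => 0
  | LAdd a b => lcoef n a + lcoef n b
  | LOpp a => - lcoef n a
  | LScale c a => c * lcoef n a
  end.

Lemma levalE e t : leval e t = \sum_(i < size e) lcoef i t *: nth 0 e i.
Proof.
elim: t => /= [n||a -> b ->|a ->|c a ->].
- have [lt_n|le_n] := ltnP n (size e).
    rewrite (bigD1 (Ordinal lt_n)) //= (introT (PeanoNat.Nat.eqb_spec n n)) //.
    rewrite scale1r big1 ?addr0 // => i ne_in.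
    case: PeanoNat.Nat.eqb_spec => [E|_]; last by rewrite scale0r.
    by case/eqP: ne_in; apply/val_inj.
  rewrite nth_default // big1 // => i _.
  case: PeanoNat.Nat.eqb_spec => [E|_]; last by rewrite scale0r.
  by rewrite E in le_n; have := ltn_ord i; rewrite ltnNge le_n.
- by rewrite big1 // => i _; rewrite scale0r.
- by rewrite -big_split; apply: eq_bigr => i _; rewrite scalerDl.
- by rewrite -sumrN; apply: eq_bigr => i _; rewrite scaleNr.
- by rewrite scaler_sumr; apply: eq_bigr => i _; rewrite scalerA.
Qed.

Fixpoint lcheck (n : nat) (a b : lexp) : Prop :=
  match n with
  | 0 => True
  | n.+1 => lcoef n a = lcoef n b /\ lcheck n a b
  end.

Lemma leval_eq e a b : lcheck (size e) a b -> leval e a = leval e b.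
Proof.
move=> H; rewrite !levalE; apply: eq_bigr => -[i /= lt_i] _; congr (_ *: _).
elim: (size e) H lt_i => //= n IHn [E H]; rewrite ltnS leq_eqVlt.
by case/orP => [/eqP -> //|]; apply: IHn.
Qed.

End LinearCombination.

(** [constr_eq] is a tactic and not a term; the inner match runs it while the term is being built,
    and its failure selects the next branch. *)
Ltac lm_mem x l :=
  lazymatch l with
  | nil => constr:(false)
  | ?y :: ?l' =>
    let r := match constr:(tt) with
      | _ => let _ := match constr:(tt) with _ => constr_eq x y end in constr:(true)
      | _ => lm_mem x l' end in r
  end.
Ltac lm_atoms C M t l :=
  lazymatch t with
  | GRing.add ?a ?b => let l := lm_atoms C M a l in lm_atoms C M b l
  | GRing.opp ?a => lm_atoms C M a l
  | GRing.scale _ ?a => lm_atoms C M a l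
  | GRing.natmul ?a _ => lm_atoms C M a l
  | GRing.zero => l
  | _ => let b := lm_mem t l in
    lazymatch b with true => l | false => constr:(cons t l) end
  end.
Ltac lm_index x l :=
  lazymatch l with
  | ?y :: ?l' =>
    let r := match constr:(tt) with
      | _ => let _ := match constr:(tt) with _ => constr_eq x y end in constr:(O)
      | _ => let n := lm_index x l' in constr:(S n) end in r
  end.
Ltac lm_reify C M t l :=
  lazymatch t with
  | GRing.add ?a ?b =>
    let a := lm_reify C M a l in let b := lm_reify C M b l in
    constr:(@LAdd C a b)
  | GRing.opp ?a => let a := lm_reify C M a l in constr:(@LOpp C a)
  | GRing.scale ?c ?a => let a := lm_reify C M a l in constr:(@LScale C c a)
  | GRing.zero => constr:(@LZero C)
  | _ => let n := lm_index t l in constr:(@LAtom C n)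
  end.
(* Decides equalities of linear combinations by comparing coefficients. *)
Ltac lmod_with C tac :=
  rewrite -?scaler_nat;
  lazymatch goal with
  | |- @eq ?T ?u ?v =>
    let l := lm_atoms C T u (@nil T) in
    let l := lm_atoms C T v l in
    let a := lm_reify C T u l in
    let b := lm_reify C T v l in
    refine (@leval_eq C _ l a b _);
    cbv [lcheck lcoef size Nat.eqb];
    repeat split; tac
  end.
Tactic Notation "lmod" constr(C) := lmod_with C ltac:(try ring).

(** * Subspaces, spans and eigenvectors *)

Section Subspaces.
Context (C : numFieldType) (M : lmodType C).
Implicit Types (S X : set M) (f : M -> M).

Lemma sub0 S : subspace S -> S 0. Proof. by case. Qed.

Lemma subZ S a u : subspace S -> S u -> S (a *: u).
Proof. by case=> S0 SD Su; rewrite -[_ *: _]addr0; apply: SD. Qed.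

Lemma subD S u v : subspace S -> S u -> S v -> S (u + v).
Proof. by case=> S0 SD Su Sv; rewrite -[u]scale1r; apply: SD. Qed.

Lemma subN S u : subspace S -> S u -> S (- u).
Proof. by move=> sS Su; rewrite -scaleN1r; apply: subZ. Qed.

Lemma subB S u v : subspace S -> S u -> S v -> S (u - v).
Proof. by move=> sS Su Sv; apply: subD => //; apply: subN. Qed.

Lemma sub_sum S (I : Type) (r : seq I) (P : pred I) (F : I -> M) :
  subspace S -> (forall i, P i -> S (F i)) -> S (\sum_(i <- r | P i) F i).
Proof.
move=> sS SF; elim/big_ind: _ => //; first exact: sub0.
by move=> u v; apply: subD.
Qed.

Lemma subBl S u v : subspace S -> S v -> S (u - v) -> S u.
Proof. by move=> sS Sv Su; rewrite -[u](subrK v); apply: subD. Qed.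

Lemma sub_congr S u v : subspace S -> S (u - v) -> S v -> S u.
Proof. by move=> sS Suv Sv; apply: (subBl sS Sv). Qed.

Lemma span_sub X : subspace (lin_span X).
Proof.
split=> [A [[A0 _] _]//|a u v Hu Hv A hA].
by case: (hA) => [[_ AD] _]; apply: AD; [apply: Hu|apply: Hv].
Qed.

Lemma span_incl X : X `<=` lin_span X.
Proof. by move=> u Xu A [_]; apply. Qed.

Lemma span_min X S : subspace S -> X `<=` S -> lin_span X `<=` S.
Proof. by move=> sS XS u; apply. Qed.

Lemma span_mono X X' : X `<=` X' -> lin_span X `<=` lin_span X'.
Proof.
by move=> XX'; apply: span_min (span_sub _) _ => u /XX'; apply: span_incl.
Qed.

Lemma set0_sub : subspace [set 0 : M].
Proof. by split=> // a u v -> ->; rewrite /= scaler0 addr0. Qed.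

Lemma setI_sub S S' : subspace S -> subspace S' -> subspace (S `&` S').
Proof.
move=> [S0 SD] [S'0 S'D]; split=> // a u v [Su S'u] [Sv S'v].
by split; [apply: SD|apply: S'D].
Qed.

Definition sum_set S S' : set M := [set x | exists u v, [/\ S u, S' v & x = u + v]].

Lemma sum_set_sub S S' : subspace S -> subspace S' -> subspace (sum_set S S').
Proof.
move=> sS sS'; split; first by exists 0, 0; rewrite addr0; split=> //; exact: sub0.
move=> a _ _ [u [v [Su Sv ->]]] [u' [v' [Su' Sv' ->]]].
exists (a *: u + u'), (a *: v + v'); split; [exact: sS.2|exact: sS'.2|].
by rewrite scalerDr addrACA.
Qed.

Lemma sum_setl S S' u : subspace S' -> S u -> sum_set S S' u.
Proof. by move=> sS' Su; exists u, 0; rewrite addr0; split=> //; apply: sub0. Qed.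

Lemma sum_setr S S' u : subspace S -> S' u -> sum_set S S' u.
Proof. by move=> sS Su; exists 0, u; rewrite add0r; split=> //; apply: sub0. Qed.

(** The generators in [S'] contribute a component in [S'], which must vanish for a vector of [S].
    This discards generators of the wrong parity or of the wrong eigenvalue. *)
Lemma span_split X S S' : subspace S -> subspace S' -> X `<=` S `|` S' ->
  S `&` S' `<=` [set 0] -> S `&` lin_span X `<=` lin_span (X `&` S).
Proof.
move=> sS sS' XSS' SS' x [Sx].
have sI T : subspace (lin_span (X `&` T)) by exact: span_sub.
have H : X `<=` sum_set (lin_span (X `&` S)) (lin_span (X `&` S')).
  move=> u Xu; case: (XSS' _ Xu) => Su.
    by apply: (sum_setl (sI _)); apply: span_incl; split.
  by apply: (sum_setr (sI _)); apply: span_incl; split.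
move=> /(span_min (sum_set_sub (sI _) (sI _)) H) [u [v [Hu Hv E]]].
have Su : S u by apply: (span_min sS) Hu => ? [].
have Sv : S' v by apply: (span_min sS') Hv => ? [].
have -> // : x = u.
apply/eqP; rewrite -subr_eq0; apply/eqP/SS'; split; first exact: subB.
by rewrite E addrC addKr.
Qed.

Definition lin f := forall (a : C) u v, f (a *: u + v) = a *: f u + f v.

Lemma linD f u v : lin f -> f (u + v) = f u + f v.
Proof. by move=> lf; rewrite -[u in LHS]scale1r lf scale1r. Qed.

Lemma lin0 f : lin f -> f 0 = 0.
Proof. by move=> lf; apply: (addrI (f 0)); rewrite -(linD _ _ lf) !addr0. Qed.

Lemma linZ f a u : lin f -> f (a *: u) = a *: f u.
Proof. by move=> lf; rewrite -[a *: u]addr0 lf (lin0 lf) addr0. Qed.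

Lemma linN f u : lin f -> f (- u) = - f u.
Proof. by move=> lf; rewrite -scaleN1r (linZ _ _ lf) scaleN1r. Qed.

Lemma linB f u v : lin f -> f (u - v) = f u - f v.
Proof. by move=> lf; rewrite linD // linN. Qed.

Lemma preim_sub f S : lin f -> subspace S -> subspace [set u | S (f u)].
Proof.
move=> lf sS; split=> [|a u v Su Sv] /=; first by rewrite (lin0 lf); apply: sub0.
by rewrite lf; apply: sS.2.
Qed.

Lemma span_lin f X S : lin f -> subspace S -> (forall u, X u -> S (f u)) ->
  forall u, lin_span X u -> S (f u).
Proof. by move=> lf sS XS; apply: span_min; [apply: preim_sub|]. Qed.

Definition eig f (c : C) : set M := [set v | f v = c *: v].

Lemma eig_sub f c : lin f -> subspace (eig f c).
Proof.
move=> lf; split=> [|a u v Eu Ev]; rewrite /eig /=.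
  by rewrite (lin0 lf) scaler0.
by rewrite lf Eu Ev scalerDr !scalerA mulrC.
Qed.

(** The polynomial in [f] with root list [s], applied to v. *)
Definition mul_out f (s : seq C) (v : M) := foldr (fun e x => f x - e *: x) v s.

Lemma mul_out_lin f s : lin f -> lin (mul_out f s).
Proof.
by move=> lf a u v; elim: s => //= e s ->; rewrite lf; lmod C.
Qed.

Lemma mul_outC f s e v : lin f ->
  mul_out f s (f v - e *: v) = f (mul_out f s v) - e *: mul_out f s v.
Proof.
move=> lf; elim: s => //= d s ->; rewrite !(linB _ _ lf) !(linZ _ _ lf); lmod C.
Qed.

Lemma mul_out_cat f s s' v : lin f ->
  mul_out f s v = 0 -> mul_out f (s ++ s') v = 0.
Proof.
move=> lf E; elim: s' s E => [|e s' IH] s E; first by rewrite cats0.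
rewrite -cat_rcons; apply: IH.
rewrite -cats1 /mul_out foldr_cat /= -/(mul_out f s _) mul_outC // E lin0 //.
by rewrite scaler0 subr0.
Qed.

Lemma mul_out_eig f s c v : lin f -> f v = c *: v ->
  mul_out f s v = (\prod_(e <- s) (c - e)) *: v.
Proof.
move=> lf E; elim: s => [|e s IH] /=; first by rewrite big_nil scale1r.
by rewrite big_cons IH (linZ _ _ lf) E; lmod C.
Qed.

(** The factors f - e commute, so concatenating the root lists of two vectors gives a polynomial
    killing both. *)
Lemma span_annihilated f (P : pred C) X : lin f ->
  (forall v, X v -> exists2 c, P c & f v = c *: v) ->
  forall v, lin_span X v -> exists2 s, all P s & mul_out f s v = 0.
Proof.
move=> lf HX; apply: span_min.
  split=> [|a u v [s Ps us] [s' Ps' vs']].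
    by exists [::].
  exists (s ++ s'); first by rewrite all_cat Ps Ps'.
  rewrite mul_out_lin // mul_out_cat // scaler0 add0r.
  rewrite /mul_out foldr_cat -/(mul_out f s' v) vs' -/(mul_out f s 0).
  exact: (lin0 (mul_out_lin s lf)).
move=> v /HX [c Pc E]; exists [:: c]; rewrite /= ?Pc //.
by rewrite E subrr.
Qed.

(** A vector in the span is killed by a polynomial in [f] none of whose roots is c; on a
    c-eigenvector this polynomial is multiplication by a nonzero scalar. *)
Lemma eig_span_neq f c : lin f ->
  eig f c `&` lin_span [set v | exists2 d, d != c & f v = d *: v] `<=` [set 0].
Proof.
move=> lf v [Ev].
move=> /(span_annihilated (P := fun d => d != c) lf (fun _ H => H)) [s Ps].
rewrite (mul_out_eig _ lf Ev) => /eqP; rewrite scaler_eq0 => /orP[|/eqP //].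
rewrite prodf_seq_eq0 => /hasP[d ds /= E].
by have := allP Ps _ ds; rewrite -subr_eq0 -opprB oppr_eq0 E.
Qed.

Lemma eig_disjoint f c d v : lin f -> c != d -> eig f c v -> eig f d v -> v = 0.
Proof.
move=> lf cd Ec Ed; apply: (eig_span_neq (c := c) lf); split=> //.
by apply: span_incl; exists d => //; rewrite eq_sym.
Qed.

Lemma eig_span f c X : lin f -> (forall v, X v -> exists d, eig f d v) ->
  eig f c `&` lin_span X `<=` lin_span (X `&` eig f c).
Proof.
move=> lf HX; pose B := lin_span [set v | exists2 d, d != c & f v = d *: v].
apply: (@span_split X _ B); [exact: eig_sub|exact: span_sub| |exact: eig_span_neq].
move=> v Xv; have [d Ed] := HX _ Xv; have [<-|dc] := eqVneq d c; [by left|right].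
by apply: span_incl; exists d.
Qed.

End Subspaces.

(** * Generalized binomial coefficients *)

Section Binomials.
Context (C : numFieldType).
Implicit Type p : int.
Local Notation binz := (binz C).

Lemma binz0 p : binz p 0 = 1.
Proof. by rewrite /binz big_ord0 fact0 divr1. Qed.

Lemma binzS p i : binz p i.+1 = binz p i * (p - i%:Z)%:~R / i.+1%:R.
Proof.
rewrite /binz big_ord_recr /= factS natrM invfM.
move: (\prod_(_ < _) _) (i.+1%:R^-1) (i`!%:R^-1) => a b c; ring.
Qed.

Lemma binz1 p : binz p 1 = p%:~R.
Proof. by rewrite binzS binz0 mul1r subr0 divr1. Qed.

Lemma natS_neq0 i : i.+1%:R != 0 :> C.
Proof. by rewrite pnatr_eq0. Qed.

Lemma binz_pascal p i : binz (p + 1) i.+1 = binz p i.+1 + binz p i.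
Proof.
elim: i => [|i IH]; first by rewrite !binz1 binz0 rmorphD.
rewrite binzS IH [binz p i.+2]binzS [binz p i.+1]binzS.
have := natS_neq0 i; have := natS_neq0 i.+1.
rewrite -[i.+2]addn2 -[i.+1]addn1 !natrD !PoszD !rmorphB !rmorphD /=.
rewrite -!pmulrn => h2 h1; field; rewrite ?h1 ?h2 //.
Qed.

Lemma binz0S i : binz 0 i.+1 = 0.
Proof.
elim: i => [|i IH]; first by rewrite binz1.
by rewrite binzS IH mul0r mul0r.
Qed.

Lemma binzN1 i : binz (- 1) i = (-1) ^+ i.
Proof.
elim: i => [|i IH]; first exact: binz0.
rewrite binzS IH exprS; have := natS_neq0 i.
rewrite -[i.+1]addn1 natrD rmorphB rmorphN /= -pmulrn => h; field; exact: h.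
Qed.

Lemma binz_nat n i : (n < i)%N -> binz n%:Z i = 0.
Proof.
move=> lt_ni; rewrite /binz (bigD1 (Ordinal lt_ni)) //= subrr.
by rewrite !mul0r.
Qed.

End Binomials.

(** * Vertex algebras *)

(** The axioms on a whole module, free of membership conditions; gradings and conformal vectors are
    added separately. The algebras of the statement, which live on subsets, are carried to modules
    at the end. *)
Record vertex_algebra (C : numFieldType) (V : lmodType C)
    (Y : V -> int -> V -> V) (one : V) : Prop := VertexAlgebra {
  va_linl : forall m w, lin (fun u => Y u m w);
  va_linr : forall w m, lin (Y w m);
  va_trunc : forall u v, exists N : int, forall m : int, N <= m -> Y u m v = 0;
  va_vac : forall v m, Y one m v = if m == - 1 then v else 0;
  va_creat : forall v, Y v (- 1) one = v;
  va_annih : forall v m, 0 <= m -> Y v m one = 0;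
  va_jacobi : forall u v w (p q r : int), exists N0 : nat, forall N : nat, (N0 <= N)%N ->
    \sum_(i < N) binz C p i *: Y (Y u (r + i%:Z) v) (p + q - i%:Z) w =
    \sum_(i < N) ((-1) ^+ i * binz C r i) *:
       (Y u (p + r - i%:Z) (Y v (q + i%:Z) w)
        - (-1) ^+ `|r|%N *: Y v (q + r - i%:Z) (Y u (p + i%:Z) w)) }.

Section VertexAlgebraTheory.
Context (C : numFieldType) (V : lmodType C) (Y : V -> int -> V -> V) (one : V).
Hypothesis VA : vertex_algebra Y one.
Implicit Types (u v w : V) (S : set V) (n m p q r : int).

Lemma Y0l n v : Y 0 n v = 0.
Proof. exact: (lin0 (va_linl VA n v)). Qed.

Lemma Y0r u n : Y u n 0 = 0.
Proof. exact: (lin0 (va_linr VA u n)). Qed.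

(** The Jacobi identity with r = 0, where only the term of index 0 is left on the right side. The
    case p = 0 gives [iterate] in the same way. *)
Lemma commutator u v w p q : exists N0 : nat, forall N : nat, (N0 <= N)%N ->
  Y u p (Y v q w) - Y v q (Y u p w) =
  \sum_(i < N) binz C p i *: Y (Y u i%:Z v) (p + q - i%:Z) w.
Proof.
have [N0 H] := va_jacobi VA u v w p q 0; exists N0.+1 => -[//|N] le_N.
have := H N.+1 (ltnW le_N); under eq_bigr => i _ do rewrite add0r.
move=> ->; rewrite big_ord_recl big1 => [|i _]; last first.
  by rewrite lift0 binz0S mulr0 scale0r.
by rewrite binz0 expr0 mulr1 scale1r /= !addr0 [X in _ = _ - X]scale1r.
Qed.

Lemma iterate u v w r q : exists N0 : nat, forall N : nat, (N0 <= N)%N ->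
  Y (Y u r v) q w = \sum_(i < N) ((-1) ^+ i * binz C r i) *:
    (Y u (r - i%:Z) (Y v (q + i%:Z) w)
     - (-1) ^+ `|r|%N *: Y v (q + r - i%:Z) (Y u i%:Z w)).
Proof.
have [N0 H] := va_jacobi VA u v w 0 q r; exists N0.+1 => -[//|N] le_N.
have := H N.+1 (ltnW le_N); rewrite big_ord_recl big1 => [|i _]; last first.
  by rewrite lift0 binz0S scale0r.
rewrite binz0 scale1r /= !addr0 add0r => ->.
by apply: eq_bigr => i _; rewrite !add0r.
Qed.

(** Membership in a subspace is checked term by term, so that the length of the sum and its
    coefficients never appear. Most arguments below use the Jacobi identity only through this form
    and [iterate_in]. *)
Lemma commutator_in S u v w p q : subspace S ->
  (forall i : nat, S (Y (Y u i%:Z v) (p + q - i%:Z) w)) ->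
  S (Y u p (Y v q w) - Y v q (Y u p w)).
Proof.
move=> sS H; have [N /(_ _ (leqnn N)) ->] := commutator u v w p q.
by apply: sub_sum => // i _; apply: subZ.
Qed.

Lemma iterate_in S u v w r q : subspace S ->
  (forall i : nat, S (Y u (r - i%:Z) (Y v (q + i%:Z) w))) ->
  (forall i : nat, S (Y v (q + r - i%:Z) (Y u i%:Z w))) ->
  S (Y (Y u r v) q w).
Proof.
move=> sS H1 H2; have [N /(_ _ (leqnn N)) ->] := iterate u v w r q.
by apply: sub_sum => // i _; apply: subZ => //; apply: subB => //; apply: subZ.
Qed.

Definition der v := Y v (- 2) one.

Lemma der_lin : lin der. Proof. exact: (va_linl VA). Qed.

(** Skew symmetry, from the Jacobi identity for v, u, 1 with p = -1, q = 0, r = n: nonnegative modes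
    kill the vacuum, so the right side reduces to u_n v up to sign. *)
Lemma skew_in S u v n : subspace S ->
  (forall i : nat, S (Y (Y v (n + i%:Z) u) (- 1 - i%:Z) one)) -> S (Y u n v).
Proof.
move=> sS H; have [N0 E] := va_jacobi VA v u one (- 1) 0 n.
have {E} := E N0.+1 (leqnSn _); rewrite [RHS]big_ord_recl [X in _ = _ + X]big1 => [|i _]; last first.
  rewrite lift0 (va_annih VA u) // Y0r (va_annih VA v); last by lia.
  by rewrite Y0r scaler0 subr0 scaler0.
rewrite (va_annih VA u) ?addr0 // Y0r (va_creat VA) binz0 expr0 mulr1 scale1r.
rewrite !add0r => E.
suff : S (- ((-1) ^+ `|n|%N *: Y u n v)).
  move=> /(subZ (- (-1) ^+ `|n|%N) sS); rewrite scalerN scaleNr opprK scalerA.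
  by rewrite -exprD addnn -mul2n exprM sqrrN expr1n expr1n scale1r.
rewrite -E; apply: sub_sum => // i _; apply: subZ => //.
Qed.

Lemma der_one : der one = 0.
Proof. by rewrite /der (va_vac VA). Qed.

(** In the iterate formula for v_(-2) 1 the vacuum leaves at most one term: the one of index -1 - n
    if n < 0, of index n - 1 if n > 0, and none if n = 0. The bound on the sum is taken large enough
    to contain it. *)
Lemma Y_der v n w : Y (der v) n w = - n%:~R *: Y v (n - 1) w.
Proof.
have [N0 E] := iterate v one w (- 2) n.
have {E} := E (N0 + `|n| + 2)%N; rewrite -addnA leq_addr => /(_ isT).
rewrite -/(der v) => ->.
have b2 i : (-1) ^+ i * binz C (-2) i = i.+1%:R.
  elim: i => [|i IH]; first by rewrite binz0 mulr1.
  have hi := natS_neq0 C i.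
  have -> : (-1) ^+ i.+1 * binz C (- 2) i.+1 =
     ((-1) ^+ i * binz C (-2) i) * ((2 + i)%:R / i.+1%:R).
    rewrite binzS exprS rmorphB rmorphN /= -!pmulrn natrD.
    by field; move: hi; rewrite -natr1 addrC.
  by rewrite IH add2n; field; move: hi; rewrite -natr1 addrC.
have [lt0|le0] := ltrP n 0.
  have hn : n = - 1 - `|n|.-1%:Z by lia.
  have lt_n : (`|n|.-1 < N0 + (`|n| + 2))%N by lia.
  rewrite (bigD1 (Ordinal lt_n)) //= big1 => [|i ne_i]; last first.
    rewrite !(va_vac VA) ifF ?ifF ?Y0r ?scaler0 ?subr0 ?scaler0 //; first lia.
    by apply/negP => /eqP E; case/eqP: ne_i; apply/val_inj => /=; lia.
  rewrite addr0 b2 !(va_vac VA) ifT ?ifF; [|lia|lia].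
  rewrite scaler0 subr0 (_ : -2 - _ = n - 1); last by lia.
  congr (_ *: _); rewrite -rmorphN /= pmulrn; congr (_ %:~R); lia.
have [->|n0] := eqVneq n 0.
  rewrite oppr0 scale0r big1 // => i _.
  by rewrite !(va_vac VA) !ifF ?Y0r ?scaler0 ?subr0 ?scaler0 //; lia.
have lt_n : (`|n|.-1 < N0 + (`|n| + 2))%N by lia.
rewrite (bigD1 (Ordinal lt_n)) //= big1 => [|i ne_i]; last first.
  rewrite !(va_vac VA) ifF ?ifF ?Y0r ?scaler0 ?subr0 ?scaler0 //; last lia.
  by apply/negP => /eqP E; case/eqP: ne_i; apply/val_inj => /=; lia.
rewrite addr0 b2 !(va_vac VA) ifF ?ifT; [|lia|lia].
rewrite Y0r sub0r expr2 mulrNN mulr1 scale1r (_ : Posz `|n|.-1 = n - 1); last by lia.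
rewrite scalerN scaleNr; congr (- (_ *: _)).
by rewrite pmulrn; congr (_ %:~R); lia.
Qed.

Lemma der_Y u n v : der (Y u n v) = Y u n (der v) - n%:~R *: Y u (n - 1) v.
Proof.
rewrite /der; have [N0 /(_ _ (leq_addr 2 N0)) ->] := iterate u v one n (- 2).
rewrite addn2 !big_ord_recl big1 => [|i _]; last first.
  rewrite !lift0 (va_annih VA v) // Y0r (va_annih VA u) // Y0r scaler0 subr0.
  by rewrite scaler0.
rewrite !(va_annih VA u) // !Y0r !scaler0 !subr0 lift0 /= binz0 binz1 addr0.
by rewrite (_ : - 2 + 1 = - 1) // (va_creat VA) mulr1 scale1r mulN1r scaleNr.
Qed.

Lemma Y_creat_der v j : j`!%:R *: Y v (- 1 - j%:Z) one = iter j der v.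
Proof.
elim: j v => [|j IH] v; first by rewrite subr0 (va_creat VA) scale1r.
rewrite iterSr -IH Y_der scalerA factS natrM mulrC; congr (_ * _ *: Y _ _ _).
  by rewrite -rmorphN /= pmulrn; congr (_ %:~R); lia.
by lia.
Qed.

Lemma Y_creat v j : Y v (- 1 - j%:Z) one = j`!%:R^-1 *: iter j der v.
Proof.
by rewrite -Y_creat_der scalerA mulVf ?scale1r // pnatr_eq0 -lt0n fact_gt0.
Qed.

(** Through this, a subspace defined by products v_(-2) w contains all the v_n w with n at most -2,
    as soon as the vectors v allowed are stable under the derivation. *)
Lemma Y_low v j w : exists c : C, Y v (- 1 - j%:Z) w = c *: Y (iter j der v) (- 1) w.
Proof.
elim: j v => [|j IH] v; first by exists 1; rewrite subr0 scale1r.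
have [c] := IH (der v); rewrite Y_der -iterSr => E.
exists ((1 + j%:R)^-1 * c); rewrite -scalerA -E scalerA.
have -> : - (- 1 - j%:Z)%:~R = 1 + j%:R :> C.
  by rewrite -rmorphN opprB rmorphB rmorphN /= opprK addrC.
rewrite mulVf ?scale1r; first by congr Y; lia.
by rewrite addrC natr1 pnatr_eq0.
Qed.

End VertexAlgebraTheory.

(** * Three-point functions *)

Section Difference.
Context (C : numFieldType) (V : lmodType C).
Implicit Types (f g : int -> int -> int -> V) (k l m n : int).

(* f l m n is the coefficient of z1^(-l-1) z2^(-m-1) z3^(-n-1) of a formal series:
   M_ij is the multiplication by z_i - z_j and D_i the derivation d/dz_i. *)
Definition M12 f : int -> int -> int -> V := fun l m n => f (l + 1) m n - f l (m + 1) n.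
Definition M13 f : int -> int -> int -> V := fun l m n => f (l + 1) m n - f l m (n + 1).
Definition M23 f : int -> int -> int -> V := fun l m n => f l (m + 1) n - f l m (n + 1).
Definition D1 f : int -> int -> int -> V := fun l m n => - (l%:~R *: f (l - 1) m n).
Definition D2 f : int -> int -> int -> V := fun l m n => - (m%:~R *: f l (m - 1) n).
Definition D3 f : int -> int -> int -> V := fun l m n => - (n%:~R *: f l m (n - 1)).
Definition addf f g : int -> int -> int -> V := fun l m n => f l m n + g l m n.
Definition D12 f := addf (D1 f) (D2 f).
Definition D13 f := addf (D1 f) (D3 f).
Definition D23 f := addf (D2 f) (D3 f).
Definition D123 f := addf (D1 f) (addf (D2 f) (D3 f)).
Definition scalf (c : C) f : int -> int -> int -> V := fun l m n => c *: f l m n.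
Definition swap12 f : int -> int -> int -> V := fun l m n => f m l n.
Definition swap23 f : int -> int -> int -> V := fun l m n => f l n m.

Lemma funext3 f g : (forall l m n, f l m n = g l m n) -> f = g.
Proof. by move=> H; apply/funext => l; apply/funext => m; apply/funext => n. Qed.

Lemma iter_commute (T : Type) (A B : T -> T) i j x :
  (forall x, A (B x) = B (A x)) -> iter i A (iter j B x) = iter j B (iter i A x).
Proof.
move=> AB; have AjB y : A (iter j B y) = iter j B (A y).
  by elim: j => //= j IH; rewrite AB IH.
by elim: i => //= i ->.
Qed.

Lemma M1213 f : M12 (M13 f) = M13 (M12 f).
Proof. by apply: funext3 => l m n; rewrite /M12 /M13; lmod C. Qed.
Lemma M1223 f : M12 (M23 f) = M23 (M12 f).
Proof. by apply: funext3 => l m n; rewrite /M12 /M23; lmod C. Qed.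
Lemma M1323 f : M13 (M23 f) = M23 (M13 f).
Proof. by apply: funext3 => l m n; rewrite /M13 /M23; lmod C. Qed.

Ltac diffD := apply: funext3 => l m n;
  rewrite /D123 /D12 /D13 /D23 /addf /D1 /D2 /D3 /M12 /M13 /M23 /= ?rmorphD ?rmorphB /=
    ?addrK ?subrK ?rmorph1; lmod C.

Lemma D123M12 f : D123 (M12 f) = M12 (D123 f). Proof. by diffD. Qed.
Lemma D123M13 f : D123 (M13 f) = M13 (D123 f). Proof. by diffD. Qed.
Lemma D123M23 f : D123 (M23 f) = M23 (D123 f). Proof. by diffD. Qed.
Lemma D12M12 f : D12 (M12 f) = M12 (D12 f). Proof. by diffD. Qed.
Lemma D1213 f : D12 (D13 f) = D13 (D12 f). Proof. by diffD. Qed.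
Lemma D1223 f : D12 (D23 f) = D23 (D12 f). Proof. by diffD. Qed.
Lemma D1323 f : D13 (D23 f) = D23 (D13 f). Proof. by diffD. Qed.

Lemma D123_sum f : D123 f = scalf 2^-1 (addf (D12 f) (addf (D13 f) (D23 f))).
Proof.
apply: funext3 => l m n; rewrite /D123 /D12 /D13 /D23 /scalf /addf.
by lmod_with C ltac:(field).
Qed.

Lemma D123_lin c f g : D123 (scalf c (addf f g)) = scalf c (addf (D123 f) (D123 g)).
Proof.
apply: funext3 => l m n; rewrite /D123 /scalf /addf /D1 /D2 /D3; lmod C.
Qed.

Lemma iterD123_lin j c f g :
  iter j D123 (scalf c (addf f g)) = scalf c (addf (iter j D123 f) (iter j D123 g)).
Proof. by elim: j => //= j ->; rewrite D123_lin. Qed.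

Lemma iterD123_add j f g :
  iter j D123 (addf f g) = addf (iter j D123 f) (iter j D123 g).
Proof.
have scal1 h : scalf 1 h = h by apply: funext3 => l m n; rewrite /scalf scale1r.
by rewrite -[addf f g]scal1 iterD123_lin scal1.
Qed.

Lemma iter_swap (A B : (int -> int -> int -> V) -> int -> int -> int -> V) s i f :
  (forall f, A (s f) = s (B f)) -> iter i A (s f) = s (iter i B f).
Proof. by move=> H; elim: i => //= i ->. Qed.

Lemma M13_swap12 f : M13 (swap12 f) = swap12 (M23 f). Proof. by []. Qed.
Lemma M23_swap12 f : M23 (swap12 f) = swap12 (M13 f). Proof. by []. Qed.
Lemma M12_swap23 f : M12 (swap23 f) = swap23 (M13 f). Proof. by []. Qed.
Lemma M13_swap23 f : M13 (swap23 f) = swap23 (M12 f). Proof. by []. Qed.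

Lemma iterM_sign (A B s : (int -> int -> int -> V) -> int -> int -> int -> V) r f :
  (forall c f, A (scalf c (s f)) = scalf (- c) (s (B f))) ->
  iter r A (s f) = scalf ((-1) ^+ r) (s (iter r B f)).
Proof.
move=> H; elim: r => [|r /= ->]; last by rewrite H exprS mulN1r.
by apply: funext3 => l m n; rewrite /scalf scale1r.
Qed.

Lemma M12_swap12 r f : iter r M12 (swap12 f) = scalf ((-1) ^+ r) (swap12 (iter r M12 f)).
Proof.
apply: iterM_sign => c g; apply: funext3 => l m n.
by rewrite /M12 /scalf /swap12; lmod C.
Qed.

Lemma M23_swap23 r f : iter r M23 (swap23 f) = scalf ((-1) ^+ r) (swap23 (iter r M23 f)).
Proof.
apply: iterM_sign => c g; apply: funext3 => l m n.
by rewrite /M23 /scalf /swap23; lmod C.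
Qed.

Lemma iter_scalf A r c f : (forall c f, A (scalf c f) = scalf c (A f)) ->
  iter r A (scalf c f) = scalf c (iter r A f).
Proof. by move=> H; elim: r => //= r ->. Qed.

Lemma M12_scalf c f : M12 (scalf c f) = scalf c (M12 f).
Proof. by apply: funext3 => l m n; rewrite /M12 /scalf scalerBr. Qed.
Lemma M13_scalf c f : M13 (scalf c f) = scalf c (M13 f).
Proof. by apply: funext3 => l m n; rewrite /M13 /scalf scalerBr. Qed.
Lemma M23_scalf c f : M23 (scalf c f) = scalf c (M23 f).
Proof. by apply: funext3 => l m n; rewrite /M23 /scalf scalerBr. Qed.
Lemma D12_scalf c f : D12 (scalf c f) = scalf c (D12 f).
Proof. by apply: funext3 => l m n; rewrite /D12 /addf /D1 /D2 /scalf; lmod C. Qed.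

(** The first N terms of (z1 - z2)^k f in powers of z2 / z1, for an integer k of either sign. Both
    sums on the right side of the Jacobi identity have this form. *)
Definition psum (k : int) N f : int -> int -> int -> V := fun l m n =>
  \sum_(i < N) ((-1) ^+ i * binz C k i) *: f (l + k - i%:Z) (m + i%:Z) n.

Lemma psum_pascal k N f l m n :
  psum (k + 1) N.+1 f l m n = psum k N.+1 f (l + 1) m n - psum k N f l (m + 1) n.
Proof.
rewrite /psum big_ord_recl [X in _ = X - _]big_ord_recl -[RHS]addrA -sumrB.
congr (_ + _); first by rewrite /= !binz0 (addrA l) (addrAC l).
apply: eq_bigr => i _; rewrite !lift0 binz_pascal.
have -> : l + (k + 1) - i.+1%:Z = l + k - i%:Z by lia.
have -> : l + 1 + k - i.+1%:Z = l + k - i%:Z by lia.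
have -> : m + i.+1%:Z = m + 1 + i%:Z by lia.
by rewrite exprS; lmod C.
Qed.

Lemma sum_stable (F : nat -> V) N0 N : (N0 <= N)%N ->
  (forall i, (N0 <= i)%N -> F i = 0) -> \sum_(i < N) F i = \sum_(i < N0) F i.
Proof.
move=> le_N F0; rewrite -!(big_mkord xpredT) (big_cat_nat (leq0n N0) le_N) /=.
by rewrite [X in _ + X = _]big_nat_cond [X in _ + X = _]big1 ?addr0 // => i /andP[/andP[/F0]].
Qed.

(* Multiplication by (z1 - z2)^k expanded in powers of z2 / z1; the truncation of
   the sum is harmless only for f vanishing at m >= 0. *)
Definition jpow (k : int) f : int -> int -> int -> V := fun l m n => psum k `|m| f l m n.

Lemma jpowE k f N l m n : (forall l m n, 0 <= m -> f l m n = 0) ->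
  (`|m| <= N)%N -> psum k N f l m n = jpow k f l m n.
Proof.
move=> f0 leN; rewrite /jpow /psum.
rewrite (sum_stable (F := fun i : nat =>
  ((-1) ^+ i * binz C k i) *: f (l + k - i%:Z) (m + i%:Z) n) leN) // => i lei.
by rewrite f0 ?scaler0 //; lia.
Qed.

Lemma M12_jpow k f : (forall l m n, 0 <= m -> f l m n = 0) ->
  M12 (jpow k f) = jpow (k + 1) f.
Proof.
move=> f0; apply: funext3 => l m n; rewrite /M12.
rewrite -!(@jpowE _ _ (`|m|.+2)) //; [|by lia..].
rewrite psum_pascal; congr (_ - _).
by rewrite !jpowE //; lia.
Qed.

Lemma jpow0 f : (forall l m n, 0 <= m -> f l m n = 0) -> jpow 0 f = f.
Proof.
move=> f0; apply: funext3 => l m n; rewrite -(@jpowE _ _ (`|m|.+1)) // /psum.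
rewrite big_ord_recl big1 => [|i _]; last by rewrite lift0 binz0S mulr0 scale0r.
by rewrite binz0 mulr1 scale1r /= !addr0.
Qed.

Lemma iterM12_jpow k (e : nat) f : (forall l m n, 0 <= m -> f l m n = 0) ->
  iter e M12 (jpow k f) = jpow (k + e%:Z) f.
Proof.
move=> f0; elim: e k => [|e IH] k; first by rewrite addr0.
by rewrite iterSr M12_jpow // IH; congr jpow; lia.
Qed.

End Difference.

Record z2_graded (C : numFieldType) (V : lmodType C) (Y : V -> int -> V -> V)
    (one : V) (Ev Od : set V) : Prop := Z2Graded {
  z2_va : vertex_algebra Y one;
  z2_Ev : subspace Ev;
  z2_Od : subspace Od;
  z2_cap : Ev `&` Od `<=` [set 0];
  z2_one : Ev one;
  z2_ee : forall u v n, Ev u -> Ev v -> Ev (Y u n v);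
  z2_eo : forall u v n, Ev u -> Od v -> Od (Y u n v);
  z2_oe : forall u v n, Od u -> Ev v -> Od (Y u n v);
  z2_oo : forall u v n, Od u -> Od v -> Ev (Y u n v) }.

(** * Products of three odd vectors modulo a subspace that absorbs antiderivatives *)

Section OddTriple.
Context (C : numFieldType) (V : lmodType C) (Y : V -> int -> V -> V) (one : V).
Context (Ev Od T : set V).
Hypothesis Z2 : z2_graded Y one Ev Od.
Hypothesis sT : subspace T.
Hypothesis T_low : forall v y (n : int), Ev v -> Od y -> n <= - 2 -> T (Y v n y).
Hypothesis T_der : forall y, Od y -> T (der Y one y) -> T y.
Let VA := z2_va Z2.

(** The coefficients of a(z1) b(z2) c(z3) 1. Letting c act on the vacuum puts the three vectors on
    the same footing; c itself is recovered at n = -1. *)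
Definition triple a b c : int -> int -> int -> V :=
  fun l m n => Y a l (Y b m (Y c n one)).

Section FixedTriple.
Variables (X : set V) (r : nat).
Hypothesis X_odd : X `<=` Od.
Hypothesis X_trunc : forall x y, X x -> X y -> forall m : int, r%:Z <= m -> Y x m y = 0.

(** In the Jacobi identity with exponent r the left side only involves the products a_(r+i) b, which
    vanish: this is locality of order r. *)
Lemma locality_psum a b w l m n : X a -> X b -> exists N0 : nat, forall N : nat, (N0 <= N)%N ->
  psum r N (fun l m n => Y a l (Y b m w)) l m n =
  (-1) ^+ r *: psum r N (fun m l n => Y b m (Y a l w)) m l n.
Proof.
move=> Xa Xb; have [N0 H] := va_jacobi VA a b w l m r; exists N0 => N /H.
rewrite big1 => [|i _]; last by rewrite (X_trunc Xa Xb) ?(Y0l VA) ?scaler0 //; lia.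
move=> E; apply/eqP; rewrite -subr_eq0; apply/eqP; rewrite {}E.
rewrite /psum scaler_sumr -sumrB; apply: eq_bigr => i _.
by rewrite absz_nat; lmod C.
Qed.

Lemma psum_iterM12 N f : (r < N)%N -> psum r%:Z N f = iter r (@M12 C V) f.
Proof.
elim: r N f => [|k IH] [//|N] f lt_N.
  apply: funext3 => l m n; rewrite /psum big_ord_recl big1 => [|i _].
    by rewrite binz0 mulr1 scale1r /= !addr0.
  by rewrite lift0 binz0S mulr0 scale0r.
apply: funext3 => l m n.
have -> : k.+1%:Z = k%:Z + 1 by lia.
by rewrite psum_pascal !IH //; lia.
Qed.

Lemma loc12 a b c : X a -> X b ->
  iter r (@M12 C V) (triple a b c) = iter r (@M12 C V) (swap12 (triple b a c)).
Proof.
move=> Xa Xb; apply: funext3 => l m n.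
have [N0 H] := locality_psum (Y c n one) l m 0 Xa Xb.
have := H (N0 + r.+1)%N (leq_addr _ _).
rewrite !psum_iterM12 ?leq_addl // M12_swap12 /scalf /swap12 => E.
have aux x y z k l' m' : iter k (@M12 C V) (triple x y z) l' m' n =
    iter k (@M12 C V) (fun l m _ => Y x l (Y y m (Y z n one))) l' m' 0.
  by elim: k l' m' => //= k IH l' m'; rewrite /M12 !IH.
by rewrite !aux E.
Qed.

Lemma loc23 a b c : X b -> X c ->
  iter r (@M23 C V) (triple a b c) = iter r (@M23 C V) (swap23 (triple a c b)).
Proof.
move=> Xb Xc; apply: funext3 => l m n.
have [N0 H] := locality_psum one m n 0 Xb Xc.
have := H (N0 + r.+1)%N (leq_addr _ _).
rewrite !psum_iterM12 ?leq_addl // M23_swap23 /scalf /swap23 => E.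
have aux x y k m' n' : iter k (@M23 C V) (triple a x y) l m' n' =
    Y a l (iter k (@M12 C V) (fun m n _ => Y x m (Y y n one)) m' n' 0).
  elim: k m' n' => //= k IH m' n'.
  by rewrite /M23 /M12 !IH (linB _ _ (va_linr VA _ _)).
by rewrite !aux E (linZ _ _ (va_linr VA _ _)).
Qed.

(** [phi] keeps the pole along z1 = z2, which is treated through powers of z1 - z2 of either sign;
    [gam] is cleared of all three poles. *)
Definition phi a b c := iter r (@M13 C V) (iter r (@M23 C V) (triple a b c)).
Definition gam a b c := iter r (@M12 C V) (phi a b c).

Lemma iterM_vanish (A : (int -> int -> int -> V) -> int -> int -> int -> V) f :
  (forall g, (forall l m n, 0 <= n -> g l m n = 0) ->
     forall l m n, 0 <= n -> A g l m n = 0) ->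
  (forall l m n, 0 <= n -> f l m n = 0) -> forall i l m n, 0 <= n -> iter i A f l m n = 0.
Proof. by move=> H f0; elim=> //= i IH; apply: H. Qed.

Lemma M12_vanish (g : int -> int -> int -> V) : (forall l m n, 0 <= n -> g l m n = 0) ->
  forall l m n, 0 <= n -> M12 g l m n = 0.
Proof. by move=> g0 l m n n0; rewrite /M12 !g0 ?subr0. Qed.

Lemma M13_vanish (g : int -> int -> int -> V) : (forall l m n, 0 <= n -> g l m n = 0) ->
  forall l m n, 0 <= n -> M13 g l m n = 0.
Proof. by move=> g0 l m n n0; rewrite /M13 !g0 ?subr0 //; lia. Qed.

Lemma M23_vanish (g : int -> int -> int -> V) : (forall l m n, 0 <= n -> g l m n = 0) ->
  forall l m n, 0 <= n -> M23 g l m n = 0.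
Proof. by move=> g0 l m n n0; rewrite /M23 !g0 ?subr0 //; lia. Qed.

Lemma triple_vanish a b c l m n : 0 <= n -> triple a b c l m n = 0.
Proof. by move=> n0; rewrite /triple (va_annih VA) // !(Y0r VA). Qed.

(** The factors (z2 - z3)^r and (z1 - z3)^r allow c to be moved to the left of b and then of a. Then
    b stands next to the vacuum, which its nonnegative modes kill. *)
Lemma phi_vanish a b c : X a -> X b -> X c ->
  forall l m n, 0 <= m -> phi a b c l m n = 0.
Proof.
move=> Xa Xb Xc l m n m0; rewrite /phi loc23 // M23_swap23.
rewrite (iter_scalf _ _ _ (@M13_scalf C V)).
rewrite (iter_swap r _ (@M13_swap23 C V)).
rewrite (iter_commute _ _ _ (@M1223 C V)) loc12 //.
rewrite M12_swap12 (iter_scalf _ _ _ (@M23_scalf C V)).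
rewrite (iter_swap r _ (@M23_swap12 C V)) /scalf /swap23 /swap12.
rewrite (iterM_vanish M13_vanish (iterM_vanish M12_vanish (triple_vanish _ _ _) _)) //.
by rewrite !scaler0.
Qed.

(** Once all poles are cleared, the function is symmetric up to sign in the three vectors, so that a
    property of one variable or of one pair passes to the others. *)
Lemma gam12 a b c : X a -> X b ->
  gam a b c = scalf ((-1) ^+ r) (swap12 (gam b a c)).
Proof.
move=> Xa Xb; rewrite /gam /phi.
have E f : iter r (@M12 C V) (iter r (@M13 C V) (iter r (@M23 C V) f)) =
   iter r (@M13 C V) (iter r (@M23 C V) (iter r (@M12 C V) f)).
  by rewrite (iter_commute _ _ _ (@M1213 C V)) (iter_commute _ _ _ (@M1223 C V)).
rewrite E loc12 // M12_swap12 (iter_scalf _ _ _ (@M23_scalf C V)).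
rewrite (iter_scalf _ _ _ (@M13_scalf C V)) (iter_swap r _ (@M23_swap12 C V)).
rewrite (iter_swap r _ (@M13_swap12 C V)) E.
by rewrite [in RHS](iter_commute _ _ _ (@M1323 C V)).
Qed.

Lemma gam23 a b c : X b -> X c ->
  gam a b c = scalf ((-1) ^+ r) (swap23 (gam a c b)).
Proof.
move=> Xb Xc; rewrite /gam /phi loc23 // M23_swap23.
rewrite (iter_scalf _ _ _ (@M13_scalf C V)) (iter_scalf _ _ _ (@M12_scalf C V)).
rewrite (iter_swap r _ (@M13_swap23 C V)) (iter_swap r _ (@M12_swap23 C V)).
by rewrite [in RHS](iter_commute _ _ _ (@M1213 C V)).
Qed.

Lemma gam_vanish3 a b c l m n : X a -> X b -> X c -> 0 <= n -> gam a b c l m n = 0.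
Proof.
move=> Xa Xb Xc; apply: (iterM_vanish M12_vanish).
exact: (iterM_vanish M13_vanish (iterM_vanish M23_vanish (triple_vanish _ _ _) _)).
Qed.

Lemma gam_vanish2 a b c l m n : X a -> X b -> X c -> 0 <= m -> gam a b c l m n = 0.
Proof.
by move=> Xa Xb Xc m0; rewrite gam23 // /scalf /swap23 gam_vanish3 // scaler0.
Qed.

Lemma gam_vanish1 a b c l m n : X a -> X b -> X c -> 0 <= l -> gam a b c l m n = 0.
Proof.
by move=> Xa Xb Xc l0; rewrite gam12 // /scalf /swap12 gam_vanish2 // scaler0.
Qed.

Lemma psum_M13 (k : int) N (f : int -> int -> int -> V) l m n :
  psum k N (M13 f) l m n = psum k N f (l + 1) m n - psum k N f l m (n + 1).
Proof.
rewrite /psum /M13 -sumrB; apply: eq_bigr => i _.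
by rewrite -scalerBr (addrAC _ _ 1) (addrAC l).
Qed.

Lemma psum_M23 (k : int) N (f : int -> int -> int -> V) l m n :
  psum k N (M23 f) l m n = psum k N f l (m + 1) n - psum k N f l m (n + 1).
Proof.
rewrite /psum /M23 -sumrB; apply: eq_bigr => i _.
by rewrite -scalerBr (addrAC _ _ 1).
Qed.

(* The two expansions of (z1 - z2)^k phi agree modulo T in low degrees: their
   difference is the contribution of the products of a and b, which are even. *)
Lemma jpow_swap a b c (k l m n : int) : X a -> X b -> X c -> l + m <= - 2 - r%:Z *+ 2 ->
  T (jpow k (phi a b c) l m n - (-1) ^+ `|k|%N *: jpow k (phi b a c) m l n).
Proof.
move=> Xa Xb Xc.
(* The two expansions agree modulo [T] in degrees l + m at most s. Each of the 2r factors z1 - z3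
   and z2 - z3 lowers s by 1, whence the bound -2 - 2r. *)
pose Q (s : int) f f' := forall l m n, l + m <= s -> exists N0 : nat, forall N : nat,
  (N0 <= N)%N -> T (psum k N f l m n - (-1) ^+ `|k|%N *: psum k N f' m l n).
have eqB x1 x2 y1 y2 : T (x1 - (-1) ^+ `|k|%N *: y1) ->
    T (x2 - (-1) ^+ `|k|%N *: y2) ->
    T ((x1 - x2) - (-1) ^+ `|k|%N *: (y1 - y2)).
  by move=> H1 H2; have := subB sT H1 H2; congr T; lmod C.
have Q13 s f f' : Q s f f' -> Q (s - 1) (M13 f) (M23 f').
  move=> H l' m' n' hs.
  have [|N1 H1] := H (l' + 1) m' n'; first by lia.
  have [|N2 H2] := H l' m' (n' + 1); first by lia.
  exists (N1 + N2)%N => N hN; rewrite psum_M13 psum_M23.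
  by apply: eqB; [apply: H1|apply: H2]; apply: leq_trans hN; rewrite ?leq_addr ?leq_addl.
have Q23 s f f' : Q s f f' -> Q (s - 1) (M23 f) (M13 f').
  move=> H l' m' n' hs.
  have [|N1 H1] := H l' (m' + 1) n'; first by lia.
  have [|N2 H2] := H l' m' (n' + 1); first by lia.
  exists (N1 + N2)%N => N hN; rewrite psum_M13 psum_M23.
  by apply: eqB; [apply: H1|apply: H2]; apply: leq_trans hN; rewrite ?leq_addr ?leq_addl.
(* The difference is a combination of the (a_(k+i) b)_(l+m-i) c_n 1, where a_(k+i) b is even and the
   mode is at most -2. *)
have Q0 : Q (- 2) (triple a b c) (triple b a c).
  move=> l' m' n' hs; have [N0 H] := va_jacobi VA a b (Y c n' one) l' m' k.
  exists N0 => N /H E; rewrite /psum scaler_sumr -sumrB.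
  rewrite (eq_bigr (fun i : 'I_N => ((-1) ^+ i * binz C k i) *:
       (Y a (l' + k - i%:Z) (Y b (m' + i%:Z) (Y c n' one))
        - (-1) ^+ `|k|%N *: Y b (m' + k - i%:Z) (Y a (l' + i%:Z) (Y c n' one))))); last first.
    by move=> i _; rewrite /triple scalerBr !scalerA (mulrC (_ ^+ `|k|%N)).
  rewrite -{}E.
  apply: sub_sum => // i _; apply: subZ => //; apply: T_low; last by lia.
    by apply: (z2_oo Z2); apply: X_odd.
  by apply: (z2_oe Z2); [apply: X_odd|apply: z2_one Z2].
have Q23i s f f' i : Q s f f' -> Q (s - i%:Z) (iter i (@M23 C V) f) (iter i (@M13 C V) f').
  move=> H; elim: i => [|i IH]; first by rewrite subr0.
  by rewrite (_ : s - i.+1%:Z = s - i%:Z - 1); [apply: Q23|lia].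
have Q13i s f f' i : Q s f f' -> Q (s - i%:Z) (iter i (@M13 C V) f) (iter i (@M23 C V) f').
  move=> H; elim: i => [|i IH]; first by rewrite subr0.
  by rewrite (_ : s - i.+1%:Z = s - i%:Z - 1); [apply: Q13|lia].
have := Q13i _ _ _ r (Q23i _ _ _ r Q0).
rewrite -/(phi a b c) -(iter_commute _ _ _ (@M1323 C V)) -/(phi b a c) => H le_lm.
have [|N0 HN] := H l m n; first by lia.
have := HN (N0 + (`|m| + `|l|))%N (leq_addr _ _).
by rewrite !jpowE //; try (by lia); apply: phi_vanish.
Qed.

Definition tin (f : int -> int -> int -> V) := forall l m n, T (f l m n).

Lemma tin_iter (A : (int -> int -> int -> V) -> int -> int -> int -> V) f i :
  (forall g, tin g -> tin (A g)) -> tin f -> tin (iter i A f).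
Proof. by move=> H Tf; elim: i => //= i; apply: H. Qed.

Lemma tin_D12 f : tin f -> tin (D12 f).
Proof. by move=> H l m n; apply: subD => //; apply: subN => //; apply: subZ. Qed.
Lemma tin_D13 f : tin f -> tin (D13 f).
Proof. by move=> H l m n; apply: subD => //; apply: subN => //; apply: subZ. Qed.
Lemma tin_D23 f : tin f -> tin (D23 f).
Proof. by move=> H l m n; apply: subD => //; apply: subN => //; apply: subZ. Qed.
Lemma tin_scalf c f : tin f -> tin (scalf c f).
Proof. by move=> H l m n; apply: subZ. Qed.
Lemma tin_addf f g : tin f -> tin g -> tin (addf f g).
Proof. by move=> H H' l m n; apply: subD. Qed.

(** The factors l and m of the two derivatives vanish just where their shifts would leave the region
    l >= 0 or m >= 0, so each application of [D12] raises the admissible l + m by 1. *)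
Lemma iterD12_edge f (s : int) j : (forall l m n, l + m <= s -> 0 <= l \/ 0 <= m -> T (f l m n)) ->
  forall l m n, l + m <= s + j%:Z -> 0 <= l \/ 0 <= m -> T (iter j (@D12 C V) f l m n).
Proof.
move=> Tf; elim: j => [|j IH] l m n; first by rewrite addr0; apply: Tf.
move=> hs hlm /=; rewrite /D12 /addf /D1 /D2.
apply: subD => //; apply: subN => //.
  have [->|l0] := eqVneq l 0; first by rewrite scale0r; apply: sub0.
  by apply: subZ => //; apply: IH; [lia|case: hlm => ?; [left; lia|right]].
have [->|m0] := eqVneq m 0; first by rewrite scale0r; apply: sub0.
by apply: subZ => //; apply: IH; [lia|case: hlm => ?; [left|right; lia]].
Qed.

(** For l + m >= 0 one index is nonnegative and [gam] vanishes there. Otherwise [gam] is (z1 - z2)^e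
    times (z1 - z2)^(r-e) [phi], with e chosen to reach the line l + m = -1, where again l or m is
    nonnegative. The expansion of the second factor vanishes for m >= 0, the opposite one for l >=
    0, and they agree modulo [T] for l + m <= -2 - 2r; hence the first is in [T] on this part of the
    region. The 2r + 1 derivations carry the bound from -2 - 2r to -1. *)
Lemma gamD12 a b c : X a -> X b -> X c -> tin (iter (r + r).+1 (@D12 C V) (gam a b c)).
Proof.
move=> Xa Xb Xc l m n; set K := (r + r).+1.
have [lm|lm] := lerP 0 (l + m).
  apply: (@iterD12_edge (gam a b c) (l + m) K); [|by lia|by lia].
  by move=> l' m' n' _ [?|?]; [rewrite gam_vanish1|rewrite gam_vanish2] => //;
    apply: (sub0 sT).
pose e := absz (- (1 + (l + m)))%R.
have -> : gam a b c = iter e (@M12 C V) (jpow (r%:Z - e%:Z) (phi a b c)).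
  rewrite iterM12_jpow; last by apply: phi_vanish.
  rewrite subrK -[r%:Z]add0r -iterM12_jpow; last by apply: phi_vanish.
  by rewrite jpow0 //; apply: phi_vanish.
rewrite (iter_commute _ _ _ (@D12M12 C V)).
set g := iter K _ _.
have Tg l' m' n' : l' + m' = - 1 -> T (g l' m' n').
  move=> E; apply: (@iterD12_edge _ (- 2 - r%:Z *+ 2) K); [|by lia|by lia].
  move=> x y z hs hxy.
  have := @jpow_swap a b c (r%:Z - e%:Z) x y z Xa Xb Xc hs.
  case: hxy => h; last first.
    by move=> _; rewrite /jpow /psum big1 => [|i _]; [apply: sub0|rewrite phi_vanish ?scaler0 //; lia].
  rewrite [X in _ - _ *: X](_ : _ = 0) ?scaler0 ?subr0 //.
  by rewrite /jpow /psum big1 // => i _; rewrite phi_vanish ?scaler0 //; lia.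
have : l + m + e%:Z = - 1 by rewrite /e; lia.
elim: (e) (l) (m) => [|k IH] x y h /=; first by apply: Tg; rewrite -h addr0.
by apply: subB => //; apply: IH; lia.
Qed.

Lemma gamD13 a b c : X a -> X b -> X c -> tin (iter (r + r).+1 (@D13 C V) (gam a b c)).
Proof.
move=> Xa Xb Xc; have H := gamD12 Xa Xc Xb.
have -> : gam a b c = swap23 (scalf ((-1) ^+ r) (gam a c b)) by rewrite gam23.
rewrite (iter_swap (s := @swap23 C V) (B := @D12 C V)) //.
rewrite (iter_scalf _ _ _ (@D12_scalf C V)) => l m n.
by apply: subZ => //; apply: H.
Qed.

Lemma gamD23 a b c : X a -> X b -> X c -> tin (iter (r + r).+1 (@D23 C V) (gam a b c)).
Proof.
move=> Xa Xb Xc; have H := gamD13 Xb Xa Xc.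
have -> : gam a b c = swap12 (scalf ((-1) ^+ r) (gam b a c)) by rewrite gam12.
rewrite (iter_swap (s := @swap12 C V) (B := @D13 C V)) //.
have D13_scalf (d : C) (f : int -> int -> int -> V) : D13 (scalf d f) = scalf d (D13 f).
  by apply: funext3 => l m n; rewrite /D13 /addf /D1 /D3 /scalf; lmod C.
rewrite (iter_scalf _ _ _ D13_scalf) => l m n.
by apply: subZ => //; apply: H.
Qed.

(* D12, D13 and D23 are nilpotent on gam modulo T, hence so is their half-sum. *)
Lemma gamD123 a b c : X a -> X b -> X c ->
  tin (iter (3 * (r + r).+1) (@D123 C V) (gam a b c)).
Proof.
move=> Xa Xb Xc; set K := (r + r).+1.
have H12 : tin (iter K (@D12 C V) (gam a b c)) by apply: gamD12.
have H13 : tin (iter K (@D13 C V) (gam a b c)) by apply: gamD13.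
have H23 : tin (iter K (@D23 C V) (gam a b c)) by apply: gamD23.
set g := gam a b c in H12 H13 H23 *.
pose W i j k := iter k (@D23 C V) (iter j (@D13 C V) (iter i (@D12 C V) g)).
have W12 i j k : D12 (W i j k) = W i.+1 j k.
  rewrite /W -[D12 _]/(iter 1 (@D12 C V) _) (iter_commute _ _ _ (@D1223 C V)).
  by rewrite (iter_commute 1 _ _ (@D1213 C V)).
have W13 i j k : D13 (W i j k) = W i j.+1 k.
  by rewrite /W -[D13 _]/(iter 1 (@D13 C V) _) (iter_commute _ _ _ (@D1323 C V)).
suff main t i j k : (3 * K <= t + (i + j + k))%N -> tin (iter t (@D123 C V) (W i j k)).
  by apply: (main (3 * K)%N 0%N 0%N 0%N); rewrite !addn0.
elim: t i j k => [|t IH] i j k h.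
  rewrite /iter; have [hk|hk] := leqP K k.
    have -> : W i j k = iter (k - K) (@D23 C V) (iter j (@D13 C V)
        (iter i (@D12 C V) (iter K (@D23 C V) g))).
      rewrite (iter_commute i K _ (@D1223 C V)) (iter_commute j K _ (@D1323 C V)).
      by rewrite -iterD subnK.
    apply: (tin_iter _ tin_D23); apply: (tin_iter _ tin_D13).
    exact: (tin_iter _ tin_D12).
  have [hj|hj] := leqP K j.
    have -> : W i j k = iter k (@D23 C V) (iter (j - K) (@D13 C V)
        (iter i (@D12 C V) (iter K (@D13 C V) g))).
      by rewrite (iter_commute i K _ (@D1213 C V)) -[iter (j - K) _ _]iterD subnK.
    apply: (tin_iter _ tin_D23); apply: (tin_iter _ tin_D13).
    exact: (tin_iter _ tin_D12).
  have hi : (K <= i)%N by lia.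
  rewrite /W -(subnK hi) iterD.
  apply: (tin_iter _ tin_D23); apply: (tin_iter _ tin_D13).
  exact: (tin_iter _ tin_D12).
rewrite iterSr D123_sum W12 W13 -[D23 _]/(W i j k.+1) iterD123_lin iterD123_add.
by apply: tin_scalf; do 2?apply: tin_addf; apply: IH; lia.
Qed.

Lemma triple_odd a b c l m n : X a -> X b -> X c -> Od (triple a b c l m n).
Proof.
move=> Xa Xb Xc; apply: (z2_oe Z2); first exact: X_odd.
apply: (z2_oo Z2); first exact: X_odd.
by apply: (z2_oe Z2); [exact: X_odd|exact: z2_one Z2].
Qed.

Lemma gam_odd a b c l m n : X a -> X b -> X c -> Od (gam a b c l m n).
Proof.
move=> Xa Xb Xc; rewrite /gam /phi.
have aux A f i : (forall g, (forall l m n, Od (g l m n)) -> forall l m n, Od (A g l m n)) ->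
   (forall l m n, Od (f l m n)) -> forall l m n, Od (iter i A f l m n).
  by move=> H Hf; elim: i => //= i; apply: H.
apply: (aux) => [g Hg l' m' n'|]; first by apply: (subB (z2_Od Z2)).
apply: (aux) => [g Hg l' m' n'|]; first by apply: (subB (z2_Od Z2)).
apply: (aux) => [g Hg l' m' n'|l' m' n']; first by apply: (subB (z2_Od Z2)).
exact: triple_odd.
Qed.

(** [der] obeys the Leibniz rule on modes and kills the vacuum, so it acts on coefficients as the
    total derivative. A power of it sends [gam] into [T], and [T_der] then removes this power. *)
Lemma D123_gam a b c l m n : iter 1 (@D123 C V) (gam a b c) l m n = der Y one (gam a b c l m n).
Proof.
pose dl := der_lin VA.
have I A f i : (forall f, D123 (A f) = A (D123 f)) ->
    (forall f, (forall l m n, D123 f l m n = der Y one (f l m n)) ->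
       forall l m n, A (D123 f) l m n = der Y one (A f l m n)) ->
    (forall l m n, D123 f l m n = der Y one (f l m n)) ->
    forall l m n, D123 (iter i A f) l m n = der Y one (iter i A f l m n).
  by move=> H1 H2 Hf; elim: i => //= i IH l' m' n'; rewrite H1 (H2 _ IH).
rewrite /gam /phi; move: l m n; apply: (I) => [f|f Hf l m n|].
- exact: D123M12.
- by rewrite /M12 !Hf (linB _ _ dl).
apply: (I) => [f|f Hf l m n|].
- exact: D123M13.
- by rewrite /M13 !Hf (linB _ _ dl).
apply: (I) => [f|f Hf l m n|l m n].
- exact: D123M23.
- by rewrite /M23 !Hf (linB _ _ dl).
rewrite /D123 /addf /D1 /D2 /D3 /triple !(der_Y VA) (der_one VA) (Y0r VA).
by rewrite !(linB _ _ (va_linr VA _ _)) !(linZ _ _ (va_linr VA _ _)) !(Y0r VA); lmod C.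
Qed.

Lemma gam_in a b c : X a -> X b -> X c -> tin (gam a b c).
Proof.
move=> Xa Xb Xc l m n; have H := gamD123 Xa Xb Xc l m n; pose dl := der_lin VA.
have Oder j y : Od y -> Od (iter j (der Y one) y).
  move=> Oy; elim: j => //= j Oj; apply: (z2_oe Z2) => //; exact: z2_one Z2.
have {}H : T (iter (3 * (r + r).+1) (der Y one) (gam a b c l m n)).
  suff E k : iter k (@D123 C V) (gam a b c) l m n = iter k (der Y one) (gam a b c l m n).
    by rewrite -E.
  pose derf (f : int -> int -> int -> V) := fun x y z => der Y one (f x y z).
  have D123_derf f : D123 (derf f) = derf (D123 f).
    apply: funext3 => x y z; rewrite /D123 /addf /D1 /D2 /D3 /derf.
    by rewrite !(linD _ _ dl) !(linN _ dl) !(linZ _ _ dl).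
  have D123_g : D123 (gam a b c) = derf (gam a b c) by apply: funext3 => x y z; apply: D123_gam.
  rewrite -[RHS]/((fun f => iter k (der Y one) (f l m n)) (gam a b c)).
  have -> : (fun f => iter k (der Y one) (f l m n)) (gam a b c) =
     iter k derf (gam a b c) l m n by elim: k => //= k ->.
  congr (_ l m n); elim: k => //= k ->.
  by elim: k => [|k IHk] /=; [exact: D123_g|rewrite D123_derf IHk].
elim: (3 * _)%N H => //= j IH /T_der H; apply: IH; apply: H.
by apply: Oder; apply: gam_odd.
Qed.

(** Modulo [T] a coefficient of index n equals one of index n + 1; after finitely many steps the
    index is nonnegative and the coefficient is zero. *)
Lemma strip13 f : (forall l m n, 0 <= n -> f l m n = 0) -> tin (M13 f) -> tin f.
Proof.
move=> f0 Tf; suff H k l m n : - k%:Z <= n -> T (f l m n).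
  by move=> l m n; apply: (H `|n|%N); lia.
elim: k l m n => [|k IH] l m n hn; first by rewrite f0 ?oppr0 //; apply: sub0.
apply: (sub_congr sT (v := f (l - 1) m (n + 1))); last by apply: IH; lia.
by have := Tf (l - 1) m n; rewrite /M13 subrK.
Qed.

Lemma strip23 f : (forall l m n, 0 <= n -> f l m n = 0) -> tin (M23 f) -> tin f.
Proof.
move=> f0 Tf; suff H k l m n : - k%:Z <= n -> T (f l m n).
  by move=> l m n; apply: (H `|n|%N); lia.
elim: k l m n => [|k IH] l m n hn; first by rewrite f0 ?oppr0 //; apply: sub0.
apply: (sub_congr sT (v := f l (m - 1) (n + 1))); last by apply: IH; lia.
by have := Tf l (m - 1) n; rewrite /M23 subrK.
Qed.

Lemma strip12 f : (forall n, exists m0 : int, forall l m, m0 <= m -> f l m n = 0) ->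
  tin (M12 f) -> tin f.
Proof.
move=> f0 Tf l m n; have [m0 f0n] := f0 n.
suff H k x y : m0 - k%:Z <= y -> T (f x y n) by apply: (H `|m0 - m|%N); lia.
elim: k x y => [|k IH] x y hn; first by rewrite f0n; [apply: sub0|lia].
apply: (sub_congr sT (v := f (x - 1) (y + 1) n)); last by apply: IH; lia.
by have := Tf (x - 1) y n; rewrite /M12 subrK.
Qed.

Lemma triple_in a b c : X a -> X b -> X c -> tin (triple a b c).
Proof.
move=> Xa Xb Xc; have := gam_in Xa Xb Xc; rewrite /gam /phi.
(* The factor z1 - z2 has to be divided out last: the other two only use vanishing for n >= 0, which
   every factor preserves, whereas this one uses the truncation of b_m (c_n 1) for fixed n. *)
rewrite (iter_commute _ _ _ (@M1213 C V)) (iter_commute _ _ _ (@M1223 C V)).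
have I A f i : (forall f, (forall l m n, 0 <= n -> f l m n = 0) -> tin (A f) -> tin f) ->
    (forall g, (forall l m n, 0 <= n -> g l m n = 0) ->
       forall l m n, 0 <= n -> A g l m n = 0) ->
    (forall l m n, 0 <= n -> f l m n = 0) -> tin (iter i A f) -> tin f.
  move=> H1 H2 f0; elim: i => //= i IH /H1 H; apply: IH; apply: H.
  exact: (iterM_vanish H2).
have V12 := iterM_vanish M12_vanish (triple_vanish a b c).
move=> /(I _ _ _ strip13 M13_vanish) H.
have {}H := H (iterM_vanish M23_vanish (V12 r) r).
have {H} := I _ _ _ strip23 M23_vanish (V12 r) H.
have : forall n, exists m0 : int, forall l m, m0 <= m -> triple a b c l m n = 0.
  move=> n; have [m0 H] := va_trunc VA b (Y c n one); exists m0 => l m /H E.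
  by rewrite /triple E (Y0r VA).
elim: r (triple a b c) => //= i IH f f0; rewrite -iterS iterSr => H.
apply: (strip12 f0); apply: IH H => n; have [m0 h] := f0 n; exists m0 => l m hm.
by rewrite /M12 !h ?subr0 //; lia.
Qed.

End FixedTriple.

Theorem odd_triple a b c : Od a -> Od b -> Od c -> forall l m n, T (triple a b c l m n).
Proof.
move=> Oa Ob Oc; pose X : set V := [set x | x \in [:: a; b; c]].
have XO : X `<=` Od by move=> x; rewrite /X /= !inE => /or3P[] /eqP ->.
have tr x y : exists r : nat, forall m : int, r%:Z <= m -> Y x m y = 0.
  have [N H] := va_trunc VA x y; exists `|N|%N => m hm; apply: H; lia.
have trX : exists r : nat, forall x y, X x -> X y -> forall m : int, r%:Z <= m -> Y x m y = 0.
  have trs x (s : seq V) : exists r : nat, forall y, y \in s -> forall m : int,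
      r%:Z <= m -> Y x m y = 0.
    elim: s => [|z s [r IH]]; first by exists 0%N.
    have [r' H] := tr x z; exists (r + r')%N => y; rewrite inE => /orP[/eqP ->|ys] m hm.
      by apply: H; lia.
    by apply: IH => //; lia.
  have [r1 H1] := trs a [:: a; b; c]; have [r2 H2] := trs b [:: a; b; c].
  have [r3 H3] := trs c [:: a; b; c].
  exists (r1 + r2 + r3)%N => x y Xx Xy m hm.
  by move: Xx; rewrite /X /= !inE => /or3P[] /eqP ->; [apply: H1|apply: H2|apply: H3] => //; lia.
have [r Hr] := trX; apply: (triple_in XO Hr); rewrite /X /= !inE eqxx ?orbT //.
Qed.

End OddTriple.

(** * Spanning sets without repetitions *)

(** [D] is L(0), recorded through its commutation with modes. [omega] is to be the even component of
    the conformal vector of the ambient algebra, and its zero mode is known to be the derivation on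
    [Od]. *)
Record cft_z2_graded (C : numFieldType) (V : lmodType C) (Y : V -> int -> V -> V)
    (one : V) (Ev Od : set V) (D : V -> V) (omega : V) : Prop := CftZ2Graded {
  cft_z2 : z2_graded Y one Ev Od;
  cft_lin : lin D;
  cft_wt : forall a k b, D (Y a k b) = Y (D a) k b + Y a k (D b) - (k + 1)%:~R *: Y a k b;
  cft_neg : forall n : int, n < 0 -> eig D n%:~R `<=` [set 0];
  cft_zero : forall v, D v = 0 -> exists c, v = c *: one;
  cft_Ev : Ev `<=` lin_span [set v | Ev v /\ exists n : int, eig D n%:~R v];
  cft_Od : Od `<=` lin_span [set v | Od v /\ exists n : int, eig D n%:~R v];
  cft_fin : forall n : int, exists s : seq V,
    (forall x, x \in s -> Od x /\ eig D n%:~R x) /\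
    Od `&` eig D n%:~R `<=` lin_span [set` s];
  cft_conf : [/\ Ev omega, eig D 2%:R omega &
    forall y, Od y -> Y omega 0 y = der Y one y] }.

Section Words.
Context (C : numFieldType) (V : lmodType C) (Y : V -> int -> V -> V) (one : V).
Context (Ev Od : set V) (D : V -> V) (omega : V).
Hypothesis G2 : cft_z2_graded Y one Ev Od D omega.
Let Z2 := cft_z2 G2.
Let VA := z2_va Z2.
Let dD := cft_lin G2.

Definition hom (a : V) (w : nat) := D a = w%:R *: a /\ (Ev a \/ Od a).

Lemma D_one : D one = 0.
Proof.
have := cft_wt G2 one (- 1) one; rewrite addNr scale0r subr0 !(va_creat VA).
rewrite (va_vac VA) eqxx => /(congr1 (fun x => x - D one)).
by rewrite subrr addrK.
Qed.

Lemma hom_int a (n : int) : Ev a \/ Od a -> eig D n%:~R a -> a = 0 \/ hom a `|n|.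
Proof.
move=> Pa Da; have [n0|n0] := ltrP n 0; first by left; apply: (cft_neg G2 n0).
by right; split=> //; rewrite Da -{1}(gez0_abs n0).
Qed.

Lemma hom0 a : hom a 0 -> exists c, a = c *: one.
Proof. by case=> Da _; apply: (cft_zero G2); rewrite Da scale0r. Qed.

Lemma parityY a b k : Ev a \/ Od a -> Ev b \/ Od b -> Ev (Y a k b) \/ Od (Y a k b).
Proof.
case=> Pa [] Pb; [left; exact: (z2_ee Z2)|right; exact: (z2_eo Z2)|
  right; exact: (z2_oe Z2)|left; exact: (z2_oo Z2)].
Qed.

Lemma D_hom a wa b wb (k : int) : D a = wa%:R *: a -> D b = wb%:R *: b ->
  D (Y a k b) = (wa%:Z + wb%:Z - k - 1)%:~R *: Y a k b.
Proof.
move=> Da Db; rewrite (cft_wt G2) Da Db (linZ _ _ (va_linl VA _ _)).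
rewrite (linZ _ _ (va_linr VA _ _)) !rmorphB rmorphD rmorphD /= -!pmulrn.
lmod C.
Qed.

Lemma homY a wa b wb (k : int) : hom a wa -> hom b wb ->
  Y a k b = 0 \/ exists2 w : nat, w%:Z = wa%:Z + wb%:Z - k - 1 & hom (Y a k b) w.
Proof.
move=> [Da Pa] [Db Pb]; have DY := D_hom k Da Db.
have [lt0|ge0] := ltrP (wa%:Z + wb%:Z - k - 1) 0.
  by left; apply: (cft_neg G2 lt0).
right; exists (absz (wa%:Z + wb%:Z - k - 1)%R); first lia.
by split; [rewrite DY -{1}(gez0_abs ge0)|exact: parityY].
Qed.

(* (a, w, n) stands for the operator a_(-n), where a has weight w. *)
Definition letter : Type := V * nat * nat.
Implicit Types (t : letter) (l : seq letter).

Definition act l (x : V) := foldr (fun t x => Y t.1.1 (- t.2%:Z) x) x l.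
Fixpoint valid l : Prop :=
  if l is t :: l' then [/\ hom t.1.1 t.1.2, (0 < t.1.2)%N, (0 < t.2)%N & valid l']
  else True.
Definition wsum l := sumn [seq t.1.2 | t <- l].
Definition isum l := sumn [seq t.2 | t <- l].
Definition deg l := sumn [seq (t.1.2 + t.2.-1)%N | t <- l].

(** The filtration of the weight M part by the total weight of the letters. A product a_i b with i
    >= 0 has weight less than the sum of the weights of a and b, so letters commute up to the next
    lower level. *)
Definition G (s : nat) (M : int) : set V :=
  lin_span [set x | exists l, [/\ valid l, (wsum l <= s)%N, (deg l)%:Z = M & x = act l one]].

Lemma G_sub s M : subspace (G s M). Proof. exact: span_sub. Qed.

Lemma G_mono s s' M M' : (s <= s')%N -> M = M' -> G s M `<=` G s' M'.
Proof.
move=> le_s ->; apply: span_mono => x [l [vl ws dl ->]].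
by exists l; split=> //; apply: leq_trans le_s.
Qed.

Lemma G_word l : valid l -> G (wsum l) (deg l) (act l one).
Proof. by move=> vl; apply: span_incl; exists l. Qed.

Lemma G_letter a w n s M x : hom a w -> (0 < w)%N -> (0 < n)%N -> G s M x ->
  G (s + w) (M + w%:Z + n%:Z - 1) (Y a (- n%:Z) x).
Proof.
move=> ha w0 n0; apply: (span_lin (va_linr VA a _) (G_sub _ _)) => _ [l [vl ws <- ->]].
apply: span_incl; exists ((a, w, n) :: l); split=> //=.
  by rewrite /wsum /= addnC leq_add2r.
by rewrite /deg /=; lia.
Qed.

Lemma G_mode0 a n s M x : hom a 0 -> G s M x ->
  G s (M - n - 1) (Y a n x) /\ (0 <= n -> Y a n x = 0).
Proof.
move=> /hom0[c ->] Gx; rewrite (linZ _ _ (va_linl VA _ _)) (va_vac VA).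
case: eqP => [->|_]; last by rewrite scaler0; split=> //; apply: (sub0 (G_sub _ _)).
split=> //; apply: (subZ _ (G_sub _ _)).
by apply: G_mono Gx => //; lia.
Qed.

(** A nonnegative mode is moved through the letters to the vacuum, which it kills. Each commutator
    merges two letters into one whose weight is at most their sum minus 1, which is the level
    gained. *)
Lemma G_mode_word l : valid l -> forall a w n, hom a w ->
  G (wsum l + w) ((deg l)%:Z + w%:Z - n - 1) (Y a n (act l one)) /\
  (0 <= n -> G (wsum l + w.-1) ((deg l)%:Z + w%:Z - n - 1) (Y a n (act l one))).
Proof.
elim: l => [|[[b wb] m] l IH] vl a w n ha.
  have [n0|n0] := lerP 0 n.
    by rewrite (va_annih VA a n0); split=> [|_]; apply: (sub0 (G_sub _ _)).
  split=> [|?]; last by lia.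
  have [w0|w0] := posnP w.
    rewrite w0 in ha *; have [H _] := G_mode0 n ha (G_word vl).
    by apply: G_mono H => //; lia.
  have n1 : (0 < `|n|)%N by lia.
  have E : - (Posz `|n|) = n by lia.
  by have := G_letter ha w0 n1 (@G_word [::] I); rewrite E; apply: G_mono; lia.
have /= [hb wb0 m0 vl'] := vl.
have [w0|w0] := posnP w.
  rewrite w0 in ha *; have [H1 H2] := G_mode0 n ha (G_word vl).
  split=> [|/H2 ->]; last by apply: (sub0 (G_sub _ _)).
  by apply: G_mono H1 => //; lia.
have Gn : 0 <= n -> G (wsum ((b, wb, m) :: l) + w.-1)
    ((deg ((b, wb, m) :: l))%:Z + w%:Z - n - 1) (Y a n (act ((b, wb, m) :: l) one)).
  move=> n0; have sG := G_sub (wsum ((b, wb, m) :: l) + w.-1)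
    ((deg ((b, wb, m) :: l))%:Z + w%:Z - n - 1).
  apply: (sub_congr sG (v := Y b (- m%:Z) (Y a n (act l one)))).
    apply: (commutator_in VA sG) => i.
    have [->|[w' Ew' hw']] := homY i%:Z ha hb; first by rewrite (Y0l VA); apply: sub0.
    have [H _] := IH vl' _ _ (n - m%:Z - i%:Z) hw'.
    apply: G_mono H; last by rewrite /deg /=; lia.
    by rewrite /wsum /=; lia.
  have [_ /(_ n0) H] := IH vl' a w n ha.
  apply: G_mono (G_letter hb wb0 m0 H); first by rewrite /wsum /=; lia.
  by rewrite /deg /=; lia.
split=> //; have [n0|n0] := lerP 0 n.
  by apply: G_mono (Gn n0) => //; rewrite leq_add2l leq_pred.
have n1 : (0 < `|n|)%N by lia.
have E : - (Posz `|n|) = n by lia.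
by have := G_letter ha w0 n1 (G_word vl); rewrite E; apply: G_mono; lia.
Qed.

Lemma G_mode a w n s M x : hom a w -> G s M x -> G (s + w) (M + w%:Z - n - 1) (Y a n x).
Proof.
move=> ha; apply: (span_lin (va_linr VA a _) (G_sub _ _)) => _ [l [vl ws <- ->]].
by have [H _] := G_mode_word vl n ha; apply: G_mono H => //; rewrite leq_add2r.
Qed.

Lemma G_pos a w n s M x : hom a w -> 0 <= n -> G s M x ->
  G (s + w.-1) (M + w%:Z - n - 1) (Y a n x).
Proof.
move=> ha n0; apply: (span_lin (va_linr VA a _) (G_sub _ _)) => _ [l [vl ws <- ->]].
have [_ /(_ n0) H] := G_mode_word vl n ha.
by apply: G_mono H => //; rewrite leq_add2r.
Qed.

Lemma G_comm a wa b wb m n s M x : hom a wa -> hom b wb -> G s M x ->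
  G (s + (wa + wb).-1) (M + wa%:Z + wb%:Z - m - n - 2) (Y a m (Y b n x) - Y b n (Y a m x)).
Proof.
move=> ha hb Gx; apply: (commutator_in VA (G_sub _ _)) => i.
have [->|[w Ew hw]] := homY i%:Z ha hb; first by rewrite (Y0l VA); apply: (sub0 (G_sub _ _)).
by apply: G_mono (G_mode (n := m + n - i%:Z) hw Gx); lia.
Qed.

Lemma G_act l s M x : valid l -> G s M x -> G (s + wsum l) (M + (deg l)%:Z) (act l x).
Proof.
elim: l s M x => [|[[a w] n] l IH] s M x /=; first by rewrite addn0 addr0.
case=> ha w0 n0 /IH{}IH /IH H.
by apply: G_mono (G_letter ha w0 n0 H); rewrite /wsum /deg /=; lia.
Qed.

Lemma hom_act l : valid l -> hom (act l one) (deg l).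
Proof.
elim: l => [|[[a w] n] l IH] /=.
  by move=> _; split; [rewrite /deg /= D_one scale0r|left; apply: z2_one Z2].
case=> -[Da Pa] w0 n0 /IH[Dl Pl]; split; last exact: parityY.
rewrite (D_hom _ Da Dl); congr (_ *: _); rewrite pmulrn; congr (_ %:~R).
by rewrite /deg /=; lia.
Qed.

Lemma G_actY l n s M x : valid l -> G s M x ->
  G (s + wsum l) (M + (deg l)%:Z - n - 1) (Y (act l one) n x) /\
  (0 <= n -> G (s + (wsum l).-1) (M + (deg l)%:Z - n - 1) (Y (act l one) n x)).
Proof.
elim: l n s M x => [|[[a w] m] l IH] n s M x vl Gx.
  rewrite /= (va_vac VA); case: eqP => [->|_]; split=> //.
  - by apply: G_mono Gx; rewrite /wsum /deg /=; lia.
  - by apply: (sub0 (G_sub _ _)).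
  - by move=> _; apply: (sub0 (G_sub _ _)).
have /= [ha w0 m0 vl'] := vl; split=> [|n0]; apply: (iterate_in VA (G_sub _ _)) => i /=.
- have [H _] := IH (n + i%:Z) _ _ _ vl' Gx.
  by apply: G_mono (G_mode (n := - m%:Z - i%:Z) ha H); rewrite /wsum /deg /=; lia.
- have [H _] := IH (n - m%:Z - i%:Z) _ _ _ vl' (G_pos ha (isT : 0 <= i%:Z) Gx).
  by apply: G_mono H; rewrite /wsum /deg /=; lia.
- have [l0|l0] := posnP (wsum l).
    have -> : l = [::] by case: (l) vl' l0 => [//|[[b wb] k] l0] [_ + _ _]; rewrite /wsum /=; lia.
    rewrite /= (va_vac VA) ifF; last by lia.
    by rewrite (Y0r VA); apply: (sub0 (G_sub _ _)).
  have [_ H] := IH (n + i%:Z) _ _ _ vl' Gx.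
  have {}H := H ltac:(lia).
  by apply: G_mono (G_mode (n := - m%:Z - i%:Z) ha H); move: l0; rewrite /wsum /deg /=; lia.
- have [H _] := IH (n - m%:Z - i%:Z) _ _ _ vl' (G_pos ha (isT : 0 <= i%:Z) Gx).
  by apply: G_mono H; rewrite /wsum /deg /=; lia.
Qed.

Definition C2_gens (w : nat) : set V := [set x | exists a wa b wb,
  [/\ hom a wa, hom b wb, (wa + wb).+1 = w & x = Y a (- 2) b]].

Variable P : nat.
Hypothesis C2P : forall w a, (P < w)%N -> hom a w -> lin_span (C2_gens w) a.

(** A vector b_(-2) c of weight w acts through modes of b and c, whose weights add up to w - 1. It
    is here that C2-cofiniteness enters the filtration. *)
Lemma G_big a w n s M x : (P < w)%N -> hom a w -> G s M x ->
  G (s + w.-1) (M + w%:Z - n - 1) (Y a n x).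
Proof.
move=> Pw ha Gx; move: (C2P Pw ha); apply: (span_lin (va_linl VA n x) (G_sub _ _)).
move=> _ [b [wb [c [wc [hb hc <- ->]]]]].
apply: (iterate_in VA (G_sub _ _)) => i.
- by apply: G_mono (G_mode (n := - 2 - i%:Z) hb (G_mode (n := n + i%:Z) hc Gx)); lia.
- by apply: G_mono (G_mode (n := n - 2 - i%:Z) hc (G_mode (n := i%:Z) hb Gx)); lia.
Qed.

End Words.

(** * Lowering words with many small indices *)

Section SpanningSet.
Context (C : numFieldType) (V : lmodType C) (Y : V -> int -> V -> V) (one : V).
Context (Ev Od : set V) (D : V -> V) (omega : V).
Hypothesis G2 : cft_z2_graded Y one Ev Od D omega.
Let Z2 := cft_z2 G2.
Let VA := z2_va Z2.
Variable P : nat.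
Hypothesis C2P : forall w a, (P < w)%N -> hom Ev Od D a w -> lin_span (C2_gens Y Ev Od D w) a.
Local Notation G := (G Y one Ev Od D).
Local Notation hom := (hom Ev Od D).
Local Notation valid := (@valid C V Ev Od D).
Local Notation act := (act Y).
Implicit Types (p : V * nat) (s m n : nat) (M : int) (x : V) (l : seq (letter V)).

Definition wsumA (ps : seq (V * nat)) := sumn [seq p.2 | p <- ps].
Definition ones (ps : seq (V * nat)) := zip ps (nseq (size ps) 1%N).

Lemma wsum_zip ps ns : size ns = size ps -> wsum (zip ps ns) = wsumA ps.
Proof.
rewrite /wsum /wsumA; elim: ps ns => [|p ps IH] [|n ns] //= [E].
by rewrite IH.
Qed.

Lemma wsum_ones ps : wsum (ones ps) = wsumA ps.
Proof. by rewrite wsum_zip // size_nseq. Qed.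

Lemma deg_ones ps : deg (ones ps) = wsumA ps.
Proof. by rewrite /deg /wsumA /ones; elim: ps => //= p ps ->; rewrite addn0. Qed.

Lemma deg_zip ps ns : size ns = size ps -> all (leq 1) ns ->
  (deg (zip ps ns) + size ps = wsumA ps + sumn ns)%N.
Proof.
rewrite /deg /wsumA; elim: ps ns => [|p ps IH] [|n ns] //= [E] /andP[n0 h].
by have := IH ns E h; lia.
Qed.

Lemma valid_zip ps ns : valid (ones ps) -> size ns = size ps -> all (leq 1) ns ->
  valid (zip ps ns).
Proof.
by elim: ps ns => [|p ps IH] [|n ns] //= [hp p0 _ vps] [E] /andP[n0 hn]; split=> //; apply: IH.
Qed.

Lemma valid_cat l l' : valid (l ++ l') <-> valid l /\ valid l'.
Proof.
elim: l => [|t l IH] /=; first by split=> // [[]].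
by split=> [[? ? ? /IH[]]|[[? ? ? ?] ?]]; split=> //; apply/IH.
Qed.

Lemma act_cat l l' x : act (l ++ l') x = act l (act l' x).
Proof. exact: foldr_cat. Qed.

Lemma wsum_cat l l' : wsum (l ++ l') = (wsum l + wsum l')%N.
Proof. by rewrite /wsum map_cat sumn_cat. Qed.

Lemma deg_cat l l' : deg (l ++ l') = (deg l + deg l')%N.
Proof. by rewrite /deg map_cat sumn_cat. Qed.

Definition index_ok (ps : seq (V * nat)) ns m :=
  [/\ size ns = size ps, all (leq 1) ns & (sumn ns + 1 = m + size ps)%N].

(** A congruence modulo the next lower level of [G]: the leading words have the letters [ps], and
    [Q] restricts their indices. [index_ok] is the condition that a word have the same weight as the
    mode -m of the product of the letters. *)
Definition LS (Q : pred (seq nat)) (ps : seq (V * nat)) m s M x : set V :=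
  lin_span ([set y | exists ns, [/\ index_ok ps ns m, Q ns & y = act (zip ps ns) x]]
    `|` [set y | (0 < wsumA ps)%N /\
           G (s + (wsumA ps).-1) (M + (wsumA ps)%:Z + m%:Z - 1) y]).

Lemma LS_sub Q ps m s M x : subspace (LS Q ps m s M x). Proof. exact: span_sub. Qed.

Lemma LS_G Q ps m s M x y : (0 < wsumA ps)%N ->
  G (s + (wsumA ps).-1) (M + (wsumA ps)%:Z + m%:Z - 1) y -> LS Q ps m s M x y.
Proof. by move=> w0 Gy; apply: span_incl; right. Qed.

Lemma LS_prefix (Q Q' : pred (seq nat)) p ps m i s M x y : (i < m)%N ->
  hom p.1 p.2 -> (0 < p.2)%N -> (forall ns, Q' ns -> Q (i.+1 :: ns)) ->
  LS Q' ps (m - i) s M x y -> LS Q (p :: ps) m s M x (Y p.1 (- i.+1%:Z) y).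
Proof.
move=> lt_im hp p0 QQ'; apply: (span_lin (va_linr VA _ _) (LS_sub _ _ _ _ _ _)).
move=> z [[ns [[E1 E2 E3] Qns ->]]|[w0 Gz]].
  apply: span_incl; left; exists (i.+1 :: ns); split=> //; last exact: QQ'.
  by split=> //=; [rewrite E1|lia].
apply: LS_G; first by rewrite /wsumA /=; lia.
by apply: (G_mono _ _ (G_mode G2 hp Gz)); move: w0; rewrite /wsumA /=; lia.
Qed.

Lemma prod_tail (Q : pred (seq nat)) p ps m s M x (i : nat) : valid (ones (p :: ps)) -> G s M x ->
  LS Q (p :: ps) m s M x (Y (act (ones ps) one) (- m%:Z - 1 - i%:Z) (Y p.1 i%:Z x)) /\
  ((m <= i)%N ->
    LS Q (p :: ps) m s M x (Y p.1 (- 1 - i%:Z) (Y (act (ones ps) one) (- m%:Z + i%:Z) x))).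
Proof.
move=> [/= hp p0 _ vps] Gx.
have w0 : (0 < wsumA (p :: ps))%N by rewrite /wsumA /=; lia.
split=> [|le_mi]; apply: LS_G => //.
  have [H _] := G_actY G2 (- m%:Z - 1 - i%:Z) vps (G_pos G2 hp (isT : 0 <= i%:Z) Gx).
  by apply: (G_mono _ _ H); rewrite ?wsum_ones ?deg_ones /wsumA /=; lia.
have [ps0|ps0] := posnP (wsumA ps).
  have -> : ps = [::].
    by case: (ps) vps ps0 => [//|q qs] [_ + _ _]; rewrite /wsumA /=; lia.
  rewrite /= (va_vac VA) ifF; last by lia.
  by rewrite (Y0r VA); apply: (sub0 (G_sub _ _ _ _ _ _ _)).
have [_ H] := G_actY G2 (- m%:Z + i%:Z) vps Gx.
have {}H := H ltac:(lia).
apply: (G_mono _ _ (G_mode (n := - 1 - i%:Z) G2 hp H)).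
  by move: ps0; rewrite wsum_ones /wsumA /=; lia.
by rewrite deg_ones /wsumA /=; lia.
Qed.

Lemma prod_in ps m s M x : valid (ones ps) -> (0 < m)%N -> G s M x ->
  LS predT ps m s M x (Y (act (ones ps) one) (- m%:Z) x).
Proof.
elim: ps m => [|p ps IH] m vps m0 Gx.
  rewrite /= (va_vac VA); case: eqP => E; last exact: (sub0 (LS_sub _ _ _ _ _ _)).
  by apply: span_incl; left; exists [::]; split=> //; split=> //=; lia.
have /= [hp p0 _ vps'] := vps.
apply: (iterate_in VA (LS_sub _ _ _ _ _ _)) => i.
  have [lt_im|le_mi] := ltnP i m.
    rewrite (_ : - 1 - i%:Z = - i.+1%:Z); last by lia.
    rewrite (_ : - m%:Z + i%:Z = - (m - i)%N%:Z); last by lia.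
    by apply: LS_prefix (IH _ vps' _ Gx) => //; rewrite subn_gt0.
  have [_ H] := prod_tail predT m i vps Gx; exact: H.
have [H _] := prod_tail predT m i vps Gx.
by congr (LS _ _ _ _ _ _ (Y _ _ _)) : H; lia.
Qed.

(** The coefficients (-1)^i binom(-1, i) of the iterate formula for index -1 all equal 1, so each
    index sequence occurs once with coefficient 1. The constant sequence n, ..., n occurs exactly
    when m - 1 is n - 1 times the number of letters. All m are needed for the induction. *)
Lemma prod_lead ps m n s M x : (0 < n)%N -> valid (ones ps) -> (0 < m)%N -> G s M x ->
  LS (fun ns => ~~ all (pred1 n) ns) ps m s M x
   (Y (act (ones ps) one) (- m%:Z) x -
    (if m == (size ps * n.-1).+1 then act (zip ps (nseq (size ps) n)) x else 0)).
Proof.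
move=> n0; elim: ps m => [|p ps IH] m vps m0 Gx.
  rewrite /= (va_vac VA) (_ : (- m%:Z == - 1) = (m == 1%N)); last by lia.
  by rewrite subrr; apply: (sub0 (LS_sub _ _ _ _ _ _)).
have /= [hp p0 _ vps'] := vps; set S := LS _ _ _ _ _ _; have sS : subspace S := LS_sub _ _ _ _ _ _.
have [N0 H] := iterate VA p.1 (act (ones ps) one) x (- 1) (- m%:Z).
rewrite (H (N0 + n)%N (leq_addr _ _)) {H}.
have S2 i : S (Y (act (ones ps) one) (- m%:Z - 1 - i%:Z) (Y p.1 i%:Z x)).
  by have [] := prod_tail (fun ns => ~~ all (pred1 n) ns) m i vps Gx.
have S1 i : (m <= i)%N -> S (Y p.1 (- 1 - i%:Z) (Y (act (ones ps) one) (- m%:Z + i%:Z) x)).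
  by have [] := prod_tail (fun ns => ~~ all (pred1 n) ns) m i vps Gx.
have lt_n : (n.-1 < N0 + n)%N by lia.
rewrite (bigD1 (Ordinal lt_n)) //= addrAC; apply: (subD sS); last first.
  apply: sub_sum => // i ne_i; apply: (subZ _ sS); apply: (subB sS); last first.
    by apply: (subZ _ sS); apply: S2.
  have [lt_im|le_mi] := ltnP i m; last exact: S1.
  rewrite (_ : - 1 - i%:Z = - i.+1%:Z); last by lia.
  rewrite (_ : - m%:Z + i%:Z = - (m - i)%N%:Z); last by lia.
  apply: LS_prefix (prod_in vps' _ Gx) => // [ns _|]; last by rewrite subn_gt0.
  rewrite /= negb_and; apply/orP; left; apply: contra ne_i => /eqP E.
  by apply/eqP/val_inj => /=; lia.
rewrite binzN1 -exprD addnn -mul2n exprM sqrrN expr1n expr1n scale1r.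
rewrite -addrA addrC -addrA; apply: (subD sS).
  by apply: (subN sS); apply: (subZ _ sS); apply: S2.
have [lt_im|le_mi] := ltnP n.-1 m.
  rewrite (_ : - 1 - n.-1%:Z = - n.-1.+1%:Z); last by lia.
  rewrite (_ : - m%:Z + n.-1%:Z = - (m - n.-1)%N%:Z); last by lia.
  have -> : (m == ((size ps).+1 * n.-1).+1) = ((m - n.-1)%N == (size ps * n.-1).+1).
    by rewrite mulSn; lia.
  rewrite addrC (_ : (if _ then _ else _) = Y p.1 (- n.-1.+1%:Z)
    (if (m - n.-1)%N == (size ps * n.-1).+1 then act (zip ps (nseq (size ps) n)) x else 0)).
    rewrite -(linB _ _ (va_linr VA _ _)).
    apply: LS_prefix (IH _ vps' _ Gx) => // [ns|]; last by rewrite subn_gt0.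
    by rewrite /= negb_and => ->; rewrite orbT.
  by case: ifP => _; rewrite ?(Y0r VA) // prednK.
rewrite ifF; last by apply/negbTE; rewrite neq_ltn ltnS mulSn (leq_trans le_mi) ?leq_addr.
by rewrite addrC subr0; apply: S1.
Qed.

Definition lowered l := forall s M x, valid l -> G s M x ->
  G (s + (wsum l).-1) (M + (deg l)%:Z) (act l x).

Lemma act_front l t l' s M x : valid (l ++ t :: l') -> G s M x ->
  G (s + (wsum (l ++ t :: l')).-1) (M + (deg (l ++ t :: l'))%:Z)
    (act (l ++ t :: l') x - act (t :: l ++ l') x).
Proof.
elim: l => [|b l IH] /=; first by rewrite subrr => *; exact: (sub0 (G_sub _ _ _ _ _ _ _)).
move=> [hb b0 n0 v] Gx; have [vl /= [ht t0 m0 vl']] := (iffLR (valid_cat _ _)) v.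
have sG := G_sub Y one Ev Od D.
have Gy : G (s + wsum (l ++ l')) (M + (deg (l ++ l'))%:Z) (act (l ++ l') x).
  by apply: (G_act G2) => //; apply/valid_cat.
have H1 := G_letter G2 hb b0 n0 (IH v Gx).
have H2 := G_comm (m := - b.2%:Z) (n := - t.2%:Z) G2 hb ht Gy.
have -> : Y b.1.1 (- b.2%:Z) (act (l ++ t :: l') x) -
    Y t.1.1 (- t.2%:Z) (Y b.1.1 (- b.2%:Z) (act (l ++ l') x)) =
  Y b.1.1 (- b.2%:Z) (act (l ++ t :: l') x - act (t :: l ++ l') x) +
  (Y b.1.1 (- b.2%:Z) (Y t.1.1 (- t.2%:Z) (act (l ++ l') x)) -
   Y t.1.1 (- t.2%:Z) (Y b.1.1 (- b.2%:Z) (act (l ++ l') x))).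
  by rewrite (linB _ _ (va_linr VA _ _)) /=; lmod C.
apply: (subD (sG _ _)).
  apply: (G_mono _ _ H1); move: b0 t0 n0; rewrite !(wsum_cat, deg_cat) /wsum /deg /= ?map_cat ?sumn_cat /=; lia.
apply: (G_mono _ _ H2); move: b0 t0 n0 m0; rewrite !(wsum_cat, deg_cat) /wsum /deg /= ?map_cat ?sumn_cat /=; lia.
Qed.

Lemma valid_perm l l' : perm_eq l l' -> valid l -> valid l'.
Proof.
have vP k : valid k <-> forall t, t \in k ->
    [/\ hom t.1.1 t.1.2, (0 < t.1.2)%N & (0 < t.2)%N].
  elim: k => [|t k IH] /=; first by split.
  split=> [[ht t0 n0 /IH vk] u|H].
    by rewrite inE => /orP[/eqP ->|/vk].
  have [|ht t0 n0] := H t; first by rewrite inE eqxx.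
  by split=> //; apply/IH => u uk; apply: H; rewrite inE uk orbT.
by move=> /perm_mem E /vP vl; apply/vP => t; rewrite -E; apply: vl.
Qed.

Lemma act_perm l l' s M x : perm_eq l l' -> valid l -> G s M x ->
  G (s + (wsum l).-1) (M + (deg l)%:Z) (act l x - act l' x).
Proof.
elim: l l' => [|t l IH] l' pl vl Gx.
  move: pl; rewrite perm_sym => /perm_nilP ->; rewrite subrr.
  exact: (sub0 (G_sub _ _ _ _ _ _ _)).
have tl' : t \in l' by rewrite -(perm_mem pl) inE eqxx.
have vl' := valid_perm pl vl.
have vl'0 := vl'; case/splitPr: tl' pl vl' vl'0 => l1 l2 pl _ vl'.
have {}pl : perm_eq l (l1 ++ l2).
  rewrite -(perm_cons t) (perm_trans pl) // -[t :: l2]cat1s perm_catCA.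
  exact: perm_refl.
have [ht t0 n0 vl0] := vl.
have -> : act (t :: l) x - act (l1 ++ t :: l2) x =
    Y t.1.1 (- t.2%:Z) (act l x - act (l1 ++ l2) x) -
    (act (l1 ++ t :: l2) x - act (t :: l1 ++ l2) x).
  by rewrite (linB _ _ (va_linr VA _ _)) /=; lmod C.
apply: (subB (G_sub _ _ _ _ _ _ _)).
  have H := G_letter G2 ht t0 n0 (IH _ pl vl0 Gx).
  have [l0|l_gt0] := posnP (wsum l).
    have El : l = [::].
      by case: (l) vl0 l0 => [//|u k] [_ + _ _]; rewrite /wsum /=; lia.
    move: pl; rewrite El perm_sym => /perm_nilP ->; rewrite subrr (Y0r VA).
    exact: (sub0 (G_sub _ _ _ _ _ _ _)).
  by apply: (G_mono _ _ H); move: l_gt0 t0 n0; rewrite /wsum /deg /=; lia.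
have Ew : wsum (t :: l) = wsum (l1 ++ t :: l2).
  rewrite /wsum; apply: perm_sumn; apply: perm_map.
  by rewrite -[t :: l2]cat1s perm_sym perm_catCA /= perm_cons perm_sym.
have Ed : deg (t :: l) = deg (l1 ++ t :: l2).
  rewrite /deg; apply: perm_sumn; apply: perm_map.
  by rewrite -[t :: l2]cat1s perm_sym perm_catCA /= perm_cons perm_sym.
by rewrite Ew Ed; apply: act_front.
Qed.

Lemma lowered_perm l l' : perm_eq l l' -> lowered l -> lowered l'.
Proof.
move=> pl Ll s M x vl' Gx; have vl : valid l by apply: valid_perm vl'; rewrite perm_sym.
have Ew : wsum l = wsum l' by rewrite /wsum; apply: perm_sumn; apply: perm_map.
have Ed : deg l = deg l' by rewrite /deg; apply: perm_sumn; apply: perm_map.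
have -> : act l' x = act l x - (act l x - act l' x) by lmod C.
rewrite -Ew -Ed; apply: (subB (G_sub _ _ _ _ _ _ _)); first exact: Ll.
exact: act_perm.
Qed.

Definition low n : pred (letter V) := fun t => (t.2 <= n)%N.
Definition at_index n : pred (letter V) := fun t => t.2 == n.

Lemma count_zip_low n ps ns : size ns = size ps -> count (low n) (zip ps ns) = count (geq n) ns.
Proof. by rewrite /low; elim: ps ns => [|p ps IH] [|m ns] //= [E]; rewrite IH. Qed.

(** The mean of the indices is n + 1, so if none is smaller they all equal n + 1. *)
Lemma not_all_low n ns : all (leq 1) ns -> sumn ns = (size ns * n.+1)%N ->
  ~~ all (pred1 n.+1) ns -> (0 < count (geq n) ns)%N.
Proof.
move=> _ E; apply: contraNT; rewrite -eqn0Ngt => /eqP c0.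
have {c0} h : all (leq n.+1) ns.
  by apply/allP => m mns; rewrite ltnNge; apply/negP => le_mn; move/eqP: c0;
    rewrite eqn0Ngt -has_count => /negP; apply; apply/hasP; exists m.
elim: ns E h => //= m ns IH; rewrite mulSn => E /andP[hm hns].
have le_ns : (size ns * n.+1 <= sumn ns)%N.
  elim: (ns) hns => //= k ks IHk /andP[hk hks]; rewrite mulSn leq_add // IHk //.
by rewrite IH //; first (apply/andP; split=> //; apply/eqP); lia.
Qed.

(* A block of P + 1 letters of index n + 1 acts, up to lower terms, as a
   combination of words each containing a letter of smaller index. *)
Lemma lowered_block n L : (forall l, valid l -> (L <= count (low n) l)%N -> lowered l) ->
  forall j l, valid l -> (L <= count (low n) l + j)%N ->
    (P.+1 * j <= count (at_index n.+1) l)%N -> lowered l.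
Proof.
move=> HL; elim=> [|j IH] l vl hL hj; first by apply: HL => //; rewrite -[count _ _]addn0.
set fl := [seq t <- l | at_index n.+1 t].
have size_fl : size fl = count (at_index n.+1) l by rewrite size_filter.
have le_k : (P.+1 <= size fl)%N by rewrite size_fl (leq_trans _ hj) // mulnS leq_addr.
pose b := take P.+1 fl; pose rest := drop P.+1 fl ++ [seq t <- l | ~~ at_index n.+1 t].
have pl : perm_eq l (b ++ rest).
  by rewrite catA cat_take_drop perm_sym perm_filterC.
apply: (@lowered_perm (b ++ rest)); first by rewrite perm_sym.
have size_b : size b = P.+1 by rewrite size_takel.
have b_idx : all (at_index n.+1) b.
  by apply/allP => t /mem_take; rewrite mem_filter => /andP[].
pose ps := [seq t.1 | t <- b].
have Eb : b = zip ps (nseq (size ps) n.+1).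
  rewrite /ps; elim: (b) b_idx => //= -[p m] b' IHb /andP[/eqP /= -> /IHb E].
  by rewrite -E.
have size_ps : size ps = P.+1 by rewrite size_map.
have vall := valid_perm pl vl; have [vb vrest] := (iffLR (valid_cat _ _)) vall.
have v1 : valid (ones ps).
  rewrite /ps /ones; elim: (b) vb => //= -[p m] b' IHb [hp p0 m0 /IHb].
  by rewrite size_map.
have c_low : count (low n) rest = count (low n) l.
  have -> : count (low n) l = (count (low n) b + count (low n) rest)%N.
    by rewrite -count_cat; apply/permP.
  rewrite (_ : count (low n) b = 0%N) //; apply/eqP; rewrite eqn0Ngt -has_count.
  apply/hasPn => t /(allP b_idx) /eqP E; by rewrite /low E ltnn.
have c_at : count (at_index n.+1) l = (P.+1 + count (at_index n.+1) rest)%N.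
  by move: b_idx; rewrite all_count => /eqP Eb'; rewrite -size_b -Eb' -count_cat; apply/permP.
have w0 : (P < wsumA ps)%N.
  rewrite -ltnS -size_ps ltnS /wsumA; elim: (ps) v1 => //= p qs IHq [_ p0 _ /IHq h].
  by rewrite -add1n leq_add.
move=> s M x _ Gx; rewrite act_cat; set y := act rest x.
have Gy : G (s + wsum rest) (M + (deg rest)%:Z) y by apply: (G_act G2).
(* In this mode the indices of a leading word have mean n + 1, so every word but the block itself
   has an index at most n. *)
pose m := (size ps * n.+1.-1).+1.
have := prod_lead (ltn0Sn n) v1 (ltn0Sn _ : (0 < m)%N) Gy.
rewrite eqxx -Eb.
(* A product of P + 1 letters of positive weight has weight above P, so its modes fall one level
   lower by C2-cofiniteness. *)
have GY : G (s + (wsum (b ++ rest)).-1) (M + (deg (b ++ rest))%:Z)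
    (Y (act (ones ps) one) (- m%:Z) y).
  have h1 : hom (act (ones ps) one) (wsumA ps) by rewrite -deg_ones; apply: (hom_act G2).
  apply: (G_mono _ _ (G_big (n := - m%:Z) G2 C2P w0 h1 Gy)).
    by rewrite wsum_cat [in wsum b]Eb wsum_zip ?size_nseq //; lia.
  have := deg_zip (ps := ps) (ns := nseq (size ps) n.+1).
  rewrite size_nseq -Eb => /(_ erefl); rewrite all_nseq orbT => /(_ isT).
  rewrite sumn_nseq /m deg_cat /=; lia.
set S := LS _ _ _ _ _ _ => HS.
suff SG : S `<=` G (s + (wsum (b ++ rest)).-1) (M + (deg (b ++ rest))%:Z).
  have -> : act b y = Y (act (ones ps) one) (- m%:Z) y -
     (Y (act (ones ps) one) (- m%:Z) y - act b y) by lmod C.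
  by apply: (subB (G_sub _ _ _ _ _ _ _)) => //; apply: SG.
apply: span_min; first exact: G_sub.
move=> z [[ns [[E1 E2 E3] Qns ->]]|[_]]; last first.
  apply: G_mono; first by rewrite wsum_cat [in wsum b]Eb wsum_zip ?size_nseq //; lia.
  have := deg_zip (ps := ps) (ns := nseq (size ps) n.+1).
  rewrite size_nseq -Eb => /(_ erefl); rewrite all_nseq orbT => /(_ isT).
  rewrite sumn_nseq /m deg_cat /=; lia.
have Ens : sumn ns = (size ns * n.+1)%N by rewrite E1 mulnS; move: E3; rewrite /m /=; lia.
have low1 := not_all_low E2 Ens Qns.
have v2 : valid (zip ps ns ++ rest) by apply/valid_cat; split=> //; apply: valid_zip.
have low2 : lowered (zip ps ns ++ rest).
  apply: IH => //; rewrite count_cat.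
    rewrite count_zip_low // c_low; lia.
  by move: hj; rewrite mulnS c_at leq_add2l => h; rewrite (leq_trans h) // leq_addl.
have := low2 s M x v2 Gx; rewrite act_cat; apply: G_mono.
  by rewrite !wsum_cat Eb !wsum_zip ?size_nseq.
have := deg_zip (ps := ps) (ns := nseq (size ps) n.+1).
rewrite size_nseq -Eb => /(_ erefl); rewrite all_nseq orbT => /(_ isT).
rewrite sumn_nseq !deg_cat; have := deg_zip E1 E2; rewrite Ens E1; lia.
Qed.

(** Among L + (P + 1) L letters of index at most n + 1, either L have index at most n, or (P + 1) L
    have index n + 1 and form L blocks, each convertible into a letter of smaller index. *)
Lemma lowered_low n : exists L, forall l, valid l -> (L <= count (low n) l)%N -> lowered l.
Proof.
elim: n => [|n [L IH]].
  exists 1%N => l vl; rewrite -has_count => /hasP[t tl]; rewrite /low.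
  suff -> : (t.2 <= 0)%N = false by [].
  elim: l vl tl => //= u l IHl [_ _ u0 vl]; rewrite inE => /orP[/eqP ->|]; last exact: IHl.
  by rewrite leqNgt u0.
exists (L + P.+1 * L)%N => l vl hc.
have Ec : count (low n.+1) l = (count (low n) l + count (at_index n.+1) l)%N.
  elim: (l) => //= t l' ->; rewrite /low /at_index.
  by have [] := ltngtP t.2 n.+1; lia.
have [hL|hL] := leqP L (count (low n) l); first exact: IH.
by apply: (lowered_block IH (j := L)) => //; lia.
Qed.

(** A word that cannot be lowered has letters of weight at most P, fewer than L of them with index
    at most P. In M = wsum + isum - size the indices then dominate: 2 isum - M is at least 2 size -
    P L. *)
Lemma spanning_set : exists M0 : nat, forall (M : nat) v, (M0 <= M)%N -> hom v M ->
  lin_span [set x | exists l, [/\ valid l, deg l = M, (M + 2 <= 2 * isum l)%N &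
    x = act l one]] v.
Proof.
(* The constant serves the short words, with 2 size < P L + 2: there wsum <= P size is bounded, and
   isum makes up more than half of M. *)
have [L HL] := lowered_low P; exists (P * (P * L + 2) + 2)%N => M v le_M hv.
set S := lin_span _; have sS : subspace S by exact: span_sub.
have M0 : (0 < M)%N by lia.
suff H s x : G s M%:Z x -> S x.
  apply: (H M); apply: span_incl; exists [:: (v, M, 1%N)].
  split=> //=; rewrite ?/wsum ?/deg /= ?addn0 //.
  by rewrite (va_creat VA).
elim: s x => [|s IH]; apply: span_min => // _ [l [vl ws [dl] ->]].
  case: l vl ws dl => [|t l] /=; first by move=> _ _; rewrite /deg /=; lia.
  by case=> _ + _ _; rewrite /wsum /=; lia.
move: ws; rewrite leq_eqVlt => /orP[/eqP ws|ws]; last first.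
  by apply: IH; apply: span_incl; exists l; rewrite dl.
have [hw|/allPn[t tl]] := boolP (all (fun t => (t.1.2 <= P)%N) l); last first.
  rewrite -ltnNge => hw; apply: IH; case/splitPr: tl vl ws dl => l1 l2 v12 ws dl.
  have [v1 /= [ht t0 n0 v2]] := (iffLR (valid_cat _ _)) v12.
  rewrite act_cat /=; have G2' := @G_word C V Y one Ev Od D l2 v2.
  have := G_act G2 v1 (G_big (n := - t.2%:Z) G2 C2P hw ht G2').
  by apply: G_mono; move: ws dl t0 n0; rewrite !(wsum_cat, deg_cat) /wsum /deg /=; lia.
have [hL|hL] := leqP L (count (low P) l).
  apply: IH; have := HL l vl hL 0%N 0 one vl (@G_word _ _ Y one Ev Od D [::] I).
  by apply: G_mono; lia.
apply: span_incl; exists l; split=> //.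
have [e1 e2 e3] : [/\ (wsum l <= P * size l)%N, (isum l + wsum l = deg l + size l)%N &
   (P * size l + size l <= isum l + P * count (low P) l)%N].
  elim: (l) vl hw => [|[[a w] n] l' IHl] /=; first by rewrite /wsum /isum /deg /= muln0.
  move=> [_ _ /= n0 /IHl{}IHl] /andP[hw /IHl[]].
  rewrite /wsum /isum /deg /low /= !mulnS => e1 e2 e3.
  split; [lia|lia|]; rewrite mulnDr.
  by have [h|h] := leqP n P; lia.
have h4 : (P * count (low P) l <= P * L)%N by rewrite leq_mul2l (ltnW hL) orbT.
have [h5|h5] := leqP (P * L + 2) (2 * size l); first by lia.
have h6 : (P * (2 * size l) <= P * (P * L + 2))%N by rewrite leq_mul2l (ltnW h5) orbT.
move: h6; rewrite mulnCA => h6; lia.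
Qed.

End SpanningSet.

(** * Cofiniteness of the odd part as a module over the even part *)

Section OddPart.
Context (C : numFieldType) (V : lmodType C) (Y : V -> int -> V -> V) (one : V).
Context (Ev Od : set V) (D : V -> V) (omega : V).
Hypothesis G2 : cft_z2_graded Y one Ev Od D omega.
Let Z2 := cft_z2 G2.
Let VA := z2_va Z2.
Let dD := cft_lin G2.
Variable P : nat.
Hypothesis C2 : forall (w : nat) a, (P < w)%N -> hom Ev Od D a w ->
  lin_span [set x | exists u v, [/\ Ev u \/ Od u, Ev v \/ Od v & x = Y u (- 2) v]] a.
Local Notation hom := (hom Ev Od D).
Local Notation der := (der Y one).
Implicit Types (u v x y z : V).

Lemma bilinear_span (X X' : set V) u v n : lin_span X u -> lin_span X' v ->
  lin_span [set z | exists x x', [/\ X x, X' x' & z = Y x n x']] (Y u n v).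
Proof.
move=> Xu; apply: (span_lin (va_linr VA u n)); first exact: span_sub.
move=> x' Xx'; move: u Xu; apply: (span_lin (va_linl VA n x')); first exact: span_sub.
by move=> x Xx; apply: span_incl; exists x, x'.
Qed.

Definition C2_pairs (A B : set V) (w : nat) : set V := [set x | exists a wa b wb,
  [/\ A a /\ D a = wa%:R *: a, B b /\ D b = wb%:R *: b, (wa + wb).+1 = w & x = Y a (- 2) b]].

Lemma parity_hom u : Ev u \/ Od u -> lin_span [set v | exists w, hom v w] u.
Proof.
move=> Pu; suff : lin_span [set v | (Ev v \/ Od v) /\ exists n : int, eig D n%:~R v] u.
  apply: span_min; first exact: span_sub.
  move=> v [Pv [n Dn]]; have [->|hv] := hom_int G2 Pv Dn; first exact: (sub0 (span_sub _)).
  by apply: span_incl; exists `|n|%N.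
case: Pu => [/(cft_Ev G2)|/(cft_Od G2)]; apply: span_mono => v [Pv En].
  by split=> //; left.
by split=> //; right.
Qed.

Lemma C2_hom (w : nat) a : (P < w)%N -> hom a w -> lin_span (C2_gens Y Ev Od D w) a.
Proof.
move=> Pw ha; pose X : set V := [set z | exists x x',
  [/\ (exists k, hom x k), exists k, hom x' k & z = Y x (- 2) x']].
have Xa : lin_span X a.
  move: (C2 Pw ha); apply: span_min; first exact: span_sub.
  move=> _ [u [v [/parity_hom Pu /parity_hom Pv ->]]].
  have := bilinear_span (n := - 2) Pu Pv.
  by apply: span_mono => z [x [x' [[k hx] [k' hx'] ->]]]; exists x, x'; split=> //; eexists; eassumption.
have {}Xa : lin_span (X `&` eig D w%:R) a.
  apply: (eig_span dD); last by split=> //; case: ha.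
  move=> _ [x [x' [[k [Dk _]] [k' [Dk' _]] ->]]].
  by eexists; apply: (D_hom G2 (- 2) Dk Dk').
move: Xa; apply: span_min; first exact: span_sub.
move=> z [[x [x' [[k hk] [k' hk'] ->]]]] Ew.
have [->|nz] := eqVneq (Y x (- 2) x') 0; first exact: (sub0 (span_sub _)).
apply: span_incl; exists x, k, x', k'; split=> //.
have := D_hom G2 (- 2) hk.1 hk'.1; rewrite (Ew : D _ = _) => /eqP.
rewrite -subr_eq0 -scalerBl scaler_eq0 (negPf nz) orbF subr_eq0 => /eqP.
rewrite (_ : k%:Z + k'%:Z - - 2 - 1 = (k + k').+1%:Z); last by lia.
by rewrite -pmulrn => /eqP; rewrite eqr_nat => /eqP.
Qed.

Lemma C2_ev (w : nat) a : (P < w)%N -> Ev a -> D a = w%:R *: a ->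
  lin_span (C2_pairs Ev Ev w `|` C2_pairs Od Od w) a.
Proof.
move=> Pw Ea Da; have := C2_hom Pw (conj Da (or_introl Ea)).
pose E := C2_pairs Ev Ev w `|` C2_pairs Od Od w.
pose O := C2_pairs Ev Od w `|` C2_pairs Od Ev w.
move=> Xa; have {}Xa : lin_span (E `|` O) a.
  move: Xa; apply: span_mono => _ [x [k [x' [k' [[Dx Px] [Dx' Px'] Ew ->]]]]].
  by case: Px => Px; case: Px' => Px'; [left; left|right; left|right; right|left; right];
    exists x, k, x', k'.
have OOd : O `<=` Od.
  by move=> _ [] [x [k [x' [k' [[Px _] [Px' _] _ ->]]]]];
    [apply: (z2_eo Z2)|apply: (z2_oe Z2)].
have EEv : E `<=` Ev.
  by move=> _ [] [x [k [x' [k' [[Px _] [Px' _] _ ->]]]]];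
    [apply: (z2_ee Z2)|apply: (z2_oo Z2)].
have := span_split (z2_Ev Z2) (z2_Od Z2) _ (z2_cap Z2) (conj Ea Xa).
move=> /(_ _) H; have {}H := H (setUSS EEv OOd).
move: H; apply: span_min; first exact: span_sub.
move=> x [[Ex|Ox] Evx]; first exact: span_incl.
by rewrite (z2_cap Z2 (conj Evx (OOd _ Ox))); apply: (sub0 (span_sub _)).
Qed.

Lemma C2_od (w : nat) a : (P < w)%N -> Od a -> D a = w%:R *: a ->
  lin_span (C2_pairs Ev Od w `|` C2_pairs Od Ev w) a.
Proof.
move=> Pw Oa Da; have := C2_hom Pw (conj Da (or_intror Oa)).
pose E := C2_pairs Ev Ev w `|` C2_pairs Od Od w.
pose O := C2_pairs Ev Od w `|` C2_pairs Od Ev w.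
move=> Xa; have {}Xa : lin_span (O `|` E) a.
  move: Xa; apply: span_mono => _ [x [k [x' [k' [[Dx Px] [Dx' Px'] Ew ->]]]]].
  by case: Px => Px; case: Px' => Px'; [right; left|left; left|left; right|right; right];
    exists x, k, x', k'.
have OOd : O `<=` Od.
  by move=> _ [] [x [k [x' [k' [[Px _] [Px' _] _ ->]]]]];
    [apply: (z2_eo Z2)|apply: (z2_oe Z2)].
have EEv : E `<=` Ev.
  by move=> _ [] [x [k [x' [k' [[Px _] [Px' _] _ ->]]]]];
    [apply: (z2_ee Z2)|apply: (z2_oo Z2)].
have cap : Od `&` Ev `<=` [set 0] by move=> x [Ox Ex]; apply: (z2_cap Z2).
have := span_split (z2_Od Z2) (z2_Ev Z2) (setUSS OOd EEv) cap (conj Oa Xa).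
apply: span_min; first exact: span_sub.
move=> x [[Ox|Ex] Odx]; first exact: span_incl.
by rewrite (cap _ (conj Odx (EEv _ Ex))); apply: (sub0 (span_sub _)).
Qed.

Definition Cs : set V := lin_span [set x | exists v y, [/\ Ev v, Od y & x = Y v (- 2) y]].

Lemma Cs_sub : subspace Cs. Proof. exact: span_sub. Qed.

Lemma Ev_der v : Ev v -> Ev (der v).
Proof. by move=> Evv; apply: (z2_ee Z2) => //; apply: z2_one Z2. Qed.

Lemma Od_der v : Od v -> Od (der v).
Proof. by move=> Ov; apply: (z2_oe Z2) => //; apply: z2_one Z2. Qed.

Lemma Ev_iter v j : Ev v -> Ev (iter j der v).
Proof. by move=> Evv; elim: j => //= j; apply: Ev_der. Qed.

Lemma Od_iter v j : Od v -> Od (iter j der v).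
Proof. by move=> Ov; elim: j => //= j; apply: Od_der. Qed.

Lemma Cs_low v y (n : int) : Ev v -> Od y -> n <= - 2 -> Cs (Y v n y).
Proof.
move=> Evv Oy n2; rewrite (_ : n = - 1 - (absz (- 1 - n)%R)%:Z); last by lia.
have : (0 < absz (- 1 - n)%R)%N by lia.
case: (absz _) => // j _; have [c ->] := Y_low VA v j.+1 y.
apply: (subZ _ Cs_sub); have {}Evv : Ev (iter j der v) by exact: Ev_iter.
rewrite iterS (Y_der VA) opprK scale1r.
by apply: span_incl; exists (iter j der v), y.
Qed.

Lemma Cs_Od : Cs `<=` Od.
Proof.
by apply: span_min (z2_Od Z2) _ => _ [v [y [Evv Oy ->]]]; apply: (z2_eo Z2).
Qed.

Lemma Cs_der y : Cs y -> Cs (der y).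
Proof.
apply: (span_lin (der_lin VA) Cs_sub) => _ [v [z [Evv Oz ->]]].
rewrite (der_Y VA); apply: (subB Cs_sub); first by apply: Cs_low => //; apply: Od_der.
by apply: (subZ _ Cs_sub); apply: Cs_low.
Qed.

Lemma Cs_m1 v y : Ev v -> Cs y -> Cs (Y v (- 1) y).
Proof.
move=> Evv; apply: (span_lin (va_linr VA _ _) Cs_sub) => _ [u [z [Evu Oz ->]]].
apply: (sub_congr Cs_sub (v := Y u (- 2) (Y v (- 1) z))); last first.
  by apply: Cs_low => //; apply: (z2_eo Z2).
apply: (commutator_in VA Cs_sub) => i; apply: Cs_low => //; last by lia.
exact: (z2_ee Z2).
Qed.

(** The derivative of v_(-1) y differs from v_(-1) of the derivative of y by v_(-2) y, an element of
    [Cs]. *)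
Lemma der_m1 v y j : Ev v -> Od y ->
  Cs (iter j der (Y v (- 1) y) - Y v (- 1) (iter j der y)).
Proof.
move=> Evv Oy; elim: j => [|j IH] /=; first by rewrite subrr; apply: (sub0 Cs_sub).
have := Cs_der IH; rewrite (linB _ _ (der_lin VA)) (der_Y VA) scaleN1r opprK => H.
apply: (sub_congr Cs_sub (v := Y v (- 1 - 1) (iter j der y))).
  by move: H; rewrite opprD addrA.
by apply: Cs_low => //; apply: Od_iter.
Qed.

(** The torsion of the odd part modulo [Cs] under the derivation. Being all of it, it contains every
    odd vector whose derivative it contains, as [odd_triple] requires. *)
Definition Ct : set V := [set y | Od y /\ exists j, Cs (iter j der y)].

Lemma Ct_sub : subspace Ct.
Proof.
split; first by split; [exact: (sub0 (z2_Od Z2))|exists 0%N; exact: (sub0 Cs_sub)].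
move=> a u v [Ou [j Cu]] [Ov [k Cv]]; split; first exact: (z2_Od Z2).2.
have up y i n : Cs (iter i der y) -> Cs (iter (n + i) der y).
  by move=> H; rewrite iterD; elim: n => //= n; apply: Cs_der.
exists (j + k)%N; have li n : lin (iter n der).
  by elim: n => [|n IH] b x x' //=; rewrite IH (der_lin VA).
rewrite li; apply: (subD Cs_sub); last exact: up.
by apply: (subZ _ Cs_sub); rewrite addnC; apply: up.
Qed.

Lemma Ct_Cs y : Cs y -> Ct y.
Proof. by move=> Cy; split; [exact: Cs_Od|exists 0%N]. Qed.

Lemma Ct_der y : Ct y -> Ct (der y).
Proof.
by case=> Oy [j Cy]; split; [exact: Od_der|exists j; rewrite -iterSr; apply: Cs_der].
Qed.

Lemma Ct_m1 v y : Ev v -> Ct y -> Ct (Y v (- 1) y).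
Proof.
move=> Evv [Oy [j Cy]]; split; first exact: (z2_eo Z2).
by exists j; apply: (sub_congr Cs_sub (der_m1 j Evv Oy)); apply: Cs_m1.
Qed.

Lemma Ct_triple a b y l m : Od a -> Od b -> Od y -> Ct (Y a l (Y b m y)).
Proof.
move=> Oa Ob Oy.
have := odd_triple (T := Ct) Z2 Ct_sub _ _ Oa Ob Oy l m (- 1).
rewrite /triple (va_creat VA); apply.
  by move=> v z n Evv Oz n2; apply: Ct_Cs; apply: Cs_low.
by move=> z Oz [_ [j Cj]]; split=> //; exists j.+1; rewrite iterSr.
Qed.

Definition P1s : set V := lin_span [set x | exists v w y,
  [/\ Ev v /\ D v = w%:R *: v, (0 < w)%N, Od y & x = Y v (- 1) y]].

(** The same torsion with the terms v_(-1) y, v even of positive weight, adjoined to [Ct]; these are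
    dealt with afterwards by iteration. *)
Definition Dt : set V := [set y | Od y /\ exists j, sum_set P1s Ct (iter j der y)].

Lemma PC_sub : subspace (sum_set P1s Ct).
Proof. by apply: sum_set_sub; [exact: span_sub|exact: Ct_sub]. Qed.

Lemma PC_der y : sum_set P1s Ct y -> sum_set P1s Ct (der y).
Proof.
move=> [p [c [Pp Cc ->]]]; rewrite (linD _ _ (der_lin VA)); apply: (subD PC_sub); last first.
  by apply: sum_setr; [exact: span_sub|exact: Ct_der].
move: p Pp; apply: (span_lin (der_lin VA) PC_sub) => _ [v [w [z [[Evv Dv] w0 Oz ->]]]].
rewrite (der_Y VA); apply: (subB PC_sub).
  apply: (sum_setl Ct_sub); apply: span_incl; exists v, w, (der z); split=> //.
  exact: Od_der.
apply: (subZ _ PC_sub); apply: sum_setr; first exact: span_sub.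
by apply: Ct_Cs; apply: Cs_low.
Qed.

Lemma iter_der_lin n : lin (iter n der).
Proof. by elim: n => [|n IH] b x x' //=; rewrite IH (der_lin VA). Qed.

Lemma Dt_sub : subspace Dt.
Proof.
split; first by split; [exact: (sub0 (z2_Od Z2))|exists 0%N; exact: (sub0 PC_sub)].
move=> a u v [Ou [j Cu]] [Ov [k Cv]]; split; first exact: (z2_Od Z2).2.
have up y i n : sum_set P1s Ct (iter i der y) -> sum_set P1s Ct (iter (n + i) der y).
  by move=> H; rewrite iterD; elim: n => //= n; apply: PC_der.
exists (j + k)%N; rewrite iter_der_lin; apply: (subD PC_sub); last exact: up.
by apply: (subZ _ PC_sub); rewrite addnC; apply: up.
Qed.

Lemma Dt_Ct y : Ct y -> Dt y.
Proof.
move=> Cy; split; first by case: Cy.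
by exists 0%N; apply: sum_setr; first exact: span_sub.
Qed.

Lemma Dt_neg v w y (n : int) : Ev v -> D v = w%:R *: v -> (0 < w)%N -> Od y -> n <= - 1 ->
  Dt (Y v n y).
Proof.
move=> Evv Dv w0 Oy; rewrite le_eqVlt => /orP[/eqP ->|n2].
  split; first exact: (z2_eo Z2).
  by exists 0%N; apply: (sum_setl Ct_sub); apply: span_incl; exists v, w, y.
by apply: Dt_Ct; apply: Ct_Cs; apply: Cs_low => //; lia.
Qed.

Lemma Dt_of_iter y j : Od y -> Dt (iter j der y) -> Dt y.
Proof.
by move=> Oy [_ [k H]]; split=> //; exists (k + j)%N; rewrite iterD.
Qed.

Fixpoint all_ev (l : seq (letter V)) : Prop :=
  if l is t :: l' then Ev t.1.1 /\ all_ev l' else True.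

Lemma all_ev_act l : all_ev l -> Ev (act Y l one).
Proof.
elim: l => [|t l IH] /=; first by move=> _; apply: z2_one Z2.
by move=> [Et /IH]; apply: (z2_ee Z2).
Qed.

(** In the iterate formula either a letter stands on the left in a negative mode, as [Dt] allows, or
    the remaining word acts in a mode lowered by at least its removed index. At the end of the
    latter branch the vacuum acts in a mode below -1, that is by 0. *)
Lemma even_word_low l y (m : int) : valid Ev Od D l -> all_ev l -> Od y ->
  m < (isum l)%:Z - 1 -> Dt (Y (act Y l one) m y).
Proof.
elim: l y m => [|[[a w] n] l IH] y m.
  move=> _ _ Oy; rewrite /isum /= => hm; rewrite (va_vac VA) ifF; last by lia.
  exact: (sub0 Dt_sub).
move=> [/= [Da _] w0 n0 vl] [/= Ea El] Oy hm.
apply: (iterate_in VA Dt_sub) => i.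
  apply: (Dt_neg Ea Da w0); last by lia.
  by apply: (z2_eo Z2) => //; apply: all_ev_act.
apply: IH => //; first exact: (z2_eo Z2).
by move: hm; rewrite /isum /=; lia.
Qed.

(** Even vectors made of two odd ones: the product of such a vector with an odd one is a product of
    three odd vectors, so lies in [Ct]. *)
Definition Is : set V := lin_span [set x | exists a b n, [/\ Od a, Od b & x = Y a n b]].

Lemma Is_Ev v x (n : int) : Ev v -> Is x -> Is (Y v n x).
Proof.
move=> Evv; apply: (span_lin (va_linr VA _ _) (span_sub _)) => _ [a [b [m [Oa Ob ->]]]].
apply: (sub_congr (span_sub _) (v := Y a m (Y v n b))); last first.
  by apply: span_incl; exists a, (Y v n b), m; split=> //; apply: (z2_eo Z2).
apply: (commutator_in VA (span_sub _)) => i; apply: span_incl.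
by eexists _, b, _; split; [|exact: Ob|reflexivity]; apply: (z2_eo Z2).
Qed.

Lemma Is_act x y (m : int) : Is x -> Od y -> Ct (Y x m y).
Proof.
move=> Ix Oy; move: x Ix; apply: (span_lin (va_linl VA m y) Ct_sub).
move=> _ [a [b [n [Oa Ob ->]]]].
by apply: (iterate_in VA Ct_sub) => i; apply: Ct_triple.
Qed.

Lemma Is_sub_Ev : Is `<=` Ev.
Proof.
by apply: span_min (z2_Ev Z2) _ => _ [a [b [n [Oa Ob ->]]]]; apply: (z2_oo Z2).
Qed.

Lemma word_cases l : valid Ev Od D l -> [\/ all_ev l, Is (act Y l one) | Od (act Y l one)].
Proof.
elim: l => [|[[a w] n] l IH]; first by constructor 1.
move=> [/= [_ [Ea|Oa]] _ _ /IH[El|Il|Ol]].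
- by constructor 1.
- by constructor 2; apply: Is_Ev.
- by constructor 3; apply: (z2_eo Z2).
- by constructor 3; apply: (z2_oe Z2) => //; apply: all_ev_act.
- by constructor 3; apply: (z2_oe Z2) => //; apply: Is_sub_Ev.
- by constructor 2; apply: span_incl; exists a, (act Y l one), (- n%:Z).
Qed.

Definition conf_word K : seq (letter V) := nseq K (omega, 2%N, 1%N).

Lemma conf_word_valid K : valid Ev Od D (conf_word K) /\ all_ev (conf_word K).
Proof.
have [Eo Do _] := cft_conf G2.
by elim: K => [|K [IH1 IH2]] //=; split; split=> //; split=> //; left.
Qed.

Lemma isum_conf K : isum (conf_word K) = K.
Proof. by rewrite /isum; elim: K => //= K ->. Qed.

Lemma deg_conf K : deg (conf_word K) = (2 * K)%N.
Proof. by rewrite /deg; elim: K => [//|K /= ->]; rewrite mulnS. Qed.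

(* The leading coefficient of the K-th power of omega acts as the K-th power
   of the derivation. *)
Lemma conf_power K y : Od y ->
  Dt (Y (act Y (conf_word K) one) (K%:Z - 1) y - iter K der y).
Proof.
have [Eo Do o0] := cft_conf G2.
elim: K y => [|K IH] y Oy.
  by rewrite /= (va_vac VA) /= subrr; apply: (sub0 Dt_sub).
rewrite [act _ _ _]/=; set u := act Y (conf_word K) one.
have [vK eK] := conf_word_valid K; have Eu : Ev u by apply: all_ev_act.
rewrite (_ : K.+1%:Z - 1 = K); last by lia.
have [N0 /(_ N0.+1 (leqnSn _)) ->] := iterate VA omega u y (- 1) K%:Z.
rewrite big_ord_recl -addrA addrC -addrA; apply: (subD Dt_sub).
  apply: sub_sum => [|i _]; first exact: Dt_sub.
  apply: (subZ _ Dt_sub); apply: (subB Dt_sub).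
    by apply: (Dt_neg Eo Do) => //; apply: (z2_eo Z2).
  apply: (subZ _ Dt_sub); apply: even_word_low => //; first exact: (z2_eo Z2).
  by rewrite isum_conf lift0; lia.
rewrite binz0 expr0 mulr1 scale1r /= subr0 addr0 scaleN1r opprK addrC -addrA.
apply: (subD Dt_sub).
  by apply: (Dt_neg Eo Do) => //; apply: (z2_eo Z2).
rewrite -iterS iterSr o0 // (_ : K%:Z - 1 - 0 = K%:Z - 1); [apply: IH; exact: Od_der|lia].
Qed.

(** The word in omega has index sum K and weight 2K, and the spanning set reaches index sum K + 1.
    This excess of 1 puts the mode K - 1 below isum - 1, as [even_word_low] demands. *)
Lemma Od_Dt : Od `<=` Dt.
Proof.
move=> y Oy; have [M0 HM] := spanning_set G2 C2_hom.
pose K := M0.+1; have [vK eK] := conf_word_valid K.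
have hK := hom_act G2 vK; rewrite deg_conf in hK.
have le_M0 : (M0 <= 2 * K)%N by rewrite /K; lia.
have H := HM _ _ le_M0 hK.
set X := [set x | _] in H.
have XE : X `<=` Ev `|` Od.
  move=> _ [l [vl _ _ ->]]; have [/all_ev_act|/Is_sub_Ev|] := word_cases vl;
  by [left|left|right].
have := span_split (z2_Ev Z2) (z2_Od Z2) XE (z2_cap Z2) (conj (all_ev_act eK) H).
set u := act Y (conf_word K) one => {}H.
apply: (@Dt_of_iter _ K) => //.
have -> : iter K der y = Y u (K%:Z - 1) y - (Y u (K%:Z - 1) y - iter K der y) by lmod C.
apply: (subB Dt_sub); last exact: conf_power.
move: u H; apply: (span_lin (va_linl VA _ y) Dt_sub) => _ [[l [vl El hl ->]] Eact].
have [al|Il|Ol] := word_cases vl.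
- by apply: even_word_low => //; move: hl; lia.
- by apply: Dt_Ct; apply: Is_act.
rewrite (z2_cap Z2 (conj Eact Ol)) (Y0l VA); exact: (sub0 Dt_sub).
Qed.

Fixpoint Pk (k : nat) : set V :=
  if k is k'.+1 then lin_span [set x | exists v w z,
    [/\ Ev v /\ D v = w%:R *: v, (0 < w)%N, Pk k' z & x = Y v (- 1) z]]
  else Od.

Lemma Pk_sub k : subspace (Pk k).
Proof. by case: k => [|k]; [exact: z2_Od Z2|exact: span_sub]. Qed.

Lemma Pk_Od k : Pk k `<=` Od.
Proof.
elim: k => [//|k IH]; apply: span_min (z2_Od Z2) _ => _ [v [w [z [[Evv _] _ /IH Oz ->]]]].
exact: (z2_eo Z2).
Qed.

Lemma PkC_sub k : subspace (sum_set (Pk k) Ct).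
Proof. by apply: sum_set_sub; [exact: Pk_sub|exact: Ct_sub]. Qed.

Lemma PkC_m1 k v w y : Ev v -> D v = w%:R *: v -> (0 < w)%N -> sum_set (Pk k) Ct y ->
  sum_set (Pk k.+1) Ct (Y v (- 1) y).
Proof.
move=> Evv Dv w0 [p [c [Pp Cc ->]]]; rewrite (linD _ _ (va_linr VA _ _)).
exists (Y v (- 1) p), (Y v (- 1) c); split=> //; last exact: Ct_m1.
by apply: span_incl; exists v, w, p.
Qed.

Lemma PkC_der k y : sum_set (Pk k) Ct y -> sum_set (Pk k) Ct (der y).
Proof.
elim: k y => [|k IH] y [p [c [Pp Cc ->]]]; rewrite (linD _ _ (der_lin VA));
    apply: (subD (PkC_sub _)); try by apply: sum_setr; [exact: Pk_sub|exact: Ct_der].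
  by apply: (sum_setl Ct_sub); apply: Od_der.
move: p Pp; apply: (span_lin (der_lin VA) (PkC_sub _)) => _ [v [w [z [[Evv Dv] w0 Pz ->]]]].
rewrite (der_Y VA); apply: (subB (PkC_sub _)).
  by apply: (PkC_m1 Evv Dv w0); apply: IH; apply: (sum_setl Ct_sub).
apply: (subZ _ (PkC_sub _)); apply: sum_setr; first exact: Pk_sub.
by apply: Ct_Cs; apply: Cs_low => //; apply: Pk_Od Pz.
Qed.

(** [Od_Dt] is applied again to the odd factor z of each v_(-1) z; since v_(-1) commutes with the
    derivation modulo [Cs], the derivatives this costs can be taken outside. *)
Lemma PkC_reach k y : Od y -> exists j, sum_set (Pk k) Ct (iter j der y).
Proof.
elim: k y => [|k IH] y Oy; first by exists 0%N; apply: (sum_setl Ct_sub).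
have [_ [j [p [c [Pp Cc E]]]]] := Od_Dt Oy.
have up x i n : sum_set (Pk k.+1) Ct (iter i der x) -> sum_set (Pk k.+1) Ct (iter (n + i) der x).
  by move=> H; rewrite iterD; elim: n => [//|n IHn]; rewrite iterS; exact: PkC_der.
suff [i Hi] : exists i, sum_set (Pk k.+1) Ct (iter i der p).
  exists (i + j)%N; rewrite iterD E (linD _ _ (iter_der_lin i)).
  apply: (subD (PkC_sub _)) => //; apply: sum_setr; first exact: Pk_sub.
  by elim: (i) => //= n; apply: Ct_der.
pose R : set V := [set x | exists i, sum_set (Pk k.+1) Ct (iter i der x)].
have RS : subspace R.
  split; first by exists 0%N; exact: (sub0 (PkC_sub _)).
  move=> a u v [i Hi] [i' Hi']; exists (i + i')%N; rewrite iter_der_lin.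
  apply: (subD (PkC_sub _)); last exact: up.
  by apply: (subZ _ (PkC_sub _)); rewrite addnC; apply: up.
apply: (span_min RS) Pp => _ [v [w [z [[Evv Dv] w0 Oz ->]]]].
have [i Hi] := IH z Oz; exists i.
apply: (sub_congr (PkC_sub _) (v := Y v (- 1) (iter i der z))).
  by apply: sum_setr; [exact: Pk_sub|apply: Ct_Cs; exact: der_m1].
exact: (PkC_m1 Evv Dv w0).
Qed.

(** Modulo [Cs], v_(-1) x_(-1) y is (v_(-1) x)_(-1) y, so k even factors of positive weight merge
    into one of weight at least k > P. This one is a combination of products a_(-2) b of equal
    parity: even pairs lead to [Cs], odd pairs to products of three odd vectors. *)
Lemma Pk_Ct k : (P < k)%N -> Pk k `<=` Ct.
Proof.
move=> Pk0; pose Q k : set V := lin_span [set z | exists x w y,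
  [/\ Ev x /\ D x = w%:R *: x, (k <= w)%N, Od y & z = Y x (- 1) y]].
have QC_sub i : subspace (sum_set (Q i) Ct) by apply: sum_set_sub; [exact: span_sub|exact: Ct_sub].
have H i : Pk i `<=` sum_set (Q i) Ct.
  elim: i => [|i IH].
    move=> y Oy; apply: (sum_setl Ct_sub); apply: span_incl; exists one, 0%N, y; split=> //.
      by split; [exact: z2_one Z2|rewrite (D_one G2) scale0r].
    by rewrite (va_vac VA).
  apply: span_min (QC_sub _) _ => _ [v [w [z [[Evv Dv] w0 /IH [q [c [Qq Cc ->]]] ->]]]].
  rewrite (linD _ _ (va_linr VA _ _)); apply: (subD (QC_sub _)); last first.
    by apply: sum_setr; [exact: span_sub|exact: Ct_m1].
  move: q Qq; apply: (span_lin (va_linr VA _ _) (QC_sub _)).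
  move=> _ [x [wx [y [[Ex Dx] hx Oy ->]]]].
  have -> : Y v (- 1) (Y x (- 1) y) = Y (Y v (- 1) x) (- 1) y -
     (Y (Y v (- 1) x) (- 1) y - Y v (- 1) (Y x (- 1) y)) by lmod C.
  apply: (subB (QC_sub _)).
    apply: (sum_setl Ct_sub); apply: span_incl; exists (Y v (- 1) x), (w + wx)%N, y.
    split=> //; last by lia.
    split; first exact: (z2_ee Z2).
    by rewrite (D_hom G2 _ Dv Dx) pmulrn; congr (_ %:~R *: _); lia.
  apply: sum_setr; first exact: span_sub.
  apply: Ct_Cs; have [N0 /(_ N0.+1 (leqnSn _)) ->] := iterate VA v x y (- 1) (- 1).
  rewrite big_ord_recl binz0 expr0 mulr1 scale1r /= subr0 addr0 scaleN1r opprK.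
  have cancel (a b d : V) : a + b + d - a = b + d by lmod C.
  rewrite cancel; apply: (subD Cs_sub).
    by apply: Cs_low => //; apply: (z2_eo Z2).
  apply: sub_sum => [|i' _]; first exact: Cs_sub.
  apply: (subZ _ Cs_sub); apply: (subB Cs_sub).
    by apply: Cs_low => //; apply: (z2_eo Z2).
  apply: (subZ _ Cs_sub); apply: Cs_low => //; first exact: (z2_eo Z2).
move=> y /H [q [c [Qq Cc ->]]].
apply: (subD Ct_sub) => //; move: q Qq; apply: span_min; first exact: Ct_sub.
move=> _ [x [w [z [[Ex Dx] hw Oz ->]]]].
have Pw : (P < w)%N by apply: leq_trans hw.
move: {Dx Ex}(C2_ev Pw Ex Dx); move: x; apply: (span_lin (va_linl VA _ _) Ct_sub).
move=> _ [] [a [wa [b [wb [[Ha _] [Hb _] _ ->]]]]].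
  by apply: (iterate_in VA Ct_sub) => i; apply: Ct_Cs; apply: Cs_low => //;
    try (by apply: (z2_eo Z2)); lia.
by apply: (iterate_in VA Ct_sub) => i; apply: Ct_triple.
Qed.

Lemma Od_Ct : Od `<=` Ct.
Proof.
move=> y Oy; have [j [p [c [Pp [Oc [i Ci]] E]]]] := PkC_reach P.+1 Oy.
have [Op [k Ck]] := Pk_Ct (ltnSn P) Pp.
split=> //; have : Ct (iter j der y).
  by rewrite E; apply: (subD Ct_sub); split=> //; [exists k|exists i].
by case=> _ [n Cn]; exists (n + j)%N; rewrite iterD.
Qed.

(** Above weight P, y is a combination of a_(-2) b with exactly one odd factor. If a is odd, skew
    symmetry gives the derivatives of order i of the b_(-2+i) a: the term i = 0 is in [Cs], the
    others are derivatives of odd vectors of weight one less than y. *)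
Lemma Od_split d y : Od y -> D y = (P + d)%:R *: y ->
  exists z, [/\ Od z, D z = P%:R *: z & Cs (y - iter d der z)].
Proof.
elim: d y => [|d IH] y Oy Dy.
  by exists y; split=> //; [rewrite Dy addn0|rewrite subrr; exact: (sub0 Cs_sub)].
pose S : set V := sum_set Cs [set der z | z in [set z | Od z /\ D z = (P + d)%:R *: z]].
have sW : subspace [set z | Od z /\ D z = (P + d)%:R *: z].
  exact: (setI_sub (z2_Od Z2) (eig_sub _ dD)).
have sD : subspace [set der z | z in [set z | Od z /\ D z = (P + d)%:R *: z]].
  split; first by exists 0; [exact: (sub0 sW)|rewrite (lin0 (der_lin VA))].
  move=> a _ _ [u Wu <-] [v Wv <-]; exists (a *: u + v); first exact: sW.2.
  exact: (der_lin VA).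
have sS : subspace S by apply: sum_set_sub => //; exact: Cs_sub.
have lt_P : (P < P + d.+1)%N by lia.
have [c [_ [Cc [y' [Oy' Dy'] <-] E]]] : S y.
  apply: (span_min sS) (C2_od lt_P Oy Dy).
  move=> _ [] [a [wa [b [wb [[Ha Da] [Hb Db] Ew ->]]]]].
    by apply: (sum_setl sD); apply: Cs_low.
  apply: (skew_in VA sS) => -[|i].
    rewrite addr0 subr0 (va_creat VA); apply: (sum_setl sD); exact: Cs_low.
  rewrite (Y_creat VA); apply: (subZ _ sS); apply: sum_setr; first exact: Cs_sub.
  rewrite iterS; exists (iter i der (Y b (- 2 + i.+1%:Z) a)) => //.
  split; first by apply: Od_iter; apply: (z2_eo Z2).
  have Dder x (w : int) : D x = w%:~R *: x -> D (der x) = (w + 1)%:~R *: der x.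
    move=> Dx; rewrite (cft_wt G2) Dx (D_one G2) (Y0r VA) addr0.
    rewrite (linZ _ _ (va_linl VA _ _)) -scalerBl -rmorphB; congr (_ %:~R *: _); lia.
  have Dit x (w : int) n : D x = w%:~R *: x -> D (iter n der x) = (w + n%:Z)%:~R *: iter n der x.
    move=> Dx; elim: n => [|n IHn] /=; first by rewrite addr0.
    by rewrite (Dder _ _ IHn); congr (_ %:~R *: _); lia.
  rewrite (Dit _ _ i (D_hom G2 _ Db Da)); congr (_ *: _).
  by rewrite [RHS]pmulrn; congr (_ %:~R); lia.
have [z [Oz Dz Cz]] := IH _ Oy' Dy'; exists z; split=> //.
rewrite E /= -addrA; apply: (subD Cs_sub) => //.
by rewrite -(linB _ _ (der_lin VA)); apply: Cs_der.
Qed.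

(** The weight P part of [Od] is finite-dimensional, so one power J of the derivation sends all of
    it into [Cs]; by [Od_split] every weight above P + J is then covered. *)
Theorem odd_C2_cofinite : exists P1, forall (w : nat) y, (P1 < w)%N -> Od y ->
  D y = w%:R *: y -> Cs y.
Proof.
have [s [sO Hs]] := cft_fin G2 P%:Z.
have [J HJ] : exists J, forall x, x \in s -> Cs (iter J der x).
  have : forall x, x \in s -> Ct x by move=> x /sO[Ox _]; apply: Od_Ct.
  elim: (s) => [|x s' IH] Hx; first by exists 0%N.
  have [|J HJ] := IH; first by move=> z zs; apply: Hx; rewrite inE zs orbT.
  have [_ [j Cj]] : Ct x by apply: Hx; rewrite inE eqxx.
  have up z i n : Cs (iter i der z) -> Cs (iter (n + i) der z).
    by move=> H; rewrite iterD; elim: n => //= n; apply: Cs_der.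
  exists (J + j)%N => z; rewrite inE => /orP[/eqP ->|zs]; first exact: up.
  by rewrite addnC; apply: up; apply: HJ.
exists (P + J)%N => w y hw Oy Dy.
have Ew : w = (P + (w - P))%N by lia.
rewrite Ew in Dy; have [z [Oz Dz Cz]] := Od_split Oy Dy.
apply: (sub_congr Cs_sub Cz).
have Jz : Cs (iter J der z).
  have := Hs _ (conj Oz Dz); apply: (span_lin (iter_der_lin J) Cs_sub) => x /=; exact: HJ.
rewrite -(subnK (_ : (J <= w - P)%N)); last by lia.
by rewrite iterD; elim: (_ - _)%N => //= n; apply: Cs_der.
Qed.

End OddPart.

(** * Cofiniteness of the even part *)

Lemma nat_roots_bounded (C : numFieldType) (p : {poly C}) : p != 0 ->
  exists N : nat, forall n : nat, (N <= n)%N -> ~~ root p n%:R.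
Proof.
move: {2}(size p) (leqnn (size p)) => s; elim: s p => [|s IH] p.
  by rewrite leqn0 size_poly_eq0 => ->.
move=> sp p0; have [[n rn]|H] := pselect (exists n : nat, root p n%:R); last first.
  by exists 0%N => n _; apply/negP => rn; apply: H; exists n.
have [q Eq] := factor_theorem _ _ rn.
have q0 : q != 0 by apply: contraNneq p0 => q0; rewrite Eq q0 mul0r.
have [|N HN] := IH q _ q0.
  by move: sp; rewrite Eq size_Mmonic ?monicXsubC // size_XsubC addn2.
exists (N + n.+1)%N => m hm; rewrite Eq rootM root_XsubC negb_or HN ?eqr_nat; lia.
Qed.

Section EvenPart.
Context (C : numFieldType) (V : lmodType C) (Y : V -> int -> V -> V) (one : V).
Context (Ev Od : set V) (D : V -> V) (omega : V).
Hypothesis G2 : cft_z2_graded Y one Ev Od D omega.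
Let Z2 := cft_z2 G2.
Let VA := z2_va Z2.
Let dD := cft_lin G2.
Variable P : nat.
Hypothesis C2 : forall (w : nat) a, (P < w)%N -> hom Ev Od D a w ->
  lin_span [set x | exists u v, [/\ Ev u \/ Od u, Ev v \/ Od v & x = Y u (- 2) v]] a.
Local Notation der := (der Y one).
Implicit Types (u v x y z : V).

Definition Zs : set V := lin_span [set x | exists u v, [/\ Ev u, Ev v & x = Y u (- 2) v]].

Lemma Zs_sub : subspace Zs. Proof. exact: span_sub. Qed.

Lemma Zs_low u v (n : int) : Ev u -> Ev v -> n <= - 2 -> Zs (Y u n v).
Proof.
move=> Eu Evv n2; rewrite (_ : n = - 1 - (absz (- 1 - n)%R)%:Z); last by lia.
have : (0 < absz (- 1 - n)%R)%N by lia.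
case: (absz _) => // j _; have [c ->] := Y_low VA u j.+1 v.
apply: (subZ _ Zs_sub); rewrite iterS (Y_der VA) opprK scale1r.
by apply: span_incl; exists (iter j der u), v; split=> //; apply: (Ev_iter G2).
Qed.

Lemma Ev_hom u : Ev u -> lin_span [set v | exists w : nat, Ev v /\ D v = w%:R *: v] u.
Proof.
move=> /(cft_Ev G2); apply: span_min; first exact: span_sub.
move=> v [Evv [n Dn]]; have [->|[Dv _]] := hom_int G2 (or_introl Evv) Dn.
  exact: (sub0 (span_sub _)).
by apply: span_incl; exists `|n|%N.
Qed.

Lemma Od_hom u : Od u -> lin_span [set v | exists w : nat, Od v /\ D v = w%:R *: v] u.
Proof.
move=> /(cft_Od G2); apply: span_min; first exact: span_sub.
move=> v [Ov [n Dn]]; have [->|[Dv _]] := hom_int G2 (or_intror Ov) Dn.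
  exact: (sub0 (span_sub _)).
by apply: span_incl; exists `|n|%N.
Qed.

Lemma Cs_pairs (w : nat) y : Cs Y Ev Od y -> D y = w%:R *: y -> lin_span (C2_pairs Y D Ev Od w) y.
Proof.
move=> Cy Dy; pose X : set V := [set z | exists x x', [/\ (exists k : nat, Ev x /\ D x = k%:R *: x),
  (exists k : nat, Od x' /\ D x' = k%:R *: x') & z = Y x (- 2) x']].
have Xy : lin_span X y.
  move: Cy; apply: span_min; first exact: span_sub.
  move=> _ [v [z [/Ev_hom Hv /Od_hom Hz ->]]]; have := bilinear_span G2 (n := - 2) Hv Hz.
  by apply: span_mono => _ [u [u' [Hu Hu' ->]]]; exists u, u'.
have {}Xy : lin_span (X `&` eig D w%:R) y.
  apply: (eig_span dD); last by split.
  move=> _ [x [x' [[k [_ Dk]] [k' [_ Dk']] ->]]].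
  by eexists; apply: (D_hom G2 (- 2) Dk Dk').
move: Xy; apply: span_min; first exact: span_sub.
move=> z [[x [x' [[k [Ex Dk]] [k' [Ox' Dk']] ->]]]] Ew.
have [->|nz] := eqVneq (Y x (- 2) x') 0; first exact: (sub0 (span_sub _)).
apply: span_incl; exists x, k, x', k'; split=> //.
have := D_hom G2 (- 2) Dk Dk'; rewrite (Ew : D _ = _) => /eqP.
rewrite -subr_eq0 -scalerBl scaler_eq0 (negPf nz) orbF subr_eq0 => /eqP.
rewrite (_ : k%:Z + k'%:Z - - 2 - 1 = (k + k').+1%:Z); last by lia.
by rewrite -pmulrn => /eqP; rewrite eqr_nat => /eqP.
Qed.

Variable P1 : nat.
Hypothesis Od_Cs : forall (w : nat) y, (P1 < w)%N -> Od y -> D y = w%:R *: y -> Cs Y Ev Od y.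

Section Reduction.
Variable ts : seq (V * nat).
Hypothesis ts_Od : forall t, t \in ts -> Od t.1 /\ D t.1 = t.2%:R *: t.1.
Hypothesis ts_span : forall (p : nat) a, (p <= P1)%N -> Od a -> D a = p%:R *: a ->
  lin_span [set x | (x, p) \in ts] a.
Let K := [seq (t, t') | t <- ts, t' <- ts].

(** The mode is the one for which the product of the two vectors has weight N. *)
Definition comp (k : (V * nat) * (V * nat)) (N : int) : V :=
  Y k.1.1 (k.1.2%:Z + k.2.2%:Z - 1 - N) k.2.1.

(** One choice of the coefficients c serves for all N: this uniformity is what makes the matrix B of
    the final linear system constant. *)
Definition reducible (F : int -> V) := exists c : 'I_(size K) -> C, forall N : int,
  Zs (F N - \sum_i c i *: comp (tnth (in_tuple K) i) N).

Lemma reducible_lin a F F' : reducible F -> reducible F' ->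
  reducible (fun N => a *: F N + F' N).
Proof.
move=> [c Hc] [c' Hc']; exists (fun i => a * c i + c' i) => N.
have := Zs_sub.2 a _ _ (Hc N) (Hc' N); congr Zs.
set X := fun i => comp (tnth (in_tuple K) i) N.
have -> : \sum_i (a * c i + c' i) *: X i = a *: (\sum_i c i *: X i) + \sum_i c' i *: X i.
  rewrite scaler_sumr -big_split; apply: eq_bigr => i _.
  by rewrite scalerDl scalerA.
by rewrite opprD scalerBr addrACA.
Qed.

Lemma reducible_congr F F' : (forall N, Zs (F N - F' N)) -> reducible F' -> reducible F.
Proof.
move=> H [c Hc]; exists c => N; apply: (sub_congr Zs_sub _ (Hc N)).
by have := H N; congr Zs; lmod C.
Qed.

Lemma reducible0 : reducible (fun=> 0).
Proof.
exists (fun=> 0) => N; rewrite sub0r big1 ?oppr0 => [|i _]; last by rewrite scale0r.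
exact: (sub0 Zs_sub).
Qed.

Lemma reducible_ext F F' : F =1 F' -> reducible F' -> reducible F.
Proof. by move=> E; apply: reducible_congr => N; rewrite E subrr; apply: (sub0 Zs_sub). Qed.

Lemma reducible_sum n (b : nat -> C) (F : nat -> int -> V) : (forall i, reducible (F i)) ->
  reducible (fun N => \sum_(i < n) b i *: F i N).
Proof.
move=> H; elim: n => [|n IH].
  by apply: reducible_ext reducible0 => N; rewrite big_ord0.
apply: reducible_ext (reducible_lin (b n) (H n) IH) => N.
by rewrite big_ord_recr addrC.
Qed.

Lemma reducible_comp k : k \in K -> reducible (comp k).
Proof.
move=> kK; have lt_k : (index k K < size K)%N by rewrite index_mem.
exists (fun i => (i == Ordinal lt_k)%:R) => N.
rewrite (bigD1 (Ordinal lt_k)) //= eqxx scale1r big1 ?addr0 => [|i /negPf ->]; last first.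
  by rewrite scale0r.
by rewrite (tnth_nth k) /= nth_index // subrr; apply: (sub0 Zs_sub).
Qed.

Lemma reducible_spanl (X : set V) a b m : lin_span X a ->
  (forall x, X x -> reducible (fun N => Y x (m - N) b)) -> reducible (fun N => Y a (m - N) b).
Proof.
move=> Xa H; move: a Xa; apply: span_min => [|x /H //]; split.
  by apply: reducible_ext reducible0 => N; rewrite (Y0l VA).
move=> c u v Hu Hv; apply: reducible_ext (reducible_lin c Hu Hv) => N.
exact: (va_linl VA).
Qed.

Lemma reducible_spanr (X : set V) a b m : lin_span X b ->
  (forall x, X x -> reducible (fun N => Y a (m - N) x)) -> reducible (fun N => Y a (m - N) b).
Proof.
move=> Xb H; move: b Xb; apply: span_min => [|x /H //]; split.
  by apply: reducible_ext reducible0 => N; rewrite (Y0r VA).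
move=> c u v Hu Hv; apply: reducible_ext (reducible_lin c Hu Hv) => N.
exact: (va_linr VA).
Qed.

(** A factor of weight above P1 is a combination of v_(-2) a' with v even. Moving v to the left
    yields elements of [Zs]; the remaining terms are products with v_i b, or (v_i a) b', of smaller
    total weight. The number of them and their coefficients do not involve N, as v_i b vanishes for
    i large by weight. *)
Lemma mode_reducible (s p q : nat) a b : (p + q < s)%N ->
  Od a -> D a = p%:R *: a -> Od b -> D b = q%:R *: b ->
  reducible (fun N => Y a (p%:Z + q%:Z - 1 - N) b).
Proof.
elim: s p q a b => // s IH p q a b; rewrite ltnS => hs Oa Da Ob Db.
have [hp|hp] := leqP p P1; last first.
  have Xa := Cs_pairs (Od_Cs hp Oa Da) Da.
  apply: (reducible_spanl Xa) => _ [v [wv [a' [wa [[Evv Dv] [Oa' Da'] Ep ->]]]]].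
  pose F i N := Y a' (p%:Z + q%:Z - 1 - N - 2 - i%:Z) (Y v i%:Z b).
  have F_red i : reducible (F i).
    have [E|[w Ew [Dw _]]] := homY G2 i%:Z (conj Dv (or_introl Evv)) (conj Db (or_intror Ob)).
      by apply: reducible_ext reducible0 => N; rewrite /F E (Y0r VA).
    apply: reducible_ext (IH wa w a' (Y v i%:Z b) _ Oa' Da' _ Dw) => //.
    - by move=> N; rewrite /F; congr Y; lia.
    - by lia.
    - exact: (z2_eo Z2).
  have F0 i N : (wv + q <= i)%N -> F i N = 0.
    move=> hi; rewrite /F.
    have [->|[w Ew _]] := homY G2 i%:Z (conj Dv (or_introl Evv)) (conj Db (or_intror Ob)).
      exact: (Y0r VA).
    by lia.
  apply: reducible_congr (reducible_sum (wv + q) (fun i => - ((-1) ^+ i * binz C (- 2) i)) F_red).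
  move=> N; have [N0 H] := iterate VA v a' b (- 2) (p%:Z + q%:Z - 1 - N).
  rewrite (H _ (leq_addr (wv + q) N0)).
  rewrite -(sum_stable (F := fun i : nat => - ((-1) ^+ i * binz C (-2) i) *: F i N)
    (leq_addl N0 (wv + q)%N)); last by move=> i hi; rewrite F0 // scaler0.
  rewrite -sumrB; apply: sub_sum => [|i _]; first exact: Zs_sub.
  rewrite [X in Zs X](_ : _ = ((-1) ^+ i * binz C (- 2) i) *:
     Y v (- 2 - i%:Z) (Y a' (p%:Z + q%:Z - 1 - N + i%:Z) b)); last first.
    rewrite /F; set z := Y a' _ (Y v _ _).
    have e1 : (-1) ^+ absz (- 2)%R = 1 :> C by rewrite expr2 mulrNN mulr1.
    by rewrite e1; move: (_ * binz C _ _) => be; rewrite scale1r scaleNr opprK scalerBr subrK.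
  by apply: (subZ _ Zs_sub); apply: Zs_low => //; [exact: (z2_oo Z2)|lia].
have [hq|hq] := leqP q P1; last first.
  have Xb := Cs_pairs (Od_Cs hq Ob Db) Db.
  apply: (reducible_spanr Xb) => _ [v [wv [b' [wb [[Evv Dv] [Ob' Db'] Eq ->]]]]].
  pose F i N := Y (Y v i%:Z a) (- 2 + (p%:Z + q%:Z - 1 - N) - i%:Z) b'.
  have F_red i : reducible (F i).
    have [E|[w Ew [Dw _]]] := homY G2 i%:Z (conj Dv (or_introl Evv)) (conj Da (or_intror Oa)).
      by apply: reducible_ext reducible0 => N; rewrite /F E (Y0l VA).
    apply: reducible_ext (IH w wb (Y v i%:Z a) b' _ _ Dw Ob' Db') => //.
    - by move=> N; rewrite /F; congr Y; lia.
    - by lia.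
    - exact: (z2_eo Z2).
  have F0 i N : (wv + p <= i)%N -> F i N = 0.
    move=> hi; rewrite /F.
    have [->|[w Ew _]] := homY G2 i%:Z (conj Dv (or_introl Evv)) (conj Da (or_intror Oa)).
      exact: (Y0l VA).
    by lia.
  apply: reducible_congr (reducible_sum (wv + p) (fun i => - binz C (- 2) i) F_red).
  move=> N; have [N0 H] := commutator VA v a b' (- 2) (p%:Z + q%:Z - 1 - N).
  have := H _ (leq_addr (wv + p)%N N0).
  rewrite (sum_stable (F := fun i : nat => binz C (-2) i *: F i N)
    (leq_addl N0 (wv + p)%N)); last by move=> i hi; rewrite F0 // scaler0.
  have -> : \sum_(i < wv + p) - binz C (- 2) i *: F i N =
      - \sum_(i < wv + p) binz C (- 2) i *: F i N.
    by rewrite -sumrN; apply: eq_bigr => i _; rewrite scaleNr.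
  rewrite opprK => <-; rewrite addrC subrK.
  by apply: Zs_low => //; exact: (z2_oo Z2).
apply: (reducible_spanl (ts_span hp Oa Da)) => x xts.
apply: (reducible_spanr (ts_span hq Ob Db)) => y yts.
apply: (reducible_comp (k := ((x, p), (y, q)))).
by apply/allpairsP; exists ((x, p), (y, q)).
Qed.

(** Integration by parts: the mode of weight N of the derivative of a with b is (N - p - q) times
    that of a with b, and it is itself reducible. *)
Lemma comp_der k : k \in K -> exists c : 'I_(size K) -> C, forall N : int,
  Zs ((N - (k.1.2%:Z + k.2.2%:Z))%:~R *: comp k N - \sum_i c i *: comp (tnth (in_tuple K) i) N).
Proof.
move=> /allpairsP[[t t'] /= [tts t'ts ->]] /=.
have [Ot Dt] := ts_Od tts; have [Ot' Dt'] := ts_Od t'ts.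
have Dd : D (der t.1) = t.2.+1%:R *: der t.1.
  rewrite (cft_wt G2) Dt (D_one G2) (Y0r VA) addr0 (linZ _ _ (va_linl VA _ _)).
  by rewrite -scalerBl -natr1 rmorphD rmorphN /= opprD opprK; congr (_ *: _); ring.
have [c Hc] := mode_reducible (ltnSn _) (Od_der G2 Ot) Dd Ot' Dt'.
exists c => N; have := Hc N; rewrite (Y_der VA) /comp /=; congr (Zs (_ - _)).
congr (_ *: Y _ _ _); last by lia.
by rewrite -rmorphN; congr (_ %:~R); lia.
Qed.

Lemma comp_in : exists N1 : nat, forall (N : nat) k, (N1 <= N)%N -> k \in K -> Zs (comp k N%:Z).
Proof.
pose n := size K; pose X i (N : int) := comp (tnth (in_tuple K) i) N.
have [c Hc] := choice (fun i => comp_der (mem_tnth i (in_tuple K))).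
pose e i : C := ((tnth (in_tuple K) i).1.2%:Z + (tnth (in_tuple K) i).2.2%:Z)%:~R.
(* The relation (N - e_i) X_i = sum of the c_ij X_j modulo [Zs] becomes (B - N) X = 0, so N only has
   to avoid the roots of the characteristic polynomial. *)
pose B : 'M[C]_n := \matrix_(i, j) (c i j + e i *+ (i == j)).
have HB i (N : nat) : Zs (\sum_j (B - N%:R%:M) i j *: X j N%:Z).
  have -> : \sum_j (B - N%:R%:M) i j *: X j N%:Z =
      \sum_j c i j *: X j N%:Z + (e i - N%:R) *: X i N%:Z.
    rewrite [X in _ = _ + X](_ : _ = \sum_j ((e i - N%:R) *+ (i == j)) *: X j N%:Z).
      by rewrite -big_split; apply: eq_bigr => j _; rewrite !mxE mulrnBl -addrA scalerDl.
    rewrite (bigD1 i) //= eqxx mulr1n big1 ?addr0 // => j /negPf ji.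
    by rewrite eq_sym ji mulr0n scale0r.
  have := subN Zs_sub (Hc i N%:Z); congr Zs; rewrite opprB; congr (_ + _).
  by rewrite -scaleNr rmorphB /= -pmulrn opprB.
have [N1 HN1] := nat_roots_bounded (monic_neq0 (char_poly_monic B)).
exists N1 => N k leN kK.
have uA : B - N%:R%:M \in unitmx.
  have := HN1 N leN; rewrite -eigenvalue_root_char /eigenvalue /eigenspace negbK.
  by rewrite kermx_eq0 row_free_unit.
have lt_k : (index k K < n)%N by rewrite index_mem.
suff : Zs (X (Ordinal lt_k) N%:Z) by rewrite /X (tnth_nth k) /= nth_index.
set A := B - _ in HB uA *; set i := Ordinal lt_k.
have -> : X i N%:Z = \sum_l (invmx A) i l *: \sum_j A l j *: X j N%:Z.
  under eq_bigr => l _ do rewrite scaler_sumr.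
  rewrite exchange_big /= (bigD1 i) //= [X in _ + X]big1 => [|j ji].
    rewrite addr0 (eq_bigr (fun l => (invmx A i l * A l i) *: X i N%:Z)); last first.
      by move=> l _; rewrite scalerA.
    by rewrite -scaler_suml; have := mulVmx uA => /matrixP /(_ i i); rewrite !mxE eqxx => ->; rewrite scale1r.
  rewrite (eq_bigr (fun l => (invmx A i l * A l j) *: X j N%:Z)); last first.
    by move=> l _; rewrite scalerA.
  rewrite -scaler_suml; have := mulVmx uA => /matrixP /(_ i j); rewrite !mxE eq_sym (negPf ji) => ->.
  by rewrite scale0r.
by apply: sub_sum => [|l _]; [exact: Zs_sub|apply: (subZ _ Zs_sub); apply: HB].
Qed.

End Reduction.

Theorem even_C2_cofinite : exists P2, forall (w : nat) x, (P2 < w)%N -> Ev x ->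
  D x = w%:R *: x -> Zs x.
Proof.
have [ts [tsO ts_span]] : exists ts : seq (V * nat),
   (forall t, t \in ts -> Od t.1 /\ D t.1 = t.2%:R *: t.1) /\
   (forall (p : nat) a, (p <= P1)%N -> Od a -> D a = p%:R *: a -> lin_span [set x | (x, p) \in ts] a).
  have H n : exists ts : seq (V * nat),
     (forall t, t \in ts -> Od t.1 /\ D t.1 = t.2%:R *: t.1) /\
     (forall (p : nat) a, (p < n)%N -> Od a -> D a = p%:R *: a -> lin_span [set x | (x, p) \in ts] a).
    elim: n => [|n [ts [H1 H2]]]; first by exists [::].
    have [s [sO Hs]] := cft_fin G2 n%:Z.
    exists ([seq (x, n) | x <- s] ++ ts); split=> [t|p a].
      by rewrite mem_cat => /orP[/mapP[x /sO[Ox Dx] ->]|/H1].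
    rewrite ltnS leq_eqVlt => /orP[/eqP -> Oa Da|hp Oa Da]; last first.
      by apply: span_mono (H2 _ _ hp Oa Da) => x /= xts; rewrite mem_cat xts orbT.
    apply: span_mono (Hs _ (conj Oa Da)) => x /= xs.
    by rewrite mem_cat; apply/orP; left; apply/mapP; exists x.
  by have [ts [H1 H2]] := H P1.+1; exists ts; split=> // p a hp; apply: H2; rewrite ltnS.
have [N1 HN1] := comp_in tsO ts_span.
exists (P + N1)%N => w x hw Ex Dx.
have hP : (P < w)%N by lia.
have := C2_ev G2 C2 hP Ex Dx; apply: span_min; first exact: Zs_sub.
move=> _ [] [a [wa [b [wb [[Ha Da] [Hb Db] Ew ->]]]]]; first exact: Zs_low.
have [c Hc] := mode_reducible ts_span (ltnSn _) Ha Da Hb Db.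
(* The product a_(-2) b has weight wa + wb + 1 = w, so it is the component N = w. *)
have := Hc w%:Z; rewrite (_ : wa%:Z + wb%:Z - 1 - w%:Z = - 2); last by lia.
move/(sub_congr Zs_sub); apply; apply: sub_sum => [|i _]; first exact: Zs_sub.
by apply: (subZ _ Zs_sub); apply: HN1; [lia|exact: mem_tnth].
Qed.

End EvenPart.

Theorem orbifold_C2 (C : numFieldType) (V : lmodType C) (Y : V -> int -> V -> V) (one : V)
    (Ev Od : set V) (D : V -> V) (omega : V) (P : nat) :
  cft_z2_graded Y one Ev Od D omega ->
  (forall (w : nat) a, (P < w)%N -> hom Ev Od D a w ->
    lin_span [set x | exists u v, [/\ Ev u \/ Od u, Ev v \/ Od v & x = Y u (- 2) v]] a) ->
  exists P', forall (w : nat) x, (P' < w)%N -> Ev x -> D x = w%:R *: x ->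
    lin_span [set x | exists u v, [/\ Ev u, Ev v & x = Y u (- 2) v]] x.
Proof.
move=> G2 C2; have [P1 H1] := odd_C2_cofinite G2 C2.
exact: (even_C2_cofinite G2 C2 H1).
Qed.

(** * The Virasoro algebra of central charge 1/2 *)

Section Virasoro.
Context (C : numFieldType) (V : lmodType C) (Y : V -> int -> V -> V) (one w : V).
Hypothesis VA : vertex_algebra Y one.
Local Notation der := (der Y one).
Hypothesis ww0 : Y w 0 w = der w.
Hypothesis ww1 : Y w 1 w = 2%:R *: w.
Hypothesis ww2 : Y w 2 w = 0.
Hypothesis ww3 : Y w 3 w = 4%:R^-1 *: one.
Hypothesis wwn : forall n : nat, (3 < n)%N -> Y w n%:Z w = 0.

Definition Lw (n : int) : V -> V := Y w (n + 1).

Lemma Lw_lin n : lin (Lw n). Proof. exact: (va_linr VA). Qed.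

Lemma Lw_mode n : Y w n = Lw (n - 1). Proof. by rewrite /Lw subrK. Qed.

(** The central term is binom(m + 1, 3) times w_3 w = 1/4, that is c / 12 times m^3 - m at c =
    1/2. *)
Lemma Lw_comm (m n : int) v : Lw m (Lw n v) = Lw n (Lw m v) + (m - n)%:~R *: Lw (m + n) v +
  (if m + n == 0 then (m * (m * m - 1))%:~R / 24%:R else 0) *: v.
Proof.
apply/eqP; rewrite -addrA addrC -subr_eq; apply/eqP; rewrite /Lw.
have [N0 /(_ (N0 + 4)%N (leq_addr _ _)) ->] := commutator VA w w v (m + 1) (n + 1).
rewrite (sum_stable (F := fun i : nat => binz C (m + 1) i *: Y (Y w i%:Z w) (m + 1 + (n + 1) - i%:Z) v)
  (leq_addl N0 4)) => [|i hi]; last by rewrite wwn // (Y0l VA) scaler0.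
rewrite !big_ord_recr big_ord0 /= ww0 ww1 ww2 ww3 (Y0l VA) (Y_der VA).
rewrite !(linZ _ _ (va_linl VA _ _)) (va_vac VA).
have -> : m + 1 + (n + 1) - 0 - 1 = m + n + 1 by lia.
have -> : m + 1 + (n + 1) - 1 = m + n + 1 by lia.
have -> : (m + 1 + (n + 1) - 3 == - 1) = (m + n == 0) by lia.
rewrite !binzS !binz0 !rmorphB !rmorphM /= !rmorphB !rmorphM !rmorphD /=.
case: (m + n == 0); rewrite ?scaler0 ?scale0r; set X := Y w _ v; set a := m%:~R; set b := n%:~R.
  by lmod_with C ltac:(field).
by lmod_with C ltac:(field).
Qed.

Lemma Lw_one (n : int) : - 1 <= n -> Lw n one = 0.
Proof. by move=> n1; rewrite /Lw (va_annih VA) //; lia. Qed.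

Lemma w_Lw : w = Lw (- 2) one.
Proof. by rewrite /Lw (va_creat VA). Qed.

(* The singular vector of weight 6 of the vacuum module at central charge 1/2. *)
Definition sing : V :=
  64%:R *: Y w (- 1) (Y w (- 1) w) + 93%:R *: Y w (- 2) (Y w (- 2) one)
  - 264%:R *: Y w (- 3) w - 108%:R *: Y w (- 5) one.

Lemma Lw_comm0 (m n k : int) (c : C) v : m + n = k -> k != 0 -> (m - n)%:~R = c ->
  Lw m (Lw n v) = Lw n (Lw m v) + c *: Lw k v.
Proof. by move=> <- k0 <-; rewrite Lw_comm (negPf k0) scale0r addr0. Qed.

Lemma sing_Lw : sing = 64%:R *: Lw (- 2) (Lw (- 2) (Lw (- 2) one)) +
  93%:R *: Lw (- 3) (Lw (- 3) one) - 264%:R *: Lw (- 4) (Lw (- 2) one)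
  - 108%:R *: Lw (- 6) one.
Proof. by rewrite -[Lw (- 2) one]w_Lw. Qed.

Lemma sing1 : Lw 1 sing = 0.
Proof.
have c12 v : Lw 1 (Lw (- 2) v) = Lw (- 2) (Lw 1 v) + 3%:R *: Lw (- 1) v by exact: Lw_comm0.
have c13 v : Lw 1 (Lw (- 3) v) = Lw (- 3) (Lw 1 v) + 4%:R *: Lw (- 2) v by exact: Lw_comm0.
have c14 v : Lw 1 (Lw (- 4) v) = Lw (- 4) (Lw 1 v) + 5%:R *: Lw (- 3) v by exact: Lw_comm0.
have c16 v : Lw 1 (Lw (- 6) v) = Lw (- 6) (Lw 1 v) + 7%:R *: Lw (- 5) v by exact: Lw_comm0.
have d2 v : Lw (- 1) (Lw (- 2) v) = Lw (- 2) (Lw (- 1) v) + 1 *: Lw (- 3) v by exact: Lw_comm0.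
have d3 v : Lw (- 2) (Lw (- 3) v) = Lw (- 3) (Lw (- 2) v) + 1 *: Lw (- 5) v by exact: Lw_comm0.
have L0 n : Lw n 0 = 0 by exact: (Y0r VA).
have LD n u v : Lw n (u + v) = Lw n u + Lw n v by exact: (linD _ _ (Lw_lin n)).
have LZ n c v : Lw n (c *: v) = c *: Lw n v by exact: (linZ _ _ (Lw_lin n)).
have LN n v : Lw n (- v) = - Lw n v by exact: (linN _ (Lw_lin n)).
have O1 : Lw 1 one = 0 by exact: Lw_one.
have O0 : Lw (- 1) one = 0 by exact: Lw_one.
rewrite sing_Lw.
rewrite !(LD, LZ, LN, c12, c13, c14, c16, d2, d3, O1, O0, L0, scaler0, add0r, addr0).
by lmod C.
Qed.

Lemma sing2 : Lw 2 sing = 0.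
Proof.
have c22 v : Lw 2 (Lw (- 2) v) = Lw (- 2) (Lw 2 v) + 4%:R *: Lw 0 v + 4%:R^-1 *: v.
  rewrite Lw_comm eqxx (_ : (2 - - 2)%:~R = 4%:R :> C) // subrr.
  rewrite (_ : (2 * (2 * 2 - 1))%:~R = 6%:R :> C) //.
  by rewrite (_ : 6%:R / 24%:R = 4%:R^-1 :> C) //; field.
have c23 v : Lw 2 (Lw (- 3) v) = Lw (- 3) (Lw 2 v) + 5%:R *: Lw (- 1) v by exact: Lw_comm0.
have c24 v : Lw 2 (Lw (- 4) v) = Lw (- 4) (Lw 2 v) + 6%:R *: Lw (- 2) v by exact: Lw_comm0.
have c26 v : Lw 2 (Lw (- 6) v) = Lw (- 6) (Lw 2 v) + 8%:R *: Lw (- 4) v by exact: Lw_comm0.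
have d3 v : Lw (- 1) (Lw (- 3) v) = Lw (- 3) (Lw (- 1) v) + 2%:R *: Lw (- 4) v by exact: Lw_comm0.
have e2 v : Lw 0 (Lw (- 2) v) = Lw (- 2) (Lw 0 v) + 2%:R *: Lw (- 2) v by exact: Lw_comm0.
have L0 n : Lw n 0 = 0 by exact: (Y0r VA).
have LD n u v : Lw n (u + v) = Lw n u + Lw n v by exact: (linD _ _ (Lw_lin n)).
have LZ n c v : Lw n (c *: v) = c *: Lw n v by exact: (linZ _ _ (Lw_lin n)).
have LN n v : Lw n (- v) = - Lw n v by exact: (linN _ (Lw_lin n)).
have O2 : Lw 2 one = 0 by exact: Lw_one.
have O1 : Lw (- 1) one = 0 by exact: Lw_one.
have O0 : Lw 0 one = 0 by exact: Lw_one.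
rewrite sing_Lw.
rewrite !(LD, LZ, LN, c22, c23, c24, c26, d3, e2, O2, O1, O0, L0, scaler0, add0r, addr0).
by lmod_with C ltac:(field).
Qed.

(** The commutators of L(1) with L(n), n >= 2, produce all the L(n) with n > 2. *)
Lemma Lw_pos x : Lw 1 x = 0 -> Lw 2 x = 0 -> forall n, 0 < n -> Lw n x = 0.
Proof.
move=> x1 x2 n n0; rewrite (_ : n = (absz n).-1.+1%:Z); last by lia.
elim/ltn_ind: (absz n).-1 => -[_|[_|k IH]] //.
have h : (k.+2%:Z - 1)%:~R != 0 :> C.
  by rewrite (_ : k.+2%:Z - 1 = k.+1%:Z) ?pnatr_eq0 //; lia.
have := Lw_comm0 (m := k.+2%:Z) (n := 1) (k := k.+3%:Z) x _ _ erefl.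
have L0 m : Lw m 0 = 0 by exact: (Y0r VA).
rewrite (IH k.+1) // (IH 0%N) // !L0 add0r => H; apply/eqP.
have /esym/eqP := H ltac:(lia) isT; by rewrite scaler_eq0 (negPf h).
Qed.

Lemma singn n : 0 < n -> Lw n sing = 0.
Proof. exact: (Lw_pos sing1 sing2). Qed.

(** The span of the L(-n_1) ... L(-n_k) x; when x is a highest weight vector it is stable under all
    the L(n). *)
Inductive descend (x : V) : V -> Prop :=
| Descend0 : descend x 0
| DescendBase : descend x x
| DescendLin a u v : descend x u -> descend x v -> descend x (a *: u + v)
| DescendL (n : nat) u : descend x u -> descend x (Lw (- n.+1%:Z) u).

Lemma descend_sub x : subspace (descend x).
Proof. by split; [exact: Descend0|move=> a u v; exact: DescendLin]. Qed.

Lemma descend_L x c : (forall n, 0 < n -> Lw n x = 0) -> Lw 0 x = c *: x ->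
  forall u, descend x u -> forall n, descend x (Lw n u).
Proof.
move=> xn x0; have sx := descend_sub x.
have dL (n : int) u : n < 0 -> descend x u -> descend x (Lw n u).
  by move=> n0 Hu; rewrite (_ : n = - (absz n).-1.+1%:Z); [exact: DescendL|lia].
move=> u; elim=> [n||a {}u v _ IHu _ IHv n|m {}u Hu IHu n].
- by rewrite /Lw (Y0r VA); exact: Descend0.
- move=> n; have [n0|n0|->] := ltrgtP n 0.
  + by apply: dL => //; exact: DescendBase.
  + by rewrite xn //; exact: Descend0.
  + by rewrite x0; apply: (subZ _ sx); exact: DescendBase.
- by rewrite (Lw_lin n); apply: DescendLin.
rewrite Lw_comm; apply: (subD sx); last by apply: (subZ _ sx).
by apply: (subD sx); [apply: DescendL|apply: (subZ _ sx)].
Qed.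

Lemma descend_eig x c : Lw 0 x = c *: x ->
  forall u, descend x u -> lin_span [set v | exists k : nat, Lw 0 v = (c + k%:R) *: v] u.
Proof.
move=> x0 u; have sS := span_sub [set v | exists k : nat, Lw 0 v = (c + k%:R) *: v].
elim=> [||a {}u v _ Hu _ Hv|n {}u _].
- exact: (sub0 sS).
- by apply: span_incl; exists 0%N; rewrite addr0.
- exact: sS.2.
apply: (span_lin (Lw_lin _) sS) => v [k Ev]; apply: span_incl; exists (k + n.+1)%N.
rewrite (Lw_comm0 (k := - n.+1%:Z) (c := n.+1%:R)) ?add0r ?opprK // Ev.
by rewrite (linZ _ _ (Lw_lin _)) natrD; lmod C.
Qed.

Variable U : set V.
Hypothesis sU : subspace U.
Hypothesis U_one : U one.
Hypothesis U_w : U w.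
Hypothesis U_closed : forall u v n, U u -> U v -> U (Y u n v).
Hypothesis U_gen : forall S : set V, subspace S -> S one -> S w ->
  (forall u v n, S u -> S v -> S (Y u n v)) -> U `<=` S.
Hypothesis U_simple : forall S : set V, subspace S -> S `<=` U ->
  (forall u v n, U u -> S v -> S (Y u n v) /\ S (Y v n u)) ->
  S `<=` [set 0] \/ U `<=` S.

(** Both operators are derivations of all products, so they agree on the subalgebra generated by w
    once they agree on w. On V itself L(-1) is not the derivation in general. *)
Lemma der_U u : U u -> der u = Lw (- 1) u.
Proof.
pose S : set V := [set v | der v = Y w 0 v].
apply: (U_gen (S := S)).
- split; first by rewrite /S /= (Y0r VA) (lin0 (der_lin VA)).
  by move=> a x y Sx Sy; rewrite /S /= (der_lin VA) (va_linr VA) Sx Sy.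
- by rewrite /S /= (der_one VA) (va_annih VA).
- by rewrite /S /= ww0.
move=> x y n Sx Sy; rewrite /S /= (der_Y VA) Sy.
have [N0 /(_ N0.+1 (leqnSn _))] := commutator VA w x y 0 n.
rewrite big_ord_recl big1 => [|i _]; last by rewrite lift0 binz0S scale0r.
rewrite binz0 scale1r -[Y w _ x]Sx !addr0 add0r (Y_der VA) => E.
by rewrite -scaleNr -E addrC subrK.
Qed.

Lemma sing0 : Lw 0 sing = 6%:R *: sing.
Proof.
have e2 v' : Lw 0 (Lw (- 2) v') = Lw (- 2) (Lw 0 v') + 2%:R *: Lw (- 2) v' by exact: Lw_comm0.
have e3 v' : Lw 0 (Lw (- 3) v') = Lw (- 3) (Lw 0 v') + 3%:R *: Lw (- 3) v' by exact: Lw_comm0.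
have e4 v' : Lw 0 (Lw (- 4) v') = Lw (- 4) (Lw 0 v') + 4%:R *: Lw (- 4) v' by exact: Lw_comm0.
have e6 v' : Lw 0 (Lw (- 6) v') = Lw (- 6) (Lw 0 v') + 6%:R *: Lw (- 6) v' by exact: Lw_comm0.
have LD m x y : Lw m (x + y) = Lw m x + Lw m y by exact: (linD _ _ (Lw_lin m)).
have LZ m c x : Lw m (c *: x) = c *: Lw m x by exact: (linZ _ _ (Lw_lin m)).
have LN m x : Lw m (- x) = - Lw m x by exact: (linN _ (Lw_lin m)).
have L0 m : Lw m 0 = 0 by exact: (Y0r VA).
have O0 : Lw 0 one = 0 by exact: Lw_one.
rewrite sing_Lw !(LD, LZ, LN, e2, e3, e4, e6, O0, L0, scaler0, add0r, addr0).
by lmod C.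
Qed.

Lemma sing_U x : descend sing x -> U x.
Proof.
elim=> [||a x' y _ Ux _ Uy|m x' _ Ux]; [exact: (sub0 sU)| |exact: sU.2|exact: U_closed].
rewrite /sing; do ![apply: (subB sU)|apply: (subD sU)]; apply: (subZ _ sU);
  by do ![apply: U_closed|done].
Qed.

(** Left products by U reduce to modes of w, which generates U. Right products follow by skew
    symmetry, where the derivation is L(-1) because everything stays in U. *)
Lemma sing_ideal u v n : U u -> descend sing v ->
  descend sing (Y u n v) /\ descend sing (Y v n u).
Proof.
move=> Uu Sv; have sS := descend_sub sing; have SL := descend_L singn sing0.
have US : forall x, U x -> forall m y, descend sing y -> descend sing (Y x m y).
  move=> x; pose S' : set V := [set x | forall m y, descend sing y -> descend sing (Y x m y)].
  apply: (U_gen (S := S')).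
  - split; first by move=> m y _; rewrite (Y0l VA); exact: Descend0.
    by move=> a x' y' Hx Hy m y Sy; rewrite (va_linl VA); apply: DescendLin; [apply: Hx|apply: Hy].
  - by move=> m y Sy; rewrite (va_vac VA); case: ifP => // _; exact: Descend0.
  - by move=> m y Sy; rewrite Lw_mode; apply: SL.
  move=> x' y' m Hx Hy k y Sy.
  by apply: (iterate_in VA sS) => i; [apply/Hx/Hy|apply/Hy/Hx].
split; first exact: US.
apply: (skew_in VA sS) => i; rewrite (Y_creat VA); apply: (subZ _ sS).
have : descend sing (Y u (n + i%:Z) v) by apply: US.
elim: i (Y u _ v) => //= i IH x Sx; rewrite (der_U (sing_U (IH _ Sx))).
exact/SL/IH.
Qed.

(** By simplicity the ideal is 0 or contains U. In the second case the vacuum, of eigenvalue 0, lies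
    in a span of eigenvectors of eigenvalue at least 6, so it is 0 and w with it. *)
Lemma sing_zero : sing = 0.
Proof.
have [H|H] := U_simple (descend_sub sing) sing_U (fun u v n Uu => sing_ideal n Uu).
  by apply: H; exact: DescendBase.
have H1 := descend_eig sing0 (H _ U_one).
have : one = 0.
  apply: (eig_span_neq (c := 0) (Lw_lin 0)); split; first by rewrite /eig /= scale0r Lw_one.
  apply: span_mono H1 => v [k Ev]; exists (6%:R + k%:R) => //.
  by rewrite -natrD pnatr_eq0.
move=> E; have w0 : w = 0 by rewrite -(va_creat VA w) E (Y0r VA).
by rewrite /sing E w0 !(Y0l VA) !scaler0 !subr0 addr0.
Qed.

(** * The cubic relation for L(0) *)

Section Zhu.
Variable K : set V.
Hypothesis sK : subspace K.
Hypothesis KL : forall n u, K u -> K (Lw n u).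

(** Taken relative to a subspace [K] stable under the L(n): the relation is needed both in the whole
    of V and inside the module generated by a single vector. *)
Definition neg_part : set V := lin_span [set x | exists (n : nat) u, K u /\ x = Lw (- n.+1%:Z) u].
Local Notation Z := neg_part.

Lemma Z_sub : subspace Z. Proof. exact: span_sub. Qed.

Lemma Z_neg (n : int) u : n < 0 -> K u -> Z (Lw n u).
Proof.
move=> n0 Ku; apply: span_incl; exists (absz n).-1, u; split=> //.
by congr Lw; lia.
Qed.

Lemma Z_iterate x v (r q : int) B (be : nat -> C) : r <= - 1 ->
  (forall n u, K u -> K (Y x n u)) -> K v ->
  (forall i, (i < B)%N -> be i = - ((-1) ^+ i * binz C r i * (-1) ^+ `|r|%N)) ->
  (forall i : nat, (B <= i)%N -> Z (Y x (q + r - i%:Z) (Y w i%:Z v))) ->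
  Z (Y (Y w r x) q v - \sum_(i < B) be i *: Y x (q + r - i%:Z) (Y w i%:Z v)).
Proof.
move=> r0 Kx Kv Hbe H; have [N0 /(_ (B + N0)%N (leq_addl _ _)) ->] := iterate VA w x v r q.
rewrite big_split_ord /= addrAC; apply: (subD Z_sub).
  rewrite -sumrB; apply: sub_sum => [|i _]; first exact: Z_sub.
  rewrite Hbe // scalerBr scalerA scaleNr opprK subrK; apply: (subZ _ Z_sub).
  by rewrite Lw_mode; apply: Z_neg; [lia|apply: Kx].
apply: sub_sum => [|i _]; first exact: Z_sub.
apply: (subZ _ Z_sub); apply: (subB Z_sub).
  by rewrite Lw_mode; apply: Z_neg; [lia|apply: Kx].
by apply: (subZ _ Z_sub); apply: H; rewrite leq_addr.
Qed.

Lemma beN1 i : 1 = - ((-1) ^+ i * binz C (- 1) i * (-1) ^+ absz (- 1)%R) :> C.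
Proof.
by rewrite binzN1 -exprD addnn -mul2n exprM sqrrN expr1n expr1n mul1r [_ ^+ absz _]expr1 opprK.
Qed.

Lemma Kw n u : K u -> K (Y w n u).
Proof. by rewrite Lw_mode; apply: KL. Qed.

Lemma Z_ww (m : int) (B : nat) y : m - 1 <= B%:Z -> K y ->
  Z (Y (Y w (- 1) w) m y - \sum_(j < B) Lw (m - 2 - j%:Z) (Lw (j%:Z - 1) y)).
Proof.
move=> hB Ky; have := @Z_iterate w y (- 1) m B (fun=> 1) (lexx _) Kw Ky (fun i _ => beN1 i) _.
rewrite (eq_bigr (fun j : 'I_B => Lw (m - 2 - j%:Z) (Lw (j%:Z - 1) y))).
  by apply=> i hi; rewrite Lw_mode; apply: Z_neg; [lia|exact: Kw].
by move=> i _; rewrite scale1r !Lw_mode; congr Lw; lia.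
Qed.

Lemma Z0 y : Z y -> Z (Lw 0 y).
Proof.
apply: (span_lin (Lw_lin 0) Z_sub) => _ [n [u [Ku ->]]].
rewrite (Lw_comm0 (k := - n.+1%:Z) (c := n.+1%:R)) ?add0r ?opprK //.
by apply: (subD Z_sub); [|apply: (subZ _ Z_sub)]; apply: Z_neg => //; apply: KL.
Qed.

Lemma Z_L1 y : K y -> Z (Lw 1 (Lw (- 1) y) - 2%:R *: Lw 0 y).
Proof.
move=> Ky; rewrite Lw_comm eqxx (_ : (1 - - 1)%:~R = 2%:R :> C) //.
rewrite (_ : (1 * (1 * 1 - 1))%:~R = 0 :> C) // mul0r scale0r addr0 addrK.
by apply: Z_neg => //; apply: KL.
Qed.

(* The coefficients are those of 2 h (16 h - 1) (2 h - 1). *)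
Lemma Z_cubic v : K v ->
  Z (64%:R *: Lw 0 (Lw 0 (Lw 0 v)) - 36%:R *: Lw 0 (Lw 0 v) + 2%:R *: Lw 0 v).
Proof.
move=> Kv; have sZ := Z_sub.
have LD n x y : Lw n (x + y) = Lw n x + Lw n y by exact: (linD _ _ (Lw_lin n)).
have LZ n c x : Lw n (c *: x) = c *: Lw n x by exact: (linZ _ _ (Lw_lin n)).
have Lv n : K (Lw n v) by apply: KL.
have LLv n m : K (Lw n (Lw m v)) by apply: KL.
have c0m y : Lw 0 (Lw (- 1) y) = Lw (- 1) (Lw 0 y) + 1 *: Lw (- 1) y by exact: Lw_comm0.
have c2m y : Lw 2 (Lw (- 1) y) = Lw (- 1) (Lw 2 y) + 3%:R *: Lw 1 y by exact: Lw_comm0.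
have Zm y : K y -> Z (Lw (- 1) y) by apply: Z_neg.
have Zc u x y : Z (u - x) -> Z (x - y) -> Z (u - y).
  by move=> H1 H2; have := subD sZ H1 H2; congr Z; lmod C.
have ZD u x y z : Z (u - x) -> Z (y - z) -> Z (u + y - (x + z)).
  by move=> H1 H2; have := subD sZ H1 H2; congr Z; lmod C.
have ZZ c u x : Z (u - x) -> Z (c *: u - c *: x) by rewrite -scalerBr; apply: subZ.
have Zr x : Z (x - x) by rewrite subrr; apply: (sub0 sZ).
(* The mode 5 of a vector of weight 6 preserves weights. [T1] to [T4] compute it on the four
   monomials of [sing], the first three modulo [Z]. *)
have T1 : Z (Y (Y w (- 1) (Y w (- 1) w)) 5 v -
    (Lw 0 (Lw 0 (Lw 0 v)) + 6%:R *: Lw 0 (Lw 0 v) + 8%:R *: Lw 0 v)).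
  have Kx n u : K u -> K (Y (Y w (- 1) w) n u).
    by move=> Ku; apply: (iterate_in VA sK) => i; apply: Kw; apply: Kw.
  apply: Zc (@Z_iterate _ v (- 1) 5 3 (fun=> 1) (lexx _) Kx Kv (fun i _ => beN1 i) _) _ => [i hi|].
    have := @Z_ww (5 - 1 - i%:Z) 0 (Y w i%:Z v) _ (Kw _ Kv).
    by rewrite big_ord0 subr0; apply; lia.
  rewrite !big_ord_recr big_ord0 /= add0r !scale1r.
  set Q := Y (Y w (- 1) w).
  have h0 : Z (Q 4 (Lw (- 1) v) - (Lw 2 (Lw (- 1) (Lw (- 1) v)) + Lw 1 (Lw 0 (Lw (- 1) v)) +
      Lw 0 (Lw 1 (Lw (- 1) v)))).
    have := @Z_ww 4 3 (Lw (- 1) v) (lexx _) (Lv _).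
    by rewrite !big_ord_recr !big_ord0 /= add0r.
  have h1 : Z (Q 3 (Lw 0 v) - (Lw 1 (Lw (- 1) (Lw 0 v)) + Lw 0 (Lw 0 (Lw 0 v)))).
    have := @Z_ww 3 2 (Lw 0 v) (lexx _) (Lv _).
    by rewrite !big_ord_recr !big_ord0 /= add0r.
  have h2 : Z (Q 2 (Lw 1 v) - Lw 0 (Lw (- 1) (Lw 1 v))).
    have := @Z_ww 2 1 (Lw 1 v) (lexx _) (Lv _).
    by rewrite !big_ord_recr !big_ord0 /= add0r.
  have ha : Z (Lw 2 (Lw (- 1) (Lw (- 1) v)) - 6%:R *: Lw 0 v).
    rewrite c2m (_ : 6%:R *: Lw 0 v = 0 + 3%:R *: (2%:R *: Lw 0 v)); last by lmod C.
    by apply: ZD; [rewrite subr0; apply: Zm|apply: ZZ; apply: Z_L1].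
  have hb : Z (Lw 1 (Lw 0 (Lw (- 1) v)) - (2%:R *: Lw 0 (Lw 0 v) + 2%:R *: Lw 0 v)).
    by rewrite c0m scale1r LD; apply: ZD; apply: Z_L1.
  have hc : Z (Lw 0 (Lw 1 (Lw (- 1) v)) - 2%:R *: Lw 0 (Lw 0 v)).
    by rewrite -LZ -(linB _ _ (Lw_lin 0)); apply: Z0; apply: Z_L1.
  have hd : Z (Lw 1 (Lw (- 1) (Lw 0 v)) - 2%:R *: Lw 0 (Lw 0 v)) by apply: Z_L1.
  have hf : Z (Lw 0 (Lw (- 1) (Lw 1 v))) by apply: Z0; apply: Zm.
  change (Z (Q 4 (Lw (- 1) v) + Q 3 (Lw 0 v) + Q 2 (Lw 1 v) -
    (Lw 0 (Lw 0 (Lw 0 v)) + 6%:R *: Lw 0 (Lw 0 v) + 8%:R *: Lw 0 v))).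
  have := subD sZ (subD sZ (subD sZ h0 h1) (subD sZ h2 hf))
    (subD sZ (subD sZ ha hb) (subD sZ hc hd)).
  by congr Z; lmod C.
have hL : Z (Lw 1 (Lw (- 1) v) - 2%:R *: Lw 0 v) by apply: Z_L1.
have T2 : Z (Y (Y w (- 2) (Y w (- 2) one)) 5 v - (4%:R *: Lw 0 (Lw 0 v) + 6%:R *: Lw 0 v)).
  have Kx n u : K u -> K (Y (der w) n u).
    by move=> Ku; rewrite (Y_der VA); apply: (subZ _ sK); apply: Kw.
  apply: Zc (@Z_iterate _ v (- 2) 5 2 (fun i => if i is 0 then -1 else -2%:R)
    isT Kx Kv _ _) _ => [[|[|]] // _|i hi|].
  - by rewrite binz0 /absz; ring.
  - by rewrite binz1 /absz (_ : (- 2)%:~R = - 2%:R :> C) //; ring.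
  - by rewrite (Y_der VA) Lw_mode; apply: (subZ _ sZ); apply: Z_neg; [lia|exact: Kw].
  rewrite !big_ord_recr big_ord0 /= !(Y_der VA) add0r.
  change (Z (- 1 *: (- 3%:~R *: Lw 1 (Lw (- 1) v)) + - 2%:R *: (- 2%:~R *: Lw 0 (Lw 0 v)) -
    (4%:R *: Lw 0 (Lw 0 v) + 6%:R *: Lw 0 v))).
  have := subZ 3%:R sZ hL; congr Z; lmod C.
have T3 : Z (Y (Y w (- 3) w) 5 v - (3%:R *: Lw 0 (Lw 0 v) + 2%:R *: Lw 0 v)).
  apply: Zc (@Z_iterate w v (- 3) 5 2 (fun i => if i is 0 then 1 else 3%:R) isT Kw Kv _ _) _
    => [[|[|]] // _|i hi|].
  - by rewrite binz0 /absz; ring.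
  - by rewrite binz1 /absz (_ : (- 3)%:~R = - 3%:R :> C) //; ring.
  - by rewrite Lw_mode; apply: Z_neg; [lia|exact: Kw].
  rewrite !big_ord_recr big_ord0 /= add0r.
  change (Z (1 *: Lw 1 (Lw (- 1) v) + 3%:R *: Lw 0 (Lw 0 v) -
    (3%:R *: Lw 0 (Lw 0 v) + 2%:R *: Lw 0 v))).
  have := hL; congr Z; lmod C.
have T4 : Y (Y w (- 5) one) 5 v = 5%:R *: Lw 0 v.
  rewrite (_ : - 5 = - 1 - 4%:Z) // (Y_creat VA) (linZ _ _ (va_linl VA _ _)) /=.
  rewrite !(Y_der VA) (_ : 5 - 1 - 1 - 1 - 1 = 0 + 1) // -/(Lw 0 v) !scalerA.
  by congr (_ *: _); rewrite !rmorphB /= (_ : 4`! = 24) //; field.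
have := congr1 (fun x => Y x 5 v) sing_zero.
rewrite (Y0l VA) /sing !(linB _ _ (va_linl VA _ _)) !(linD _ _ (va_linl VA _ _)).
rewrite !(linZ _ _ (va_linl VA _ _)) T4 => E.
set t1 := Y _ 5 v in T1 E; set t2 := Y _ 5 v in T2 E; set t3 := Y _ 5 v in T3 E.
set A1 := Lw 0 v in T1 T2 T3 E *; set A2 := Lw 0 A1 in T1 T2 T3 *; set A3 := Lw 0 A2 in T1 *.
have H := subN sZ (subB sZ (subD sZ (subZ 64%:R sZ T1) (subZ 93%:R sZ T2)) (subZ 264%:R sZ T3)).
suff -> : 64%:R *: A3 - 36%:R *: A2 + 2%:R *: A1 =
   - (64%:R *: (t1 - (A3 + 6%:R *: A2 + 8%:R *: A1)) + 93%:R *: (t2 - (4%:R *: A2 + 6%:R *: A1))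
     - 264%:R *: (t3 - (3%:R *: A2 + 2%:R *: A1))) by [].
by rewrite -[RHS]addr0 -[in RHS]E; lmod C.
Qed.

End Zhu.
End Virasoro.

(** * Decomposition with respect to an Ising vector *)

(** Two gradings coexist: [D], the L(0) of the whole algebra, with bounded below spectrum and
    finite-dimensional eigenspaces, and [Lw Y w 0], whose spectrum is found from the cubic
    relation. *)
Record cft_ising (C : numFieldType) (V : lmodType C) (Y : V -> int -> V -> V)
    (one : V) (D : V -> V) (w : V) : Prop := CftIsing {
  ci_va : vertex_algebra Y one;
  ci_lin : lin D;
  ci_wt : forall a k b, D (Y a k b) = Y (D a) k b + Y a k (D b) - (k + 1)%:~R *: Y a k b;
  ci_neg : forall n : int, n < 0 -> eig D n%:~R `<=` [set 0];
  ci_zero : forall v, D v = 0 -> exists c, v = c *: one;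
  ci_span : forall v, lin_span [set v | exists n : int, eig D n%:~R v] v;
  ci_fin : forall n : int, exists s : seq V,
    (forall x, x \in s -> eig D n%:~R x) /\ eig D n%:~R `<=` lin_span [set` s];
  ci_conf : exists omega, D omega = 2%:R *: omega /\ forall v, Y omega 0 v = der Y one v;
  ci_w : D w = 2%:R *: w;
  ci_w0 : Y w 0 w = der Y one w;
  ci_w1 : Y w 1 w = 2%:R *: w;
  ci_w2 : Y w 2 w = 0;
  ci_w3 : Y w 3 w = 4%:R^-1 *: one;
  ci_wn : forall n : nat, (3 < n)%N -> Y w n%:Z w = 0;
  ci_cubic : forall K : set V, subspace K -> (forall n u, K u -> K (Lw Y w n u)) ->
    forall v, K v -> neg_part Y w K (64%:R *: Lw Y w 0 (Lw Y w 0 (Lw Y w 0 v))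
      - 36%:R *: Lw Y w 0 (Lw Y w 0 v) + 2%:R *: Lw Y w 0 v) }.

Section Decomposition.
Context (C : numFieldType) (V : lmodType C) (Y : V -> int -> V -> V) (one w : V) (D : V -> V).
Hypothesis CI : cft_ising Y one D w.
Let VA := ci_va CI.
Let dD := ci_lin CI.
Local Notation L := (Lw Y w).
Local Notation der := (der Y one).
Implicit Types (x y u v a b : V).

Definition L_lin (n : int) : lin (L n) := Lw_lin w VA n.
Definition L_comm := Lw_comm VA (ci_w0 CI) (ci_w1 CI) (ci_w2 CI) (ci_w3 CI) (ci_wn CI).
Definition L_comm0 := Lw_comm0 VA (ci_w0 CI) (ci_w1 CI) (ci_w2 CI) (ci_w3 CI) (ci_wn CI).

(* The eigenvalues of L(0) lie in N / 16, and are indexed by their numerators. *)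
Definition ising_ev (e : nat) : C := e%:R / 16%:R.
Local Notation ev := ising_ev.
(** The numerators over 16 of the three roots 0, 1/16 and 1/2 of [cubic]. *)
Definition top_ev := [:: 0; 1; 8]%N.
Definition cubic (x : C) : C := 64%:R * x ^+ 3 - 36%:R * x ^+ 2 + 2%:R * x.

Lemma n16 : 16%:R != 0 :> C. Proof. by rewrite pnatr_eq0. Qed.

Lemma ev16 (e : nat) : ev e * 16%:R = e%:R. Proof. by rewrite /ev divfK ?n16. Qed.

Lemma ev_inj (e e' : nat) : ev e = ev e' -> e = e'.
Proof.
by move=> /(congr1 ( *%R^~ 16%:R)); rewrite !ev16 => /eqP; rewrite eqr_nat => /eqP.
Qed.

Lemma cubic_ev (e : nat) : cubic (ev e) = 0 -> e \in top_ev.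
Proof.
have -> : cubic (ev e) = e%:R * (e%:R - 1) * (e%:R - 8%:R) / 64%:R.
  by rewrite /cubic /ev; field.
move/eqP; rewrite mulf_eq0 invr_eq0 pnatr_eq0 orbF !mulf_eq0 pnatr_eq0 !subr_eq0.
by rewrite (eqr_nat C e 1) eqr_nat !inE orbA.
Qed.

Lemma ev_shift (e k : nat) : ev (e + 16 * k) = ev e + k%:R.
Proof. by rewrite /ev natrD natrM; field. Qed.

Lemma L0_L (m : int) (e : C) x : eig (L 0) e x -> eig (L 0) (e - m%:~R) (L m x).
Proof.
rewrite /eig /= => E; have [->|m0] := eqVneq m 0; first by rewrite subr0 E (linZ _ _ (L_lin 0)) E.
rewrite (L_comm0 (k := m) (c := (- m)%:~R)) ?add0r ?sub0r // E (linZ _ _ (L_lin m)).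
by rewrite rmorphN /=; lmod C.
Qed.

Lemma D_L (m : int) (c : C) x : D x = c *: x -> D (L m x) = (c - m%:~R) *: L m x.
Proof.
move=> E; rewrite /Lw (ci_wt CI) (ci_w CI) E (linZ _ _ (va_linl VA _ _)).
by rewrite (linZ _ _ (va_linr VA _ _)) !rmorphD /=; lmod C.
Qed.

Lemma D_int (n : int) x : eig D n%:~R x -> x = 0 \/ exists k : nat, n = k%:Z /\ D x = k%:R *: x.
Proof.
move=> Dx; have [n0|n0] := ltrP n 0; first by left; apply: (ci_neg CI n0).
by right; exists `|n|%N; rewrite (gez0_abs n0); split=> //; rewrite pmulrn (gez0_abs n0).
Qed.

Lemma D_span x : lin_span [set v | exists n : nat, D v = n%:R *: v] x.
Proof.
apply: (span_min (span_sub _)) (ci_span CI x) => v [n /D_int[->|[k [_ Dk]]]].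
  exact: (sub0 (span_sub _)).
by apply: span_incl; exists k.
Qed.

Definition homeig (P : nat -> Prop) (n : nat) : set V :=
  [set x | D x = n%:R *: x /\ exists e, [/\ P e, (e %% 16)%N \in top_ev & eig (L 0) (ev e) x]].

Lemma lagrange (n : nat) x : D x = n%:R *: x ->
  64%:R *: L 0 (L 0 (L 0 x)) - 36%:R *: L 0 (L 0 x) + 2%:R *: L 0 x = 0 ->
  lin_span (homeig (fun=> True) n) x.
Proof.
move=> Dx E; set a := L 0 x in E *; set b := L 0 a in E *.
have Lb : L 0 b = (36%:R / 64%:R) *: b - (2%:R / 64%:R) *: a.
  have <- : L 0 b - 64%:R^-1 *: (64%:R *: L 0 b - 36%:R *: b + 2%:R *: a) =
     (36%:R / 64%:R) *: b - (2%:R / 64%:R) *: a.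
    by lmod_with C ltac:(field).
  by rewrite E scaler0 subr0.
have Da : D a = n%:R *: a by rewrite /a (D_L 0 Dx) subr0.
have Db : D b = n%:R *: b by rewrite /b (D_L 0 Da) subr0.
have LD u v : L 0 (u + v) = L 0 u + L 0 v by exact: (linD _ _ (L_lin 0)).
have LZ c u : L 0 (c *: u) = c *: L 0 u by exact: (linZ _ _ (L_lin 0)).
have DD u v : D (u + v) = D u + D v by exact: (linD _ _ dD).
have DZ c u : D (c *: u) = c *: D u by exact: (linZ _ _ dD).
pose comb c1 c2 c3 := c1 *: b + (c2 *: a + c3 *: x).
have Dc c1 c2 c3 : D (comb c1 c2 c3) = n%:R *: comb c1 c2 c3.
  by rewrite /comb !DD !DZ Da Db Dx; lmod C.
have Lc c1 c2 c3 : L 0 (comb c1 c2 c3) =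
    c1 *: ((36%:R / 64%:R) *: b - (2%:R / 64%:R) *: a) + (c2 *: b + c3 *: a).
  by rewrite /comb !LD !LZ Lb.
(* Lagrange interpolation at 0, 1/2, 1/16: with h = L(0) the summands are (16h - 1)(2h - 1) x, (2/7)
   h (16h - 1) x and -(128/7) h (2h - 1) x. *)
have -> : x = comb 32%:R (- 18%:R) 1 +
    (comb (32%:R / 7%:R) (- (2%:R / 7%:R)) 0 + comb (- (256%:R / 7%:R)) (128%:R / 7%:R) 0).
  by rewrite /comb; lmod_with C ltac:(field).
apply: (subD (span_sub _)); last apply: (subD (span_sub _)); apply: span_incl; split=> //.
- by exists 0%N; split=> //; rewrite /eig /= Lc /ev /comb; lmod_with C ltac:(field).
- by exists 8%N; split=> //; rewrite /eig /= Lc /ev /comb; lmod_with C ltac:(field).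
- by exists 1%N; split=> //; rewrite /eig /= Lc /ev /comb; lmod_with C ltac:(field).
Qed.

(** Write q for the cubic in L(0). By induction on the weight, q x is a combination of vectors L(-m)
    u, m > 0, with eigenvalues at least 1, where the cubic has no root. Hence q x = q z for such a
    combination z, and x - z is killed by q. *)
Lemma decomposition (n : nat) x : D x = n%:R *: x -> lin_span (homeig (fun=> True) n) x.
Proof.
elim/ltn_ind: n x => n IH x Dx.
pose q v := 64%:R *: L 0 (L 0 (L 0 v)) - 36%:R *: L 0 (L 0 v) + 2%:R *: L 0 v.
have q_lin : lin q.
  move=> c u v; rewrite /q !(L_lin 0); lmod C.
have setTs : subspace (@setT V) by split.
have := ci_cubic CI setTs (fun _ _ _ => I) (I : setT x); rewrite -/(q x) => Zx.
have {Zx} : lin_span [set y | exists (m k : nat) u, D u = k%:R *: u /\ y = L (- m.+1%:Z) u] (q x).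
  move: Zx; apply: span_min; first exact: span_sub.
  move=> _ [m [u [_ ->]]]; move: u (D_span u); apply: (span_lin (L_lin _) (span_sub _)).
  by move=> u [k Du]; apply: span_incl; exists m, k, u.
have Dq : D (q x) = n%:R *: q x.
  have D0 y : D y = n%:R *: y -> D (L 0 y) = n%:R *: L 0 y.
    by move=> Dy; rewrite (D_L 0 Dy) subr0.
  rewrite /q (linD _ _ dD) (linB _ _ dD) !(linZ _ _ dD) !D0 //; lmod C.
move=> Zx; have {Zx} : lin_span (homeig (fun e => (15 < e)%N) n) (q x).
  have := eig_span (f := D) (c := n%:R) dD _ (conj Dq Zx).
  move=> H; have {}H := H (fun v => _); have {H} : lin_span
     ([set y | exists (m k : nat) u, D u = k%:R *: u /\ y = L (- m.+1%:Z) u] `&` eig D n%:R) (q x).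
    by apply: H => _ [m [k [u [Du ->]]]]; eexists; exact: (D_L _ Du).
  apply: span_min; first exact: span_sub.
  move=> y [[m [k [u [Du ->]]]] Dy].
  have [->|nz] := eqVneq (L (- m.+1%:Z) u) 0; first exact: (sub0 (span_sub _)).
  have En : n = (k + m.+1)%N.
    apply/eqP; rewrite -(eqr_nat C) eq_sym -subr_eq0; have := D_L (- m.+1%:Z) Du.
    rewrite (Dy : D _ = _) => /eqP; rewrite -subr_eq0 -scalerBl scaler_eq0 (negPf nz) orbF.
    by rewrite -oppr_eq0 opprB rmorphN /= opprK natrD.
  have := IH k _ u Du; rewrite En => /(_ _) H.
  have {}H := H ltac:(lia).
  move: u H {Du Dy nz}; apply: (span_lin (L_lin _) (span_sub _)) => u [Du [e [_ he Eu]]].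
  apply: span_incl; split.
    by rewrite (D_L _ Du) rmorphN opprK /= -natrD.
  exists (e + 16 * m.+1)%N; split; [lia|by rewrite addnC mulnC modnMDl|].
  by have := L0_L (- m.+1%:Z) Eu; rewrite rmorphN opprK /= ev_shift.
pose S : set V := lin_span (homeig (fun e => (15 < e)%N) n).
have sS : subspace S by exact: span_sub.
have Sq : S `<=` [set y | exists2 z, S z & q z = y].
  apply: span_min; first (split; first by exists 0; [exact: (sub0 sS)|exact: (lin0 q_lin)]).
    move=> c u v [z Sz <-] [z' Sz' <-]; exists (c *: z + z'); first exact: sS.2.
    exact: q_lin.
  move=> y [Dy [e [e15 he Ey]]].
  have qy c : eig (L 0) c y -> q y = cubic c *: y.
    rewrite /q /eig /= => E; rewrite !(E, linZ _ _ (L_lin 0)) /cubic; lmod C.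
  have c0 : cubic (ev e) != 0.
    by apply/eqP => /cubic_ev; rewrite !inE => /or3P[] /eqP E; rewrite E in e15.
  exists ((cubic (ev e))^-1 *: y); last by rewrite (linZ _ _ q_lin) (qy _ Ey) scalerA mulVf // scale1r.
  by apply: (subZ _ sS); apply: span_incl; split=> //; exists e.
move=> /Sq[z Sz Ez].
have S_all : S `<=` lin_span (homeig (fun=> True) n).
  by apply: span_mono => y [Dy [e [_ he Ey]]]; split=> //; exists e.
have Dz : D z = n%:R *: z.
  by apply: (span_min (eig_sub _ dD) _ Sz) => y [].
rewrite -(subrK z x); apply: (subD (span_sub _)); last exact: S_all.
apply: lagrange; first by rewrite (linB _ _ dD) Dx Dz -scalerBr.
by rewrite -/(q (x - z)) (linB _ _ q_lin) Ez subrr.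
Qed.

End Decomposition.

(** * Sectors, primary vectors and singular vectors *)

Section Spectrum.
Context (C : numFieldType) (V : lmodType C) (Y : V -> int -> V -> V) (one w : V) (D : V -> V).
Hypothesis CI : cft_ising Y one D w.
Let VA := ci_va CI.
Local Notation L := (Lw Y w).
Local Notation L_lin := (L_lin CI).
Local Notation L_comm := (L_comm CI).
Local Notation L_comm0 := (L_comm0 CI).
Local Notation ev := (ising_ev C).
Implicit Types (x y u v a b : V) (c : C) (P : pred nat) (e f : nat) (m n : int).

(** [P] is tested on the numerator modulo 16, that is on the eigenvalue modulo 1, so that [Sec P] is
    a sum of sectors. *)
Definition joint_eig P : set V := [set x | exists (n : nat) e,
  [/\ D x = n%:R *: x, (e %% 16)%N \in top_ev, P (e %% 16)%N & eig (L 0) (ev e) x]].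

Definition Sec P : set V := lin_span (joint_eig P).

Lemma Sec_sub P : subspace (Sec P). Proof. exact: span_sub. Qed.

Lemma Sec_all x : Sec xpredT x.
Proof.
move: x (D_span CI x); apply: span_min; first exact: Sec_sub.
move=> x [n /(decomposition CI)]; apply: span_min; first exact: Sec_sub.
by move=> y [Dy [e [_ he Ey]]]; apply: span_incl; exists n, e.
Qed.

(* The kernel of the projection onto the c-eigenspace of L(0). *)
Definition off c : set V := lin_span [set v | exists2 d, d != c & eig (L 0) d v].

Lemma off_sub c : subspace (off c). Proof. exact: span_sub. Qed.

Lemma off_eig c x : off c x -> eig (L 0) c x -> x = 0.
Proof. by move=> xo xe; apply: (eig_span_neq (L_lin 0)); split; [exact: xe|exact: xo]. Qed.

Lemma eig_off c d x : d != c -> eig (L 0) d x -> off c x.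
Proof. by move=> dc E; apply: span_incl; exists d. Qed.

Lemma Sec_off P c x : (forall e, (e %% 16)%N \in top_ev -> P (e %% 16)%N -> c != ev e) ->
  Sec P x -> off c x.
Proof.
move=> H; apply: span_min; first exact: off_sub.
by move=> y [n [e [_ he Pe Ey]]]; apply: (eig_off _ Ey); rewrite eq_sym H.
Qed.

Lemma eig_cases c x : eig (L 0) c x -> x = 0 \/ exists2 e, (e %% 16)%N \in top_ev & c = ev e.
Proof.
move=> E; have [|N] := pselect (exists2 e, (e %% 16)%N \in top_ev & c = ev e); [by right|left].
apply: (off_eig _ E); apply: (Sec_off (P := xpredT)) (Sec_all x) => e he _.
by apply/eqP => ce; apply: N; exists e.
Qed.

Lemma off_L m c x : off c x -> off (c - m%:~R) (L m x).
Proof.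
apply: (span_lin (L_lin m) (off_sub _)) => u [d dc Eu].
by apply: (eig_off _ (L0_L CI m Eu)); rewrite (inj_eq (addIr _)).
Qed.

Lemma off_L0 c x : off c x -> off c (L 0 x).
Proof. by move=> /(off_L (m := 0)); rewrite subr0. Qed.

Lemma off_split c x : sum_set (eig (L 0) c) (off c) x.
Proof.
have sE := eig_sub c (L_lin 0).
move: x (Sec_all x); apply: span_min; first exact: (sum_set_sub sE (off_sub c)).
move=> x [n [e [_ _ _ Ex]]]; have [E|N] := eqVneq (ev e) c.
  by apply: sum_setl; [exact: off_sub|rewrite -E].
by apply: sum_setr => //; exact: (eig_off N).
Qed.

Lemma L0_off c x : off c (L 0 x - c *: x).
Proof.
have [p [q [Ep qo ->]]] := off_split c x.
rewrite (linD _ _ (L_lin 0)) (Ep : L 0 p = _) scalerDr opprD addrACA subrr add0r.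
by apply: (subB (off_sub c)); [exact: off_L0|apply: (subZ _ (off_sub c))].
Qed.

Lemma off_all x : (forall c, off c x) -> x = 0.
Proof.
have : exists2 s, all predT s & mul_out (L 0) s x = 0.
  apply: (span_annihilated (P := predT) (L_lin 0) _ (Sec_all x)).
  by move=> v [n [e [_ _ _ Ev]]]; exists (ev e).
move=> [s _]; elim: s x => [|e s IH] x //= E H.
have Ez : L 0 x - e *: x = 0.
  apply: IH => [|c]; first by rewrite (mul_outC _ _ _ (L_lin 0)).
  by apply: (subB (off_sub c)); [exact: off_L0|apply: (subZ _ (off_sub c))].
by apply: (off_eig (H e)); apply/eqP; rewrite -subr_eq0 Ez.
Qed.

(** With x = s + t, t outside the sectors of [P], the hypothesis and the position of s show that t
    has no component at any eigenvalue. *)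
Lemma Sec_compl P x : (forall e, (e %% 16)%N \in top_ev -> ~~ P (e %% 16)%N -> off (ev e) x) ->
  Sec P x.
Proof.
move=> H; have : sum_set (Sec P) (Sec (predC P)) x.
  move: x {H} (Sec_all x); apply: span_min; first exact: (sum_set_sub (Sec_sub _) (Sec_sub _)).
  move=> x [n [e [Dx he _ Ex]]]; case Pe: (P (e %% 16)%N).
    by apply: sum_setl; [exact: Sec_sub|apply: span_incl; exists n, e].
  apply: sum_setr; first exact: Sec_sub.
  by apply: span_incl; exists n, e; split=> //; rewrite /= Pe.
move=> [s [t [Ss St E]]]; suff t0 : t = 0 by rewrite E t0 addr0.
apply: off_all => c.
have [[e he ce]|N] := pselect (exists2 e, (e %% 16)%N \in top_ev & c = ev e); last first.
  by apply: (Sec_off _ St) => e he _; apply/eqP => ce; apply: N; exists e.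
have neq e' : P (e %% 16)%N != P (e' %% 16)%N -> ev e != ev e'.
  by apply: contra => /eqP/ev_inj ->.
rewrite ce; case Pe: (P (e %% 16)%N) neq => neq.
  by apply: (Sec_off _ St) => e' _ /negPf Pe'; apply: neq; rewrite Pe'.
have -> : t = x - s by rewrite E addrC addKr.
apply: (subB (off_sub _)); first by apply: H => //; rewrite Pe.
by apply: (Sec_off _ Ss) => e' _ Pe'; apply: neq; rewrite Pe'.
Qed.

Lemma off_neg e k x : (e < 16)%N -> off (ev e) (L (- k.+1%:Z) x).
Proof.
move=> e16; move: x (Sec_all x); apply: (span_lin (L_lin _) (off_sub _)).
move=> u [n [f [_ _ _ Eu]]]; apply: (eig_off _ (L0_L CI (- k.+1%:Z) Eu)).
rewrite rmorphN opprK /= -ev_shift; apply/eqP => /ev_inj E.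
by move: e16; rewrite -E; lia.
Qed.

Lemma L_ev m e x : eig (L 0) (ev e) x ->
  L m x = 0 \/ exists f, [/\ f%:Z = e%:Z - 16%:Z * m, (f %% 16 = e %% 16)%N & eig (L 0) (ev f) (L m x)].
Proof.
move=> /(L0_L CI m) E; have [|[f _ Ef]] := eig_cases E; [by left|right].
have Ez : f%:Z = e%:Z - 16%:Z * m.
  apply/eqP; rewrite -(eqr_int C) rmorphB rmorphM /=; apply/eqP.
  move/(congr1 ( *%R^~ 16%:R)): Ef; rewrite mulrBl !ev16 -!pmulrn => <-.
  by rewrite mulrC.
by exists f; split=> //; [lia|rewrite -Ef].
Qed.

Lemma primary e x m : (e < 16)%N -> eig (L 0) (ev e) x -> 0 < m -> L m x = 0.
Proof. by move=> e16 /(L_ev m)[//|[f [Ef _ _]]] m0; move: Ef; nia. Qed.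

(** The cubic relation is applied inside the module generated by x, where the image of the L(-n) has
    eigenvalues above that of x. So cubic(h) x = 0, and h >= 1 is not a root. *)
Lemma singular_zero e x : (15 < e)%N -> eig (L 0) (ev e) x -> (forall m, 0 < m -> L m x = 0) -> x = 0.
Proof.
move=> e15 Ex px; have dL := descend_L VA (ci_w0 CI) (ci_w1 CI) (ci_w2 CI) (ci_w3 CI) (ci_wn CI) px Ex.
have KL n u : descend Y w x u -> descend Y w x (L n u) by move=> /dL.
have := ci_cubic CI (descend_sub _ _ _) KL (DescendBase _ _ x).
rewrite !((Ex : L 0 x = _), linZ _ _ (L_lin 0)) => Z.
have Zo : off (ev e) (cubic (ev e) *: x).
  have -> : cubic (ev e) *: x = 64%:R *: (ev e *: (ev e *: (ev e *: x))) -
      36%:R *: (ev e *: (ev e *: x)) + 2%:R *: (ev e *: x) by rewrite /cubic; lmod C.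
  move: Z; apply: span_min; first exact: off_sub.
  move=> _ [k [u [/(descend_eig VA (ci_w0 CI) (ci_w1 CI) (ci_w2 CI) (ci_w3 CI) (ci_wn CI) Ex) Su ->]]].
  move: u Su; apply: (span_lin (L_lin _) (off_sub _)) => u [j Eu].
  apply: (eig_off _ (L0_L CI (- k.+1%:Z) Eu)).
  by rewrite rmorphN opprK -addrA -natrD -subr_eq0 addrAC subrr add0r pnatr_eq0 addnS.
have c0 : cubic (ev e) != 0.
  by apply/eqP => /cubic_ev; rewrite !inE => /or3P[] /eqP E; rewrite E in e15.
have /eqP := off_eig Zo (subZ _ (eig_sub _ (L_lin 0)) Ex).
by rewrite scaler_eq0 (negPf c0) => /eqP.
Qed.

Definition neg_eig e : set V := [set x | exists k f u,
  [/\ e = (f + 16 * k.+1)%N, eig (L 0) (ev f) u & x = L (- k.+1%:Z) u]].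

(** The cubic relation in all of V writes cubic(h) x through images of the L(-n), and h >= 1 is not
    a root. This allows induction from primary vectors to all others. *)
Lemma high_eig e x : (15 < e)%N -> eig (L 0) (ev e) x -> lin_span (neg_eig e) x.
Proof.
move=> e15 Ex; have setTs : subspace (@setT V) by split.
have := ci_cubic CI setTs (fun _ _ _ => I) (I : setT x).
rewrite !((Ex : L 0 x = _), linZ _ _ (L_lin 0)) => Z.
have c0 : cubic (ev e) != 0.
  by apply/eqP => /cubic_ev; rewrite !inE => /or3P[] /eqP E; rewrite E in e15.
have Zx : lin_span [set y | exists k f u, eig (L 0) (ev f) u /\ y = L (- k.+1%:Z) u] x.
  have -> : x = (cubic (ev e))^-1 *: (64%:R *: (ev e *: (ev e *: (ev e *: x))) -
      36%:R *: (ev e *: (ev e *: x)) + 2%:R *: (ev e *: x)).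
    apply: (scalerI c0); rewrite [RHS]scalerA divff // /cubic; lmod C.
  apply: (subZ _ (span_sub _)); move: Z; apply: span_min; first exact: span_sub.
  move=> _ [k [u [_ ->]]]; move: u (Sec_all u); apply: (span_lin (L_lin _) (span_sub _)).
  by move=> u [_ [f [_ _ _ Eu]]]; apply: span_incl; exists k, f, u.
have := eig_span (L_lin 0) _ (conj Ex Zx) => H.
have {H} : lin_span ([set y | exists k f u, eig (L 0) (ev f) u /\ y = L (- k.+1%:Z) u] `&`
    eig (L 0) (ev e)) x.
  by apply: H => _ [k [f [u [Eu ->]]]]; eexists; exact: (L0_L CI _ Eu).
apply: span_min; first exact: span_sub.
move=> _ [[k [f [u [Eu ->]]]] Ey].
have [->|nz] := eqVneq (L (- k.+1%:Z) u) 0; first exact: (sub0 (span_sub _)).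
apply: span_incl; exists k, f, u; split=> //; apply: (@ev_inj C).
apply/eqP; apply/negP => /negP ne; case/eqP: nz.
apply: (eig_disjoint (L_lin 0) ne Ey); have := L0_L CI (- k.+1%:Z) Eu.
by rewrite rmorphN opprK /= ev_shift.
Qed.

End Spectrum.

(** * Fusion rules *)

Section Fusion.
Context (C : numFieldType) (V : lmodType C) (Y : V -> int -> V -> V) (one w : V) (D : V -> V).
Hypothesis CI : cft_ising Y one D w.
Let VA := ci_va CI.
Local Notation L := (Lw Y w).
Local Notation L_lin := (L_lin CI).
Local Notation L_comm := (L_comm CI).
Local Notation L_comm0 := (L_comm0 CI).
Local Notation ev := (ising_ev C).
Local Notation off := (off Y w).
Implicit Types (x y u v a b : V) (c h : C) (P : pred nat) (e f : nat) (m n : int).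

(** The Ising fusion rules, with 0 for the identity, 8 for epsilon and 1 for sigma: sigma times
    sigma gives the identity and epsilon, epsilon times epsilon the identity, since 8 + 8 is 0
    modulo 16. *)
Definition fus (i j k : nat) := if i == 1%N then (if j == 1%N then k != 1%N else k == 1%N)
  else if j == 1%N then k == 1%N else k == ((i + j) %% 16)%N.

Lemma L1_mode a n b : Y (L (- 1) a) (n + 1) b = L 0 (Y a n b) - Y (L 0 a) n b - Y a n (L 0 b).
Proof.
have [N0 /(_ (N0 + 2)%N (leq_addr _ _)) E] := commutator VA w a b 1 n; move: E.
rewrite (sum_stable (F := fun i : nat => binz C 1 i *: Y (Y w i%:Z a) (1 + n - i%:Z) b)
  (leq_addl N0 2)) => [|i hi]; last by rewrite (@binz_nat C 1) ?scale0r.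
rewrite !big_ord_recr big_ord0 /= binz0 binz1 add0r !scale1r.
have -> : 1 + n - 0 = n + 1 by lia.
have -> : 1 + n - 1 = n by lia.
move=> /(canRL (subrK _)) E.
change (Y (Y w 0 a) (n + 1) b = Y w 1 (Y a n b) - Y (Y w 1 a) n b - Y a n (Y w 1 b)).
rewrite E; change (Y w 0%Z a) with (Y w 0 a); change (Y w 1%Z a) with (Y w 1 a); lmod C.
Qed.

Lemma Lm1_mode a n b : Y (L (- 1) a) n b = L (- 1) (Y a n b) - Y a n (L (- 1) b).
Proof.
have [N0 /(_ N0.+1 (leqnSn _)) E] := commutator VA w a b 0 n; move: E.
rewrite big_ord_recl big1 ?addr0 => [|i _]; last by rewrite binz0S scale0r.
by rewrite binz0 scale1r /= add0r => /esym.
Qed.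

Lemma off_mode c h h' a n b : eig (L 0) h a -> eig (L 0) h' b ->
  off c (Y (L (- 1) a) (n + 1) b - (c - h - h') *: Y a n b).
Proof.
move=> Ea Eb; rewrite L1_mode (Ea : L 0 a = _) (Eb : L 0 b = _).
rewrite (linZ _ _ (va_linl VA _ _)) (linZ _ _ (va_linr VA _ _)).
rewrite (_ : _ - _ = L 0 (Y a n b) - c *: Y a n b); [exact: (L0_off CI)|lmod C].
Qed.

Lemma level1 c h h' a n b : eig (L 0) h a -> eig (L 0) h' b ->
  L (- 1) a = 0 -> off c ((c - h - h') *: Y a n b).
Proof.
move=> Ea Eb a0; have := off_mode (c := c) n Ea Eb; rewrite a0 (Y0l VA) sub0r.
by move=> /(subN (off_sub _ _ _)); rewrite opprK.
Qed.

(* Modulo off, the mode n + 1 of L(-1) a is d times the mode n of a, so that a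
   singular vector of level 2 over a becomes a quadratic equation for d. *)
Lemma level2 k h h' (ka : C) a n b : (k < 16)%N -> eig (L 0) h a -> eig (L 0) h' b ->
  (forall m, 0 < m -> L m b = 0) -> L (- 2) a = ka *: L (- 1) (L (- 1) a) ->
  let d := ev k - h - h' in off (ev k) ((h' - d - ka * ((d - 1) * d)) *: Y a n b).
Proof.
move=> k16 Ea Eb pb E2; set c := ev k => d; have sO := off_sub Y w c.
have neg m x : m < 0 -> off c (L m x).
  by move=> m0; rewrite (_ : m = - (absz m).-1.+1%:Z); [exact: (off_neg CI)|lia].
have E11 : off c (Y (L (- 1) (L (- 1) a)) (n + 2) b - ((d - 1) * d) *: Y a n b).
  have Ea1 : eig (L 0) (h + 1) (L (- 1) a).
    by have := L0_L CI (- 1) Ea; rewrite rmorphN opprK.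
  have := off_mode (c := c) (n + 1) Ea1 Eb; rewrite (_ : n + 1 + 1 = n + 2); last by lia.
  move=> H1; have := subZ (d - 1) sO (off_mode (c := c) n Ea Eb) => /(subD sO H1).
  by congr off; rewrite /d; lmod C.
have E1 : off c (Y a (n + 1) (L (- 1) b) + d *: Y a n b).
  have -> : Y a (n + 1) (L (- 1) b) = L (- 1) (Y a (n + 1) b) - Y (L (- 1) a) (n + 1) b.
    by rewrite Lm1_mode; lmod C.
  have := subB sO (neg (- 1) (Y a (n + 1) b) isT) (off_mode (c := c) n Ea Eb).
  by congr off; rewrite /d; lmod C.
have E22 : off c (Y (L (- 2) a) (n + 2) b - (h' - d) *: Y a n b).
  have [N0 /(_ (N0 + 2)%N (leq_addr _ _))] := iterate VA w a b (- 1) (n + 2).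
  rewrite (eq_bigr (fun i : 'I_(N0 + 2) => Y w (- 1 - i%:Z) (Y a (n + 2 + i%:Z) b) +
      Y a (n + 1 - i%:Z) (Y w i%:Z b))) => [|i _]; last first.
    rewrite binzN1 -exprD addnn -mul2n exprM sqrrN !expr1n scale1r expr1 scaleN1r opprK.
    by congr (_ + Y a _ _); lia.
  rewrite big_split /= (sum_stable (F := fun i : nat => Y a (n + 1 - i%:Z) (Y w i%:Z b))
    (leq_addl N0 2)) => [|i hi]; last by rewrite (Lw_mode Y w) pb ?(Y0r VA) //; lia.
  rewrite !big_ord_recr big_ord0 /= add0r.
  have -> : n + 1 - 0 = n + 1 by lia.
  have -> : n + 1 - 1 = n by lia.
  have -> : Y w 1 b = h' *: b by exact: Eb.
  rewrite (linZ _ _ (va_linr VA _ _)) -[Y w 0 b]/(L (- 1) b) -[Y w (- 1) a]/(L (- 2) a) => ->.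
  rewrite -!addrA; apply: (subD sO).
    by apply: sub_sum => // i _; rewrite (Lw_mode Y w); apply: neg; lia.
  by move: E1; congr off; lmod C.
have := subB sO (subZ ka sO E11) E22.
rewrite E2 (linZ _ _ (va_linl VA _ _)); congr off; lmod C.
Qed.

(** L(1) L(-1) a = 2 L(0) a = 0, so L(-1) a is singular of eigenvalue 1 and vanishes. *)
Lemma singular0 a : eig (L 0) (ev 0) a -> L (- 1) a = 0.
Proof.
move=> Ea; have Ln0 m : L m 0 = 0 by exact: (Y0r VA).
have pa m : 0 < m -> L m a = 0 by exact: (primary CI _ Ea).
have L0a : L 0 a = 0 by rewrite (Ea : _ = _) (_ : ev 0 = 0) ?scale0r // /ising_ev mul0r.
have c11 v : L 1 (L (- 1) v) = L (- 1) (L 1 v) + 2%:R *: L 0 v.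
  by rewrite L_comm eqxx (_ : (1 - - 1)%:~R = 2%:R :> C) // subrr mul0r scale0r addr0.
have c21 v : L 2 (L (- 1) v) = L (- 1) (L 2 v) + 3%:R *: L 1 v by exact: L_comm0.
apply: (singular_zero CI (e := 0 + 16 * 1)) => //.
  by rewrite ev_shift; have := L0_L CI (- 1) Ea; rewrite rmorphN opprK.
apply: (Lw_pos VA (ci_w0 CI) (ci_w1 CI) (ci_w2 CI) (ci_w3 CI) (ci_wn CI)).
  by rewrite c11 pa // L0a Ln0 scaler0 addr0.
by rewrite c21 !pa // Ln0 scaler0 addr0.
Qed.

(** The conditions on [ka] say that L(1) and L(2) kill the difference of the two sides, which is
    then singular of eigenvalue h + 2. They have the solution 3/4 at h = 1/2 and 4/3 at h = 1/16. *)
Lemma singular12 e ka a : (e < 16)%N -> eig (L 0) (ev e) a -> ka * (4%:R * ev e + 2%:R) = 3%:R ->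
  4%:R * ev e + 4%:R^-1 = 6%:R * ev e * ka -> L (- 2) a = ka *: L (- 1) (L (- 1) a).
Proof.
move=> e16 Ea k1 k2; have pa := primary CI e16 Ea; set h := ev e in Ea k1 k2.
have c12 v : L 1 (L (- 2) v) = L (- 2) (L 1 v) + 3%:R *: L (- 1) v by exact: L_comm0.
have c22 v : L 2 (L (- 2) v) = L (- 2) (L 2 v) + 4%:R *: L 0 v + 4%:R^-1 *: v.
  rewrite L_comm eqxx (_ : (2 - - 2)%:~R = 4%:R :> C) // subrr.
  rewrite (_ : (2 * (2 * 2 - 1))%:~R = 6%:R :> C) //.
  by rewrite (_ : 6%:R / 24%:R = 4%:R^-1 :> C) //; field.
have c21 v : L 2 (L (- 1) v) = L (- 1) (L 2 v) + 3%:R *: L 1 v by exact: L_comm0.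
have c11 v : L 1 (L (- 1) v) = L (- 1) (L 1 v) + 2%:R *: L 0 v.
  by rewrite L_comm eqxx (_ : (1 - - 1)%:~R = 2%:R :> C) // subrr mul0r scale0r addr0.
have c01 v : L 0 (L (- 1) v) = L (- 1) (L 0 v) + 1 *: L (- 1) v by exact: L_comm0.
have Ln0 m : L m 0 = 0 by exact: (Y0r VA).
have LD m u v : L m (u + v) = L m u + L m v by exact: (linD _ _ (L_lin m)).
have LZ m c v : L m (c *: v) = c *: L m v by exact: (linZ _ _ (L_lin m)).
have LB m u v : L m (u - v) = L m u - L m v by exact: (linB _ _ (L_lin m)).
have p1 : L 1 a = 0 by exact: pa.
have p2 : L 2 a = 0 by exact: pa.
apply/eqP; rewrite -subr_eq0; apply/eqP; apply: (singular_zero CI (e := e + 16 * 2)); first by lia.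
  apply: (subB (eig_sub _ (L_lin 0))); last apply: (subZ _ (eig_sub _ (L_lin 0))).
    by rewrite ev_shift; have := L0_L CI (- 2) Ea; rewrite rmorphN opprK.
  have := L0_L CI (- 1) (L0_L CI (- 1) Ea).
  by rewrite rmorphN opprK ev_shift -addrA.
apply: (Lw_pos VA (ci_w0 CI) (ci_w1 CI) (ci_w2 CI) (ci_w3 CI) (ci_wn CI)).
  rewrite !(LB, LZ, c12, c11, p1, Ln0, add0r, c01, LD, (Ea : L 0 a = _)).
  transitivity ((3%:R - ka * (4%:R * h + 2%:R)) *: L (- 1) a); first by lmod C.
  by rewrite k1 subrr scale0r.
rewrite !(LB, LZ, c22, c21, c11, p1, p2, Ln0, add0r, c01, LD, (Ea : L 0 a = _), addr0).
transitivity ((4%:R * h + 4%:R^-1 - 6%:R * h * ka) *: a); first by lmod C.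
by rewrite k2 subrr scale0r.
Qed.

End Fusion.

Section FusionRules.
Context (C : numFieldType) (V : lmodType C) (Y : V -> int -> V -> V) (one w : V) (D : V -> V).
Hypothesis CI : cft_ising Y one D w.
Let VA := ci_va CI.
Local Notation L := (Lw Y w).
Local Notation L_lin := (L_lin CI).
Local Notation ev := (ising_ev C).
Local Notation off := (off Y w).
Local Notation Sec := (Sec Y w D).
Implicit Types (x y u v a b : V) (c h : C) (P : pred nat) (e f : nat) (m n : int).

(** Multiplied by 16^2 q the coefficient becomes an integer, whose nonvanishing is decided by
    computation for each forbidden triple. *)
Lemma level2_coef (i j k p q : nat) (ka d : C) : ka * q%:R = p%:R ->
  16%:Z * q%:Z * j%:Z - 16%:Z * q%:Z * (k%:Z - i%:Z - j%:Z)
    - p%:Z * ((k%:Z - i%:Z - j%:Z - 16%:Z) * (k%:Z - i%:Z - j%:Z)) != 0 ->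
  d = ev k - ev i - ev j -> ev j - d - ka * ((d - 1) * d) != 0.
Proof.
move=> kq; rewrite -(intr_eq0 C) => H ->; apply: contra H => /eqP E; apply/eqP.
have {}E := congr1 ( *%R (16%:R * 16%:R * q%:R)) E; rewrite mulr0 in E.
rewrite -E !(rmorphB, rmorphM) /= -!pmulrn -kq -(ev16 C i) -(ev16 C j) -(ev16 C k); ring.
Qed.

Lemma fusion_primary (i j k : nat) a b n : i \in top_ev -> j \in top_ev -> k \in top_ev -> ~~ fus i j k ->
  eig (L 0) (ev i) a -> eig (L 0) (ev j) b -> off (ev k) (Y a n b).
Proof.
move=> hi hj hk nf Ea Eb; have sO := off_sub Y w (ev k).
have top16 l : l \in top_ev -> (l < 16)%N by rewrite !inE => /or3P[] /eqP ->.
have cancel c x : c != 0 -> off (ev k) (c *: x) -> off (ev k) x.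
  by move=> c0 /(subZ c^-1 sO); rewrite scalerA mulVf // scale1r.
have pb := primary CI (top16 _ hj) Eb.
have [i0|i0] := eqVneq i 0%N.
  rewrite i0 in nf Ea; have a0 := singular0 CI Ea.
  have := level1 CI (c := ev k) n Ea Eb a0; apply: cancel.
  rewrite (_ : ev 0 = 0) ?subr0 ?subr_eq0; last by rewrite /ising_ev mul0r.
  apply: contra nf => /eqP/ev_inj ->; rewrite /fus /= add0n.
  by case/or3P: hj => [||/orP[]//] /eqP ->.
have [p [q [ka [q0 kq E2]]]] : exists p q ka, [/\ (p, q) = (if i == 8 then (3, 4) else (4, 3))%N,
    ka * q%:R = p%:R & L (- 2) a = ka *: L (- 1) (L (- 1) a)].
  have [i8|i8] := eqVneq i 8%N.
    exists 3%N, 4%N, (3%:R / 4%:R); split=> //; first by field.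
    rewrite i8 in Ea; apply: (singular12 CI _ Ea); rewrite // /ising_ev; by field.
  have i1 : i = 1%N by move: hi i0 i8; rewrite !inE => /or3P[] /eqP ->.
  exists 4%N, 3%N, (4%:R / 3%:R); split=> //; first by field.
  rewrite i1 in Ea; apply: (singular12 CI _ Ea); rewrite // /ising_ev; by field.
have := level2 CI n (top16 _ hk) Ea Eb pb E2; apply: cancel.
apply: (level2_coef kq _ erefl); move: q0 nf i0; clear -hi hj hk.
move: hi hj hk; rewrite !inE.
by move=> /or3P[] /eqP -> /or3P[] /eqP -> /or3P[] /eqP -> //= [-> ->].
Qed.

(** A factor of eigenvalue at least 1 is a combination of L(-m) u. Moved to the left, L(-m) has no
    component at ev k < 1, and the other terms involve u, of smaller eigenvalue; so the claim
    descends to primary vectors, first in a and then in b. *)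
Lemma fusion_low (i j k : nat) : i \in top_ev -> j \in top_ev -> k \in top_ev -> ~~ fus i j k ->
  forall e f a b n, (e %% 16 = i)%N -> (f %% 16 = j)%N ->
  eig (L 0) (ev e) a -> eig (L 0) (ev f) b -> off (ev k) (Y a n b).
Proof.
move=> hi hj hk nf; have sO := off_sub Y w (ev k).
have top16 l : l \in top_ev -> (l < 16)%N by rewrite !inE => /or3P[] /eqP ->.
have neg m x : m < 0 -> off (ev k) (L m x).
  by move=> m0; rewrite (_ : m = - (absz m).-1.+1%:Z); [apply: (off_neg CI); apply: top16|lia].
elim/ltn_ind => e IHe f a b n Ee Ef Ea Eb; have [e16|e15] := ltnP e 16; last first.
  move: (high_eig CI e15 Ea).
  apply: (span_lin (va_linl VA n b) sO) => _ [m [g [u [Eg Eu ->]]]].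
  have Eg16 : (g %% 16 = i)%N by move: Ee; rewrite Eg => <-; lia.
  have Yu n' f' b' : (f' %% 16)%N = j -> eig (L 0) (ev f') b' -> off (ev k) (Y u n' b').
    by move=> Ef' Eb'; apply: (IHe g _ f') => //; lia.
  rewrite /Lw; apply: (iterate_in VA sO) => l.
    by rewrite (Lw_mode Y w); apply: neg; lia.
  rewrite (Lw_mode Y w); have [->|[f' [_ Ef' Eb']]] := L_ev CI (l%:Z - 1) Eb.
    by rewrite (Y0r VA); exact: (sub0 sO).
  by apply: Yu Eb'; rewrite Ef'.
have pa := primary CI e16 Ea; elim/ltn_ind: f n b Ef Eb => f IHf n b Ef Eb.
have [f16|f15] := ltnP f 16.
  by apply: (fusion_primary (i := i) (j := j)) => //; [rewrite -Ee|rewrite -Ef]; rewrite modn_small.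
move: (high_eig CI f15 Eb).
apply: (span_lin (va_linr VA a n) sO) => _ [m [g [u [Eg Eu ->]]]].
have Yu n' : off (ev k) (Y a n' u) by apply: (IHf g); [lia|rewrite -Ef Eg; lia|].
have := subN sO (_ : off (ev k) (Y w (- m.+1%:Z + 1) (Y a n u) - Y a n (Y w (- m.+1%:Z + 1) u))).
rewrite opprB => /(_ _) H; apply: (sub_congr sO (H _)); last by apply: neg; lia.
apply: (commutator_in VA sO) => l; rewrite (Lw_mode Y w (l%:Z)).
have [l2|] := ltnP 1 l; first by rewrite pa ?(Y0l VA); [exact: (sub0 sO)|lia].
case: l => [|[|//]] _; last first.
  have -> : L (1%N%:Z - 1) a = ev e *: a by exact: Ea.
  by rewrite (linZ _ _ (va_linl VA _ _)); exact: (subZ _ sO).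
(* The product w_0 a = L(-1) a is not a multiple of a; [L1_mode] expresses its mode through a and u
   alone, where the induction applies. *)
set n' := (X in Y _ X u); rewrite -[n'](subrK 1) -[L _ a]/(L (- 1) a) (L1_mode CI).
rewrite (Ea : L 0 a = _) (Eu : L 0 u = _) (linZ _ _ (va_linl VA _ _)) (linZ _ _ (va_linr VA _ _)).
by apply: (subB sO); [apply: (subB sO)|]; [apply: (off_L0 CI); exact: Yu|apply: (subZ _ sO); exact: Yu|apply: (subZ _ sO); exact: Yu].
Qed.

(* The lowest component of a product in a forbidden sector would be a singular
   vector of too high weight. *)
Lemma fusion_off (i j k l : nat) : i \in top_ev -> j \in top_ev -> k \in top_ev -> ~~ fus i j k ->
  forall e f a b n, (e %% 16 = i)%N -> (f %% 16 = j)%N ->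
  eig (L 0) (ev e) a -> eig (L 0) (ev f) b -> off (ev (k + 16 * l)) (Y a n b).
Proof.
move=> hi hj hk nf; elim/ltn_ind: l => -[_|l IH] e f a b n Ee Ef Ea Eb.
  by rewrite muln0 addn0; apply: (fusion_low hi hj hk nf n Ee Ef Ea Eb).
set c := ev _; have sO := off_sub Y w; have [p [q [Ep qo E]]] := off_split CI c (Y a n b).
suff p0 : p = 0 by rewrite E p0 add0r.
apply: (singular_zero CI _ Ep) => [|m m0]; first by lia.
have [//|[g [Eg _ Eg']]] := L_ev CI m Ep.
apply: (off_eig CI _ Eg'); have -> : L m p = L m (Y a n b) - L m q.
  by rewrite E (linD _ _ (L_lin m)) addrK.
have k16 : (k < 16)%N by move: hk; rewrite !inE => /or3P[] /eqP ->.
have Ek : ev g = ev (k + 16 * (l.+1 - absz m)) by congr ev; lia.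
apply: (subB (sO _)); last first.
  have -> : ev g = c - m%:~R; last exact: (off_L CI).
  apply/eqP; rewrite /c -subr_eq0 opprB addrA (_ : k + 16 * l.+1 = g + 16 * absz m)%N; last by lia.
  by rewrite ev_shift opprD addrACA subrr add0r pmulrn (gtz0_abs m0) subrr.
have lt_l : (l.+1 - absz m < l.+1)%N by lia.
have Yg e' f' a' b' n' : (e' %% 16 = i)%N -> (f' %% 16 = j)%N ->
  eig (L 0) (ev e') a' -> eig (L 0) (ev f') b' -> off (ev g) (Y a' n' b').
  by rewrite Ek; exact: IH.
rewrite /Lw; apply: (sub_congr (sO _) (v := Y a n (Y w (m + 1) b))).
  apply: (commutator_in VA (sO _)) => r; rewrite (Lw_mode Y w r).
  have [->|[e' [_ Ee' Ea']]] := L_ev CI (r%:Z - 1) Ea; first by rewrite (Y0l VA); exact: (sub0 (sO _)).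
  by apply: (Yg e' f) => //; rewrite Ee'.
rewrite -[Y w (m + 1) b]/(L m b).
have [->|[f' [_ Ef' Eb']]] := L_ev CI m Eb; first by rewrite (Y0r VA); exact: (sub0 (sO _)).
by apply: (Yg e f') => //; rewrite Ef'.
Qed.

Theorem fusion (P Q R : pred nat) : (forall i j k : nat, i \in top_ev -> j \in top_ev -> k \in top_ev ->
    P i -> Q j -> fus i j k -> R k) ->
  forall a b n, Sec P a -> Sec Q b -> Sec R (Y a n b).
Proof.
move=> H a b n Pa Qb; have sR : subspace (Sec R) by exact: span_sub.
move: a Pa; apply: (span_lin (va_linl VA n b) sR) => a [na [e [_ he Pe Ea]]]; move: b Qb.
apply: (span_lin (va_linr VA a n) sR) => b [nb [f [_ hf Qf Eb]]].
apply: (Sec_compl CI) => g hg nR.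
have nf : ~~ fus (e %% 16) (f %% 16) (g %% 16) by apply: contra nR; apply: H.
rewrite {1}(divn_eq g 16) addnC mulnC.
exact: (fusion_off (l := g %/ 16) he hf hg nf n erefl erefl Ea Eb).
Qed.

End FusionRules.

(** * The even part *)

Section Sectors.
Context (C : numFieldType) (V : lmodType C) (Y : V -> int -> V -> V) (one w : V) (D : V -> V).
Hypothesis CI : cft_ising Y one D w.
Let VA := ci_va CI.
Let dD := ci_lin CI.
Local Notation L := (Lw Y w).
Local Notation ev := (ising_ev C).
Local Notation Sec := (Sec Y w D).
Implicit Types (x y u v a b : V) (c : C) (P Q R : pred nat) (n : int).

(** A Boolean over the 27 triples, so that it holds by computation for concrete sectors. *)
Definition fus_in P Q R := all (fun i => all (fun j => all (fun k =>
  [&& P i, Q j & fus i j k] ==> R k) top_ev) top_ev) top_ev.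

Lemma fusion_in P Q R a b n : fus_in P Q R -> Sec P a -> Sec Q b -> Sec R (Y a n b).
Proof.
move=> H; apply: (fusion CI) => i j k hi hj hk Pi Qj f.
by move/allP/(_ i hi)/allP/(_ j hj)/allP/(_ k hk): H; rewrite Pi Qj f.
Qed.

Lemma Sec_mono P Q : {subset P <= Q} -> Sec P `<=` Sec Q.
Proof.
by move=> PQ; apply: span_mono => x [n [e [Dx he Pe Ex]]]; exists n, e; split=> //; exact: PQ.
Qed.

Lemma Sec_disjoint P Q x : (forall k, P k -> ~~ Q k) -> Sec P x -> Sec Q x -> x = 0.
Proof.
move=> PQ Px Qx; apply: (off_all CI) => c.
have [Qc|Qc] := pselect (exists e, Q (e %% 16)%N /\ c = ev e).
  have [e [Qe ->]] := Qc; apply: (Sec_off _ Px) => f _ Pf; apply/eqP => /ev_inj ef.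
  by have := PQ _ Pf; rewrite -ef Qe.
by apply: (Sec_off _ Qx) => e _ Qe; apply/eqP => ce; apply: Qc; exists e.
Qed.

Lemma Sec_split P Q R x : (forall k, k \in top_ev -> R k -> P k || Q k) -> Sec R x -> sum_set (Sec P) (Sec Q) x.
Proof.
move=> RPQ; have sS S := @Sec_sub C V Y w D S.
apply: span_min => [|y [n [e [Dy he Re Ey]]]]; first exact: sum_set_sub.
have [Pe|Qe] := orP (RPQ _ he Re).
  by apply: sum_setl => //; apply: span_incl; exists n, e.
by apply: sum_setr => //; apply: span_incl; exists n, e.
Qed.

Lemma Sec_D P x : Sec P x -> Sec P (D x).
Proof.
apply: (span_lin dD (Sec_sub _ _ _ _)) => y [n [e [Dy he Pe Ey]]].
by rewrite Dy; apply: (subZ _ (Sec_sub _ _ _ _)); apply: span_incl; exists n, e.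
Qed.

Lemma Sec_part P x : exists s, [/\ Sec P s, Sec (predC P) (x - s) &
  forall c, D x = c *: x -> D s = c *: s].
Proof.
have PC k : k \in top_ev -> xpredT k -> P k || predC P k by rewrite /= orbN.
have [s [t [Ps Pt ->]]] := Sec_split PC (Sec_all CI x).
exists s; split=> //; first by rewrite addrC addKr.
move=> c; rewrite (linD _ _ dD) scalerDr => E; apply/eqP; rewrite -subr_eq0; apply/eqP.
have sS S := @Sec_sub C V Y w D S.
apply: (Sec_disjoint (P := P) (Q := predC P)) => [k Pk||].
- by rewrite /= negbK.
- by apply: (subB (sS _)); [exact: Sec_D|exact: (subZ _ (sS _))].
have -> : D s - c *: s = c *: t - D t.
  by apply/eqP; rewrite subr_eq addrAC eq_sym subr_eq addrC E addrC.
by apply: (subB (sS _)); [exact: (subZ _ (sS _))|exact: Sec_D].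
Qed.

Lemma Sec_one P : P 0%N -> Sec P one.
Proof.
move=> P0; apply: span_incl; exists 0%N, 0%N; split=> //.
  have := ci_wt CI one (- 1) one; rewrite addNr scale0r subr0 !(va_creat VA) (va_vac VA) /= => E.
  by apply: (addrI (D one)); rewrite -{1}E scale0r addr0.
by rewrite /eig /= (Lw_one (one := one) w VA) // /ising_ev mul0r scale0r.
Qed.

(** The last condition concerns the conformal vector: its component outside [P] has a zero mode that
    leads from Q out of Q, so that on Q the component in [P] already acts as the derivation. *)
Lemma sector_z2 P Q : P 0%N -> (forall k, P k -> ~~ Q k) -> fus_in P P P -> fus_in P Q Q ->
  fus_in Q P Q -> fus_in Q Q P -> fus_in (predC P) Q (predC Q) ->
  exists omega, cft_z2_graded Y one (Sec P) (Sec Q) D omega.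
Proof.
move=> P0 PQ PPP PQQ QPQ QQP PcQ; have sS S := @Sec_sub C V Y w D S.
have [om [Dom Hom]] := ci_conf CI; have [s [Ps Pcs Ds]] := Sec_part P om.
have cap x : Sec P x -> Sec Q x -> x = 0 by exact: Sec_disjoint.
exists s; split.
- split=> //; first by move=> x [/cap]; exact.
  + exact: Sec_one.
  + by move=> u v n; apply: fusion_in.
  + by move=> u v n; apply: fusion_in.
  + by move=> u v n; apply: fusion_in.
  + by move=> u v n; apply: fusion_in.
- exact: dD.
- exact: (ci_wt CI).
- exact: (ci_neg CI).
- exact: (ci_zero CI).
- apply: span_mono => x [n [e [Dx he Pe Ex]]]; split; first by apply: span_incl; exists n, e.
  by exists n%:Z; rewrite /eig /= Dx.
- apply: span_mono => x [n [e [Dx he Pe Ex]]]; split; first by apply: span_incl; exists n, e.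
  by exists n%:Z; rewrite /eig /= Dx.
- move=> n; have [t [tD tspan]] := ci_fin CI n.
  have [f Hf] := choice (Sec_part Q).
  exists [seq f x | x <- t]; split=> [y /mapP[x /tD Dx ->]|y [Qy Dy]].
    by have [Qf _ Df] := Hf x; split=> //; apply: Df.
  have : sum_set (lin_span [set` [seq f x | x <- t]]) (Sec (predC Q)) y.
    move: (tspan _ Dy); apply: span_min => [|x xt]; first exact: (sum_set_sub (span_sub _)).
    have [Qf Qcf _] := Hf x; exists (f x), (x - f x); split=> //; last by rewrite addrC subrK.
    by apply: span_incl => /=; apply: map_f.
  move=> [z [r [Sz Qr E]]]; suff r0 : r = 0 by rewrite E r0 addr0.
  apply: (Sec_disjoint (P := Q) (Q := predC Q)) => [k Qk||] //; first by rewrite /= negbK.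
  have -> : r = y - z by rewrite E addrC addKr.
  apply: (subB (sS _)) => //; move: Sz; apply: span_min => // x /= /mapP[u _ ->].
  by have [] := Hf u.
- split=> //; first by apply: Ds.
  move=> y Qy; have yder : Sec Q (der Y one y) by apply: (fusion_in _ QPQ) => //; exact: Sec_one.
  have E : der Y one y - Y s 0 y = Y (om - s) 0 y.
    by rewrite (linB _ _ (va_linl VA 0 y)) Hom.
  apply/eqP; rewrite eq_sym -subr_eq0; apply/eqP.
  apply: (Sec_disjoint (P := Q) (Q := predC Q)) => [k Qk||].
  + by rewrite /= negbK.
  + by apply: (subB (sS _)) => //; apply: (fusion_in _ PQQ).
  by rewrite E; apply: (fusion_in _ PcQ).
Qed.

Definition C2_above P (N : nat) := forall (m : nat) x, (N < m)%N -> Sec P x -> D x = m%:R *: x ->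
  lin_span [set x | exists u v, [/\ Sec P u, Sec P v & x = Y u (- 2) v]] x.

Lemma sector_C2 P Q R N : {subset P <= R} -> {subset Q <= R} -> (forall k, k \in top_ev -> R k -> P k || Q k) ->
  P 0%N -> (forall k, P k -> ~~ Q k) -> fus_in P P P -> fus_in P Q Q ->
  fus_in Q P Q -> fus_in Q Q P -> fus_in (predC P) Q (predC Q) ->
  C2_above R N -> exists N', C2_above P N'.
Proof.
move=> PR QR RPQ P0 PQ H1 H2 H3 H4 H5 HR.
have [om G] := sector_z2 P0 PQ H1 H2 H3 H4 H5.
apply: (orbifold_C2 (P := N) G) => m x Nm [Dx Sx].
have Rx : Sec R x by case: Sx; apply: Sec_mono.
have := HR m x Nm Rx Dx; apply: span_min; first exact: span_sub.
set T := lin_span _; have sT : subspace T by exact: span_sub.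
move=> _ [u [v [/(Sec_split RPQ)[u1 [u2 [Pu Qu ->]]] /(Sec_split RPQ)[v1 [v2 [Pv Qv ->]]] ->]]].
rewrite (linD _ _ (va_linl VA _ _)) !(linD _ _ (va_linr VA _ _)).
apply: (subD sT); apply: (subD sT); apply: span_incl.
- by exists u1, v1; split=> //; left.
- by exists u1, v2; split=> //; [left|right].
- by exists u2, v1; split=> //; [right|left].
- by exists u2, v2; split=> //; right.
Qed.

Theorem sector0_C2 N : C2_above xpredT N -> exists N', C2_above (pred1 0%N) N'.
Proof.
move=> H0; have [N1 H1] : exists N', C2_above (pred2 0%N 8%N) N'.
  apply: (sector_C2 (P := pred2 0%N 8%N) (Q := pred1 1%N)) H0 => // k.
    by rewrite !inE => /or3P[] /eqP ->.
  by move=> /pred2P[] ->.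
apply: (sector_C2 (P := pred1 0%N) (Q := pred1 8%N)) H1 => // k.
- by rewrite !inE => ->.
- by rewrite !inE => ->; rewrite orbT.
- by move=> /eqP ->.
Qed.

End Sectors.

(** * The commutant *)

Section Commutant.
Context (C : numFieldType) (V : lmodType C) (Y : V -> int -> V -> V) (one w : V) (D : V -> V).
Hypothesis CI : cft_ising Y one D w.
Let VA := ci_va CI.
Let dD := ci_lin CI.
Local Notation L := (Lw Y w).
Local Notation L_lin := (L_lin CI).
Local Notation ev := (ising_ev C).
Local Notation off := (off Y w).
Implicit Types (x y u v a b : V) (c : C) (n m : int) (e f : nat).

Definition com : set V := [set v | L 0 v = 0].

Lemma com_ev0 v : com v <-> eig (L 0) (ev 0) v.
Proof. by rewrite /com /eig /= /ising_ev mul0r scale0r. Qed.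

Lemma com_sub : subspace com.
Proof.
split=> [|c u v]; rewrite /com /=; first exact: (lin0 (L_lin 0)).
by rewrite (L_lin 0) => -> ->; rewrite scaler0 addr0.
Qed.

(** For n > 0, L(n) would lower the eigenvalue below 0; L(-1) v vanishes as a singular vector of
    eigenvalue 1. *)
Lemma com_mode v n : com v -> 0 <= n -> Y w n v = 0.
Proof.
move=> /com_ev0 Ev n0; rewrite (Lw_mode Y w).
have [n2|n1] := ltrP 1 n; first by apply: (primary CI _ Ev) => //; lia.
have [->|n0'] := eqVneq n 1; first exact/com_ev0.
by rewrite (_ : n - 1 = - 1); [apply: (singular0 CI)|lia].
Qed.

(** L(0) acts on u_n v as a derivation up to the mode n + 1 of L(-1) u, and L(-1) u = 0. *)
Lemma com_Y u v n : com u -> com v -> com (Y u n v).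
Proof.
move=> cu cv; rewrite /com /=; have := L1_mode CI u n v.
have -> : L (- 1) u = 0 by exact: (com_mode cu (n := 0)).
rewrite (cu : L 0 u = 0) (cv : L 0 v = 0) !(Y0l VA) (Y0r VA) !subr0 => ->; exact: erefl.
Qed.

Lemma com_one : com one. Proof. exact: Lw_one. Qed.

Definition com_C2 : set V := lin_span [set x | exists u v, [/\ com u, com v & x = Y u (- 2) v]].

Lemma com_low u v n : com u -> com v -> n <= - 2 -> com_C2 (Y u n v).
Proof.
move=> cu cv n2; rewrite (_ : n = - 1 - (absz (- 2 - n)%R).+1%:Z); last by lia.
set j := absz _; have [c ->] := Y_low VA u j.+1 v.
apply: (subZ _ (span_sub _)); rewrite iterS (Y_der VA); apply: (subZ _ (span_sub _)).
apply: span_incl; exists (iter j (der Y one) u), v; split=> //.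
by elim: j => //= j IH; apply: com_Y => //; exact: com_one.
Qed.

Definition com_rest : set V := sum_set com_C2 (off (ev 0)).

Lemma com_rest_neg m x : m < 0 -> com_rest (L m x).
Proof.
move=> m0; apply: sum_setr; first exact: span_sub.
by rewrite (_ : m = - (absz m).-1.+1%:Z); [exact: (off_neg CI)|lia].
Qed.

(* Writing a and b through the L(-n), n > 0, moves all the negative modes of w to
   the left, since those of w with n >= 0 kill the commutant. *)
Lemma sector0_low e f a b n : (e %% 16 = 0)%N -> (f %% 16 = 0)%N ->
  eig (L 0) (ev e) a -> eig (L 0) (ev f) b -> n <= - 2 -> com_rest (Y a n b).
Proof.
have sR : subspace com_rest by apply: sum_set_sub; exact: span_sub.
elim/ltn_ind: e f a b n => e IH f a b n e0 f0 Ea Eb n2.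
have [e16|e15] := ltnP e 16; last first.
  move: (high_eig CI e15 Ea).
  apply: (span_lin (va_linl VA n b) sR) => _ [m [g [u [Eg Eu ->]]]].
  rewrite /Lw; apply: (iterate_in VA sR) => l.
    by rewrite (Lw_mode Y w); apply: com_rest_neg; lia.
  rewrite (Lw_mode Y w); have [->|[f' [_ Ef' Eb']]] := L_ev CI (l%:Z - 1) Eb.
    by rewrite (Y0r VA); exact: (sub0 sR).
  by apply: (IH g _ f') => //; lia.
have ca : com a by apply/com_ev0; rewrite (_ : 0%N = e) //; lia.
have [f16|f15] := ltnP f 16.
  apply: sum_setl; first exact: span_sub.
  by apply: com_low => //; apply/com_ev0; rewrite (_ : 0%N = f) //; lia.
move: (high_eig CI f15 Eb).
apply: (span_lin (va_linr VA a n) sR) => _ [m [g [u [Eg Eu ->]]]].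
have [N /(_ _ (leqnn N)) E] := commutator VA w a u (- m.+1%:Z + 1) n.
move: E; rewrite big1 => [|i _]; last by rewrite com_mode // (Y0l VA) scaler0.
by move=> /eqP; rewrite subr_eq0 => /eqP <-; apply: com_rest_neg; lia.
Qed.

Lemma com_C2_above N : C2_above Y w D (pred1 0%N) N ->
  forall (m : nat) x, (N < m)%N -> com x -> D x = m%:R *: x -> com_C2 x.
Proof.
move=> H m x Nm cx Dx.
have Sx : Sec Y w D (pred1 0%N) x.
  by apply: span_incl; exists m, 0%N; split=> //; exact/com_ev0.
have sR : subspace com_rest by apply: sum_set_sub; exact: span_sub.
have [c [z [Cc oz E]]] : com_rest x.
  have := H m x Nm Sx Dx; apply: span_min => // _ [u [v [Su Sv ->]]].
  move: u Su; apply: (span_lin (va_linl VA _ _) sR) => u [nu [e [_ he /eqP e0 Eu]]].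
  move: v Sv; apply: (span_lin (va_linr VA _ _) sR) => v [nv [f [_ hf /eqP f0 Ev]]].
  exact: (sector0_low e0 f0 Eu Ev).
have cc : com c.
  by move: Cc; apply: span_min com_sub _ _ => _ [u [v [cu cv ->]]]; exact: com_Y.
suff z0 : z = 0 by rewrite E z0 addr0.
apply: (off_eig CI oz); apply/com_ev0; rewrite (_ : z = x - c); last by rewrite E addrC addKr.
exact: (subB com_sub).
Qed.

Lemma D_L0 x : D (L 0 x) = L 0 (D x).
Proof.
rewrite /Lw (ci_wt CI) (ci_w CI) (linZ _ _ (va_linl VA _ _)) add0r.
by rewrite (_ : (1 + 1)%:~R = 2%:R :> C) // addrAC subrr add0r.
Qed.

Lemma D_off c x : off c x -> off c (D x).
Proof.
apply: (span_lin dD (off_sub _ _ _)) => u [d dc Eu]; apply: (eig_off dc).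
by rewrite /eig /= -D_L0 (Eu : _ = _) (linZ _ _ dD).
Qed.

Lemma com_part x : exists p, [/\ com p, off (ev 0) (x - p) & forall c, D x = c *: x -> D p = c *: p].
Proof.
have [p [q [/com_ev0 cp oq ->]]] := off_split CI (ev 0) x.
exists p; split=> //; first by rewrite addrC addKr.
move=> c; rewrite (linD _ _ dD) scalerDr => E; apply/eqP; rewrite -subr_eq0; apply/eqP.
apply: (off_eig CI (c := ev 0)).
  have -> : D p - c *: p = c *: q - D q.
    by apply/eqP; rewrite subr_eq addrAC eq_sym subr_eq addrC E addrC.
  by apply: (subB (off_sub _ _ _)); [exact: (subZ _ (off_sub _ _ _))|exact: D_off].
apply/com_ev0; apply: (subB com_sub); last exact: (subZ _ com_sub).
by rewrite /com /= -D_L0 (cp : L 0 p = 0) (lin0 dD).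
Qed.

(** The generators may be replaced by their components in the kernel of L(0): what is discarded lies
    in [off (ev 0)], which meets [com] in 0. *)
Lemma com_span X x : com x -> lin_span X x ->
  forall S, subspace S -> S `<=` com -> (forall y, X y -> exists2 p, S p & off (ev 0) (y - p)) -> S x.
Proof.
move=> cx Xx S sS Sc H; have [p [q [Sp oq E]]] : sum_set S (off (ev 0)) x.
  move: Xx; apply: span_min => [|y /H[p Sp oy]]; first exact: (sum_set_sub sS (off_sub _ _ _)).
  by exists p, (y - p); split=> //; rewrite addrC subrK.
suff q0 : q = 0 by rewrite E q0 addr0.
apply: (off_eig CI oq); apply/com_ev0; rewrite (_ : q = x - p); last by rewrite E addrC addKr.
by apply: (subB com_sub) => //; exact: Sc.
Qed.

Lemma com_graded x : com x -> lin_span [set y | com y /\ exists n : nat, D y = n%:R *: y] x.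
Proof.
move=> cx; apply: (com_span cx (D_span CI x)); first exact: span_sub.
  by apply: span_min com_sub _ => y [].
move=> y [n Dy]; have [p [cp op Dp]] := com_part y.
by exists p => //; apply: span_incl; split=> //; exists n; exact: Dp.
Qed.

Lemma com_fin n : exists s : seq V, (forall x, x \in s -> com x) /\
  forall x, com x -> eig D n%:~R x -> lin_span [set` s] x.
Proof.
have [t [tD tspan]] := ci_fin CI n; have [f Hf] := choice com_part.
exists [seq f x | x <- t]; split=> [x /mapP[y _ ->]|x cx Dx]; first by have [] := Hf y.
apply: (com_span cx (tspan _ Dx)); first exact: span_sub.
  by apply: span_min com_sub _ => y /= /mapP[z _ ->]; have [] := Hf z.
move=> y yt; have [_ oy _] := Hf y; exists (f y) => //.
by apply: span_incl => /=; apply: map_f.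
Qed.

Theorem com_C2_cofinite N : C2_above Y w D xpredT N ->
  exists s : seq V, (forall x, x \in s -> com x) /\
  forall x, com x -> lin_span ([set x | exists (n : nat) u v,
    [/\ (0 < n)%N, D u = n%:R *: u, com u, com v & x = Y u (- 2) v]] `|` [set` s]) x.
Proof.
move=> /(sector0_C2 CI)[N0 /com_C2_above H].
have [s [sc Hs]] : exists s : seq V, (forall x, x \in s -> com x) /\
    forall (m : nat) x, (m < N0.+1)%N -> com x -> D x = m%:R *: x -> lin_span [set` s] x.
  elim: N0.+1 => [|k [s [sc Hs]]]; first by exists [::].
  have [t [tc Ht]] := com_fin k%:Z.
  exists (t ++ s); split=> [x|m x]; first by rewrite mem_cat => /orP[/tc|/sc].
  rewrite ltnS leq_eqVlt => /orP[/eqP ->|mk] cx Dx.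
    by apply: span_mono (Ht x cx Dx) => y /=; rewrite mem_cat => ->.
  by apply: span_mono (Hs m x mk cx Dx) => y /=; rewrite mem_cat => ->; rewrite orbT.
exists s; split=> // x /com_graded; apply: span_min => [|y [cy [m Dy]]]; first exact: span_sub.
have [mN|Nm] := ltnP m N0.+1.
  by apply: span_mono (Hs m y mN cy Dy) => z zs; right.
have := H m y Nm cy Dy; apply: span_min => [|_ [u [v [cu cv ->]]]]; first exact: span_sub.
(* The C2-space of a module only admits v of positive weight; in weight 0, v is a multiple of the
   vacuum and v_(-2) = 0. *)
move: (com_graded cu) => {cu}; apply: (span_lin (va_linl VA _ _) (span_sub _)) => {}u [cu [[|k] Du]].
  have [c ->] : exists c, u = c *: one by apply: (ci_zero CI); rewrite Du scale0r.
  by rewrite (linZ _ _ (va_linl VA _ _)) (va_vac VA) scaler0; exact: (sub0 (span_sub _)).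
by apply: span_incl; left; exists k.+1, u, v.
Qed.

End Commutant.

(** * A subspace as a module *)

Section Carrier.
Context (C : numFieldType) (M : lmodType C) (S : set M).

(** The proof [sS] is an argument so that the closure instance can be attached to the predicate,
    which gives [carrier] its module structure. *)
Definition in_sub (sS : subspace S) : pred M := fun x => `[< S x >].

Variable sS : subspace S.

Fact in_sub_closed : submod_closed (in_sub sS).
Proof.
split=> [|a u v /asboolP Su /asboolP Sv]; apply/asboolP; first exact: (sub0 sS).
exact: sS.2.
Qed.

HB.instance Definition _ := GRing.isSubmodClosed.Build C M (in_sub sS) in_sub_closed.

Record carrier := Carrier { cval : M; _ : cval \in in_sub sS }.

HB.instance Definition _ := [isSub for cval].
HB.instance Definition _ := [Choice of carrier by <:].
HB.instance Definition _ := [SubChoice_isSubLmodule of carrier by <:].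

(* Equal to 0 outside S. *)
Definition inc (x : M) : carrier := insubd (0 : carrier) x.

Lemma cval_in (x : carrier) : S (cval x).
Proof. by case: x => x /= /asboolP. Qed.

Lemma incK x : S x -> cval (inc x) = x.
Proof. by move=> Sx; apply: insubdK; apply/asboolP. Qed.

Lemma cvalK x : inc (cval x) = x.
Proof. by apply: val_inj; rewrite /= incK //; exact: cval_in. Qed.

Lemma cval_lin (a : C) (x y : carrier) : cval (a *: x + y) = a *: cval x + cval y.
Proof. by []. Qed.

End Carrier.

(** * Vertex operator algebras as vertex algebras on a module *)

Section Typed.
Context (C : numFieldType) (M : lmodType C) (V : voa_data M).
Hypothesis HV : is_voa V.
Let sV := voa_subspace HV.
Local Notation T := (carrier sV).
Local Notation inc := (inc sV).
Implicit Types (x y z : T) (u v : M) (n m : int).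

Definition tmode x n y : T := inc (mode V (cval x) n (cval y)).
Definition tone : T := inc (vac V).
Definition tconf : T := inc (conf V).
Definition tD x : T := tmode tconf 1 x.

Lemma cval_inj : injective (@cval C M (space V) sV). Proof. exact: val_inj. Qed.

Lemma cval_mode x n y : cval (tmode x n y) = mode V (cval x) n (cval y).
Proof. by apply: incK; apply: (voa_closed HV); exact: cval_in. Qed.

Lemma space_vac : space V (vac V). Proof. by have [] := voa_vac_weight HV. Qed.
Lemma space_conf : space V (conf V). Proof. by have [] := voa_conf_weight HV. Qed.

Lemma cval_one : cval tone = vac V. Proof. exact: incK space_vac. Qed.
Lemma cval_conf : cval tconf = conf V. Proof. exact: incK space_conf. Qed.

Lemma cvalD x y : cval (x + y) = cval x + cval y. Proof. by []. Qed.
Lemma cvalZ c x : cval (c *: x) = c *: cval x. Proof. by []. Qed.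
Lemma cvalN x : cval (- x) = - cval x. Proof. by []. Qed.
Lemma cval0 : cval (0 : T) = 0. Proof. by []. Qed.
Lemma cval_sum (I : Type) (r : seq I) (P : pred I) (F : I -> T) :
  cval (\sum_(i <- r | P i) F i) = \sum_(i <- r | P i) cval (F i).
Proof. by apply: (big_morph _ cvalD cval0). Qed.

Lemma span_cval X x : X `<=` space V -> lin_span X (cval x) -> lin_span [set y | X (cval y)] x.
Proof.
move=> XS; rewrite -{2}(cvalK x); move: (cval x); suff H u : lin_span X u ->
    space V u /\ lin_span [set y | X (cval y)] (inc u) by move=> u /H[].
move: u; apply: span_min => [|u Xu]; last first.
  by split; [exact: XS|apply: span_incl; rewrite /= incK //; exact: XS].
split=> [|c u v [Su Hu] [Sv Hv]].
  split; first exact: (sub0 sV); have -> : inc 0 = 0 by apply: cval_inj; rewrite incK //; exact: (sub0 sV).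
  exact: (sub0 (span_sub _)).
split; first exact: sV.2; have -> : inc (c *: u + v) = c *: inc u + inc v.
  by apply: cval_inj; rewrite cval_lin !incK //; exact: sV.2.
exact: (span_sub _).2.
Qed.

Lemma cval_span X (S : set M) x : subspace S -> (forall y, X y -> S (cval y)) ->
  lin_span X x -> S (cval x).
Proof.
move=> sS XS; move: x; apply: span_min => // [].
by split=> [|c x y Sx Sy]; [exact: (sub0 sS)|exact: sS.2].
Qed.

Lemma typed_va : vertex_algebra tmode tone.
Proof.
have cin x := cval_in x; split.
- move=> m z c x y; apply: cval_inj.
  by rewrite cval_lin !cval_mode cval_lin (voa_linl HV).
- move=> z m c x y; apply: cval_inj.
  by rewrite cval_lin !cval_mode cval_lin (voa_linr HV).
- move=> x y; have [K HK] := voa_truncation HV (cin x) (cin y).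
  by exists K => m Km; apply: cval_inj; rewrite cval_mode HK.
- move=> x m; apply: cval_inj; rewrite cval_mode cval_one (voa_vacuum HV) //.
  by case: ifP.
- by move=> x; apply: cval_inj; rewrite cval_mode cval_one; have [] := voa_creation HV (cin x).
- move=> x m m0; apply: cval_inj; rewrite cval_mode cval_one.
  by have [_] := voa_creation HV (cin x); apply.
move=> x y z p q r; have [N0 H] := voa_jacobi HV (cin x) (cin y) (cin z) p q r.
exists N0 => K KN; apply: cval_inj; rewrite !cval_sum; under eq_bigr => i _ do rewrite cvalZ !cval_mode.
rewrite H //; apply: eq_bigr => i _.
by rewrite cvalZ cvalD cvalN cvalZ !cval_mode.
Qed.

Lemma tD_lin : lin tD. Proof. exact: (va_linr typed_va). Qed.

Lemma cval_D x : cval (tD x) = Lop V 0 (cval x).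
Proof. by rewrite cval_mode cval_conf. Qed.

Lemma weightP n x : weight_space V n (cval x) <-> tD x = n%:~R *: x.
Proof.
split=> [[_ E]|E]; first by apply: cval_inj; rewrite cval_D E.
by split; [exact: cval_in|rewrite -cval_D E].
Qed.

Lemma conf0 x n y : tmode (tmode tconf 0 x) n y = - n%:~R *: tmode x (n - 1) y.
Proof.
apply: cval_inj; rewrite cvalZ !cval_mode cval_conf.
exact: (voa_derivative HV n (cval_in x) (cval_in y)).
Qed.

Lemma conf_der x : tmode tconf 0 x = der tmode tone x.
Proof.
have := conf0 x (- 1) tone; rewrite (va_creat typed_va) => ->.
by rewrite rmorphN opprK scale1r.
Qed.

Lemma typed_wt x k y : tD (tmode x k y) =
  tmode (tD x) k y + tmode x k (tD y) - (k + 1)%:~R *: tmode x k y.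
Proof.
have [N0 /(_ (N0 + 2)%N (leq_addr _ _)) E] := commutator typed_va tconf x y 1 k; move: E.
rewrite (sum_stable (F := fun i : nat => binz C 1 i *: tmode (tmode tconf i%:Z x) (1 + k - i%:Z) y)
  (leq_addl N0 2)) => [|i hi]; last by rewrite (@binz_nat C 1) ?scale0r.
rewrite !big_ord_recr big_ord0 /= binz0 binz1 add0r !scale1r.
have -> : 1 + k - 0 = k + 1 by lia.
have -> : 1 + k - 1 = k by lia.
change (tmode tconf 0%Z x) with (tmode tconf 0 x); rewrite conf0 addrK => /eqP.
by rewrite subr_eq => /eqP E; rewrite /tD E scaleNr -addrA addrC.
Qed.

Lemma typed_graded x : lin_span [set y | exists n : int, eig tD n%:~R y] x.
Proof.
have sub : \bigcup_n weight_space V n `<=` space V by move=> u [n _ []].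
apply: span_mono (span_cval sub (voa_graded HV (cval_in x))) => y [n _ /weightP Dy].
by exists n.
Qed.

Lemma typed_fin n : exists s : seq T, (forall x, x \in s -> eig tD n%:~R x) /\
  eig tD n%:~R `<=` lin_span [set` s].
Proof.
have [s [ss Hs]] := voa_fin_dim HV n.
have sub : [set` s] `<=` space V by move=> u /ss[].
exists (map inc s); split=> [x /mapP[u us ->]|x /weightP/Hs Hx].
  by apply/weightP; rewrite incK; [exact: ss|exact: sub].
have sub' : [set 0] `|` [set` s] `<=` space V by move=> u [->|/sub//]; exact: (sub0 sV).
move: (span_cval sub' Hx); apply: span_min => [|y [y0|ys]]; first exact: span_sub.
  have -> : y = 0 by apply: cval_inj.
  exact: (sub0 (span_sub _)).
apply: span_incl; rewrite /= -(cvalK y); exact: map_f.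
Qed.

Hypothesis CV : CFT_type V.

Lemma typed_neg n : n < 0 -> eig tD n%:~R `<=` [set 0].
Proof. by move=> /(proj1 CV) H x /weightP/H E; apply: cval_inj. Qed.

Lemma typed_zero x : tD x = 0 -> exists c, x = c *: tone.
Proof.
move=> Dx; have : weight_space V 0 (cval x) by apply/weightP; rewrite Dx scale0r.
rewrite (proj2 CV) => -[c _ E]; exists c; apply: cval_inj.
by rewrite cvalZ cval_one E.
Qed.

Hypothesis C2V : C2_cofinite V.

(** Finite codimension turned into a bound on weights: the finitely many representatives have
    components of weight at most N, which disappear when the component of weight m > N of a spanning
    expression is taken. *)
Lemma typed_C2 : exists N : nat, forall (m : nat) x, (N < m)%N -> tD x = m%:R *: x ->
  lin_span [set z | exists x y, z = tmode x (- 2) y] x.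
Proof.
have [s [ss Hs]] := C2V.
pose X N : set T := [set z | (exists n : int, tD z = n%:~R *: z) /\
  ((exists x y, z = tmode x (- 2) y) \/ exists2 m : nat, (m <= N)%N & tD z = m%:R *: z)].
have Xmono N N' : (N <= N')%N -> lin_span (X N) `<=` lin_span (X N').
  move=> NN; apply: span_mono => z [h [h'|[m mN Dm]]]; split=> //; [by left|right].
  by exists m => //; lia.
have Xlow x : exists N, lin_span (X N) x.
  move: x (typed_graded x); apply: span_min => [|x [n Dx]].
    split=> [|c x y [N1 H1] [N2 H2]]; first by exists 0%N; exact: (sub0 (span_sub _)).
    exists (maxn N1 N2); apply: (span_sub _).2.
      exact: (Xmono _ _ (leq_maxl _ _) _ H1).
    exact: (Xmono _ _ (leq_maxr _ _) _ H2).
  have [n0|n0] := ltrP n 0.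
    by exists 0%N; rewrite (typed_neg n0 Dx); exact: (sub0 (span_sub _)).
  exists (absz n); apply: span_incl; split; first by exists n.
  by right; exists (absz n); rewrite // pmulrn (gez0_abs n0).
have [N HN] : exists N, forall u, u \in s -> lin_span (X N) (inc u).
  elim: s {ss Hs} => [|u s [N IH]]; first by exists 0%N.
  have [N' H'] := Xlow (inc u); exists (maxn N N') => v; rewrite inE => /predU1P[->|/IH].
    exact: (Xmono _ _ (leq_maxr _ _) _ H').
  exact: (Xmono _ _ (leq_maxl _ _)).
have sub : C2_space V (space V) (mode V) `|` [set` s] `<=` space V.
  move=> u [|/ss//]; apply: span_min => // _ [n [v [y [_ [Sv _] Sy ->]]]].
  exact: (voa_closed HV).
exists N => m x mN Dx.
have {}Hx : lin_span (X N) x.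
  have := span_cval sub (Hs _ (cval_in x)); apply: span_min => [|y [|/HN]]; first exact: span_sub.
    have sub2 : [set x | exists (n : int) (v u : M), [/\ 0 < n, weight_space V n v, space V u &
       x = mode V v (- 2) u]] `<=` space V.
      by move=> _ [n [v [u [_ [Sv _] Su ->]]]]; exact: (voa_closed HV).
    move=> /(span_cval sub2); apply: span_min => [|z [n [v [u [n0 [Sv Wv] Su Ez]]]]].
      exact: span_sub.
    have -> : z = tmode (inc v) (- 2) (inc u) by apply: cval_inj; rewrite cval_mode !incK.
    have Dv : tD (inc v) = n%:~R *: inc v by apply/weightP; rewrite incK.
    move: (inc u) (typed_graded (inc u)).
    apply: (span_lin (va_linr typed_va _ _) (span_sub _)) => t [k Dt].
    apply: span_incl; split; last by left; exists (inc v), t.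
    exists (n + k - (- 2 + 1)); rewrite typed_wt Dv (Dt : tD t = _).
    rewrite (linZ _ _ (va_linl typed_va _ _)) (linZ _ _ (va_linr typed_va _ _)).
    by rewrite -scalerDl -scalerBl -!rmorphD /= -rmorphB.
  by rewrite cvalK.
have := eig_span tD_lin _ (conj (Dx : eig tD _ x) Hx) => H.
have {H} : lin_span (X N `&` eig tD m%:R) x by apply: H => z [[n Dz] _]; exists n%:~R.
apply: span_min => [|z [[_ [h|[k kN Dz]]] Dm]]; first exact: span_sub.
  by apply: span_incl.
rewrite (_ : z = 0); first exact: (sub0 (span_sub _)).
apply: (eig_disjoint tD_lin _ Dm Dz); rewrite eqr_nat; lia.
Qed.

End Typed.

(** * Transport along the isomorphism with the Ising model *)

Section Transfer.
Context (C : numFieldType) (M : lmodType C) (V : voa_data M) (U : set M) (omegaU : M).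
Context (N : lmodType C) (L : voa_data N).
Hypothesis HV : is_voa V.
Hypothesis CV : CFT_type V.
Hypothesis HU : is_subvoa V U omegaU.
Hypothesis HL : is_simple_Virasoro_voa L (1 / 2%:R).
Hypothesis HI : voa_isomorphic (sub_data V U omegaU) L.
Let sV := voa_subspace HV.
Let VA := typed_va HV.
Local Notation T := (carrier sV).
Local Notation inc := (inc sV).
Local Notation Y := (@tmode C M V HV).
Local Notation one := (@tone C M V HV).
Local Notation D := (@tD C M V HV).
Implicit Types (x y z : T) (u v : M) (n m : int).

Let HUV : U `<=` space V. Proof. by have [] := HU. Qed.
Let voaU : is_voa (sub_data V U omegaU). Proof. by have [] := HU. Qed.
Let sU : subspace U. Proof. exact: (voa_subspace voaU). Qed.
Let U_w : U omegaU. Proof. by have [] := voa_conf_weight voaU. Qed.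

Definition ising : T := inc omegaU.
Definition tU : set T := [set x | U (cval x)].

Lemma cval_ising : cval ising = omegaU. Proof. exact: incK (HUV U_w). Qed.

Lemma tU_sub : subspace tU.
Proof.
split=> [|c x y Ux Uy]; first exact: (sub0 sU).
exact: sU.2.
Qed.

Lemma tU_one : tU one.
Proof. by rewrite /tU /= cval_one; have [] := voa_vac_weight voaU. Qed.

Lemma tU_ising : tU ising. Proof. by rewrite /tU /= cval_ising. Qed.

Lemma tU_closed x y n : tU x -> tU y -> tU (Y x n y).
Proof. by move=> Ux Uy; rewrite /tU /= cval_mode; apply: (voa_closed voaU). Qed.

Lemma iso_ex : exists f : T -> N, [/\ forall x, tU x -> space L (f x),
  forall v : N, space L v -> exists2 x, tU x & f x = v,
  forall x y, tU x -> tU y -> f x = f y -> x = y,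
  forall c x y, tU x -> tU y -> f (c *: x + y) = c *: f x + f y &
  [/\ forall x y n, tU x -> tU y -> f (Y x n y) = mode L (f x) n (f y),
  f one = vac L & f ising = conf L]].
Proof.
have [f [[f1 f3 f2] flin fmode fvac fconf]] := HI; exists (fun x => f (cval x)).
split; [by move=> x Ux; exact: f1|move=> y /f2[u Uu <-]|move=> x y Ux Uy E| |split].
- by exists (inc u); [rewrite /tU /=|]; rewrite incK //; exact: HUV.
- by apply: cval_inj; apply: f3 => //; exact: mem_set.
- by move=> c x y Ux Uy; rewrite cval_lin flin.
- by move=> x y n Ux Uy; rewrite cval_mode fmode.
- by rewrite cval_one.
- by rewrite cval_ising.
Qed.

Lemma tU_charge m n x : tU x -> Y ising (m + 1) (Y ising (n + 1) x) - Y ising (n + 1) (Y ising (m + 1) x) =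
  (m - n)%:~R *: Y ising (m + n + 1) x +
  (if m + n == 0 then ((m ^+ 3 - m)%:~R / 12%:R * (1 / 2%:R)) *: x else 0).
Proof.
move=> Ux; have [f [f1 _ finj flin [fmode fvac fconf]]] := iso_ex.
have [_ charge _ _] := HL.
have Uw := tU_ising; have UY y k : tU y -> tU (Y ising k y) by exact: tU_closed.
have fD y z : tU y -> tU z -> f (y + z) = f y + f z.
  by move=> Uy Uz; rewrite -{1}(scale1r y) flin // scale1r.
have f0 : f 0 = 0.
  apply: (addrI (f 0)); rewrite addr0 -[in RHS](addr0 (0 : T)) fD //; exact: (sub0 tU_sub).
have fZ c y : tU y -> f (c *: y) = c *: f y.
  by move=> Uy; rewrite -(addr0 (c *: y)) flin ?f0 ?addr0 //; exact: (sub0 tU_sub).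
have fB y z : tU y -> tU z -> f (y - z) = f y - f z.
  move=> Uy Uz; rewrite fD //; last exact: (subN tU_sub).
  by rewrite -(scaleN1r z) fZ // scaleN1r.
have UZ c y : tU y -> tU (c *: y) by exact: (subZ _ tU_sub).
apply: finj.
- by apply: (subB tU_sub); auto.
- apply: (subD tU_sub); first by auto.
  by case: ifP => _; [auto|exact: (sub0 tU_sub)].
have U2 : tU (if m + n == 0 then ((m ^+ 3 - m)%:~R / 12%:R * (1 / 2%:R)) *: x else 0).
  by case: ifP => _; [auto|exact: (sub0 tU_sub)].
rewrite fB ?fD ?fZ ?fmode //; auto.
rewrite fconf charge; last exact: f1.
by case: ifP => _; rewrite ?fZ ?f0.
Qed.

Lemma tU_comm m n p q r k x : m + n + 1 = r -> tU x -> m + 1 = p -> n + 1 = q -> m - n = k ->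
  Y ising p (Y ising q x) = Y ising q (Y ising p x) + k%:~R *: Y ising r x +
  (if m + n == 0 then ((m ^+ 3 - m)%:~R / 12%:R * (1 / 2%:R)) *: x else 0).
Proof.
move=> <- Ux <- <- <-; apply/eqP; rewrite -addrA addrC -subr_eq; apply/eqP.
exact: tU_charge.
Qed.

Lemma tU_gen (S : set T) : subspace S -> S one -> S ising ->
  (forall x y n, S x -> S y -> S (Y x n y)) -> tU `<=` S.
Proof.
move=> sS S1 Sw SY x Ux; have [f [f1 _ finj flin [fmode fvac fconf]]] := iso_ex.
have [_ _ gen _] := HL.
have : [set v : N | exists y, [/\ tU y, S y & f y = v]] (f x).
  apply: gen; last exact: f1.
  - split=> [|c _ _ [y [Uy Sy <-]] [z [Uz Sz <-]]].
      exists 0; split; [exact: (sub0 tU_sub)|exact: (sub0 sS)|].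
      have U0 := sub0 tU_sub; have := flin (- 1) 0 0 U0 U0.
      by rewrite scaler0 addr0 scaleN1r addNr.
    by exists (c *: y + z); split; [exact: tU_sub.2|exact: sS.2|exact: flin].
  - by exists one; split=> //; exact: tU_one.
  - by exists ising; split=> //; exact: tU_ising.
  move=> _ _ n [y [Uy Sy <-]] [z [Uz Sz <-]].
  by exists (Y y n z); split; [exact: tU_closed|exact: SY|exact: fmode].
by move=> [y [Uy Sy /finj <-]].
Qed.

Lemma tU_simple (S : set T) : subspace S -> S `<=` tU ->
  (forall x y n, tU x -> S y -> S (Y x n y) /\ S (Y y n x)) -> S `<=` [set 0] \/ tU `<=` S.
Proof.
move=> sS SU SY; have [f [f1 fsur finj flin [fmode fvac fconf]]] := iso_ex.
have [_ _ _ [_ simple]] := HL; have U0 := sub0 tU_sub.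
have f0 : f 0 = 0 by have := flin (- 1) 0 0 U0 U0; rewrite scaler0 addr0 scaleN1r addNr.
have [|H|H] := simple [set v : N | exists2 y, S y & f y = v].
- split.
  + split=> [|c _ _ [y Sy <-] [z Sz <-]]; first by exists 0 => //; exact: (sub0 sS).
    by exists (c *: y + z); [exact: sS.2|apply: flin; exact: SU].
  + by move=> _ [y Sy <-]; apply: f1; exact: SU.
  move=> _ _ n /fsur[y Uy <-] [z Sz <-]; have [S1 S2] := SY y z n Uy Sz.
  by split; [exists (Y y n z)|exists (Y z n y)] => //; apply: fmode => //; exact: SU.
- left=> x Sx; have : [set v : N | exists2 y, S y & f y = v] (f x) by exists x.
  by rewrite H => E; apply: finj => //; [exact: SU|rewrite f0].
right=> x Ux; have : space L (f x) by exact: f1.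
by rewrite -H => -[y Sy /finj <-] //; exact: SU.
Qed.

Lemma typed_ising : cft_ising Y one D ising.
Proof.
have w_one : ising = Y ising (- 2 + 1) one by rewrite (va_creat VA).
have one0 n : 0 <= n -> Y ising (- 1) (Y ising n one) = 0.
  by move=> n0; rewrite (va_annih VA) // (Y0r VA).
(* Since w = w_(-1) 1, for p >= 0 the product w_p w is a commutator on the vacuum: p + 1 times
   w_(p-2) 1, with a central term for p = 3 only. *)
have comm p r k : 0 <= p -> p - 2 = r -> p + 1 = k -> p != 3 ->
    Y ising p ising = k%:~R *: Y ising r one.
  move=> p0 rE kE p3; rewrite {2}w_one.
  by rewrite (tU_comm (m := p - 1) (n := - 2) (r := r) (k := k) _ tU_one) ?one0 ?add0r ?ifN ?addr0 //; lia.
have w0 : Y ising 0 ising = der Y one ising.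
  by rewrite (comm 0 (- 2) 1) // scale1r.
have w1 : Y ising 1 ising = 2%:R *: ising.
  by rewrite (comm 1 (- 1) 2) // (va_creat VA).
have w2 : Y ising 2 ising = 0.
  by rewrite (comm 2 0 3) // (va_annih VA) // scaler0.
have w3 : Y ising 3 ising = 4%:R^-1 *: one.
  rewrite {2}w_one (tU_comm (m := 2) (n := - 2) (r := 1) (k := 4) _ tU_one) // one0 // (va_annih VA) //.
  rewrite scaler0 !add0r; congr (_ *: _).
  rewrite (_ : (2 ^+ 3 - 2)%:~R = 6%:R :> C) //; by field.
have wn (n : nat) : (3 < n)%N -> Y ising n%:Z ising = 0.
  move=> n3; rewrite (comm n%:Z (n%:Z - 2) (n%:Z + 1)) ?(va_annih VA) ?scaler0 //; lia.
split=> //.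
- exact: tD_lin.
- exact: typed_wt.
- exact: typed_neg.
- exact: typed_zero.
- exact: typed_graded.
- exact: typed_fin.
- exists (@tconf C M V HV); split; last exact: conf_der.
  have /weightP : weight_space V 2 (cval (@tconf C M V HV)); last exact.
  by rewrite cval_conf; exact: (voa_conf_weight HV).
- have /weightP : weight_space V 2 (cval ising); last exact.
  by rewrite cval_ising; have [] := HU.
by apply: (Z_cubic VA w0 w1 w2 w3 wn tU_sub tU_one tU_ising tU_closed tU_gen tU_simple).
Qed.

(** One mode of one vector is enough: a vector killed by w_1 is killed by all nonnegative modes of
    w, and the vectors whose nonnegative modes kill it form a subalgebra, which contains U because w
    generates U. *)
Lemma commutantP x : commutant V U (cval x) <-> com Y ising x.
Proof.
split=> [[_ H]|cx].
  apply: cval_inj; rewrite /Lw cval_mode cval_ising; exact: (H _ 1 U_w).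
split=> [|u m Uu m0]; first exact: cval_in.
have : [set z | forall n, 0 <= n -> Y z n x = 0] (inc u).
  have Uiu : tU (inc u) by rewrite /tU /= incK //; exact: HUV.
  apply: (tU_gen _ _ _ _ Uiu).
  - split=> [n n0|c y z Hy Hz n n0]; first exact: (Y0l VA).
    by rewrite (va_linl VA n x) Hy // Hz // scaler0 addr0.
  - by move=> n n0; rewrite (va_vac VA) //; case: eqP n0 => // ->.
  - by move=> n n0; exact: (com_mode typed_ising cx n0).
  move=> y z k Hy Hz n n0; apply: (iterate_in (S := [set 0]) VA (@set0_sub _ _)) => i /=.
    by rewrite Hz ?(Y0r VA) //; lia.
  by rewrite Hy // (Y0r VA).
move=> /(_ m m0)/(congr1 (@cval C M (space V) sV)); rewrite cval_mode incK //; exact: HUV.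
Qed.

Hypothesis C2V : C2_cofinite V.

Theorem commutant_C2_cofinite : C2_cofinite (commutant_voa V U omegaU).
Proof.
have [N0 HN] := typed_C2 HV CV C2V.
have [s [sc Hs]] : exists s : seq T, (forall x, x \in s -> com Y ising x) /\
  forall x, com Y ising x -> lin_span ([set x | exists (n : nat) y z,
    [/\ (0 < n)%N, D y = n%:R *: y, com Y ising y, com Y ising z & x = Y y (- 2) z]] `|` [set` s]) x.
  apply: (com_C2_cofinite typed_ising (N := N0)) => m x mN _ Dx.
  have := HN m x mN Dx; apply: span_mono => _ [y [z ->]].
  by exists y, z; split=> //; exact: (Sec_all typed_ising).
exists (map (@cval _ _ _ _) s); split=> [_ /= /mapP[x /sc/commutantP cx ->] //|u cu].
have Su : space V u by have [] := cu.
rewrite -(incK sV Su); apply: cval_span (Hs (inc u) _) => [|x [|xs]|]; first exact: span_sub.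
- move=> [n [y [z [n0 Dy /commutantP cy /commutantP cz ->]]]]; apply: span_incl; left.
  apply: span_incl; exists n%:Z, (cval y), (cval z); split=> //; last by rewrite cval_mode.
  split=> //; rewrite /Lop /=.
  have [_ Ey] : weight_space V n%:Z (cval y) by apply/weightP; rewrite Dy.
  have wy : mode V omegaU (0 + 1) (cval y) = 0 by have [_] := cy; apply.
  rewrite -[conf V - omegaU]addrC -scaleN1r (voa_linl HV) ?wy ?scaler0 ?add0r //.
  + exact: HUV.
  + exact: space_conf.
  + exact: cval_in.
- by apply: span_incl; right; rewrite /=; exact: map_f.
by apply/commutantP; rewrite incK.
Qed.

End Transfer.

Theorem corollary3 (R : realType) (M : lmodType R[i]) (V : voa_data M)
    (U : set M) (omegaU : M) (N : lmodType R[i]) (L : voa_data N) :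
  is_voa V -> CFT_type V -> C2_cofinite V ->
  is_subvoa V U omegaU ->
  is_simple_Virasoro_voa L (1 / 2%:R) ->
  voa_isomorphic (sub_data V U omegaU) L ->
  C2_cofinite (commutant_voa V U omegaU).
Proof.
by move=> HV CV C2V HU HL HI; exact: (commutant_C2_cofinite HV CV HU HL HI C2V).
Qed.
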